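(* Let $d\in\mathbb{N}$, $1\leqslant p<\infty$, $1\leqslant\theta\leqslant\infty$, $l\in\mathbb{N}$, $\alpha>\frac{d}{p}$, and let $\Omega\in\Phi_{\alpha,l}$. Then $$\mathcal{E}_n\big(B^{\Omega}_{p,\theta}(\mathbb{R}^d)\big)_{L_{\infty}(\mathbb{R}^d)}\asymp \Omega(2^{-n})\,2^{\frac{nd}{p}},$$ that is, there exist constants $c,C>0$, independent of $n$ (they may depend on $d,p,\theta,\alpha,l,\Omega$), such that for all $n\in\mathbb{N}$ $$c\,\Omega(2^{-n})2^{\frac{nd}{p}}\leqslant \mathcal{E}_n\big(B^{\Omega}_{p,\theta}(\mathbb{R}^d)\big)_{L_{\infty}(\mathbb{R}^d)}\leqslant C\,\Omega(2^{-n})2^{\frac{nd}{p}}.$$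
   Context: $L_p(\mathbb{R}^d)$, $1\leqslant p\leqslant\infty$, is the usual Lebesgue space of (complex-valued) functions with its usual norm. **The set $\Phi_{\alpha,l}$** ($\alpha>0$, $l\in\mathbb{N}$). It consists of all continuous functions $\Omega:[0,\infty)\to[0,\infty)$ such that: (1) $\Omega(0)=0$ and $\Omega(t)>0$ for $t>0$; (2) $\Omega$ is nondecreasing; (3) there is $C_1>0$ with $\Omega(nt)\leqslant C_1n^l\Omega(t)$ for all $n\in\mathbb{Z}_+$ and $t\geqslant 0$; $(S^{\alpha})$ $\Omega(\tau)/\tau^{\alpha}$ is almost increasing: there is $C_2>0$ with $\Omega(\tau_1)/\tau_1^{\alpha}\leqslant C_2\,\Omega(\tau_2)/\tau_2^{\alpha}$ for all $0<\tau_1\leqslant\tau_2\leqslant 1$; $(S_l)$ there are $\gamma$ with $0<\gamma<l$ and $C_3>0$ such that $\Omega(\tau_1)/\tau_1^{l-\gamma}\geqslant C_3\,\Omega(\tau_2)/\tau_2^{l-\gamma}$ for all $0<\tau_1\leqslant\tau_2\leqslant1$. **De la Vallée Poussin sums.** For $s\in\mathbb{Z}_+=\{0,1,2,\dots\}$ let $$V_{2^s}(\boldsymbol{x})=\frac{1}{2^{sd}}\prod_{j=1}^{d}\frac{\cos 2^s x_j-\cos 2^{s+1}x_j}{x_j^2},\qquad \boldsymbol{x}\in\mathbb{R}^d,$$ which belongs to $L_1(\mathbb{R}^d)\cap L_\infty(\mathbb{R}^d)$. For $f\in L_p(\mathbb{R}^d)$, $1\leqslant p\leqslant\infty$, put $$\sigma_{2^s}(f,\boldsymbol{x})=\frac{1}{\pi^d}\int_{\mathbb{R}^d}V_{2^s}(\boldsymbol{x}-\boldsymbol{u})f(\boldsymbol{u})\,d\boldsymbol{u},$$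 $q_0(f,\cdot)=\sigma_{2^0}(f,\cdot)$, and $q_s(f,\cdot)=\sigma_{2^s}(f,\cdot)-\sigma_{2^{s-1}}(f,\cdot)$ for $s\in\mathbb{N}$. **The class $B^{\Omega}_{p,\theta}(\mathbb{R}^d)$.** For $1\leqslant p,\theta\leqslant\infty$ it is the unit ball $\{f\in L_p(\mathbb{R}^d):\|f\|_{B^{\Omega}_{p,\theta}(\mathbb{R}^d)}\leqslant 1\}$, where $$\|f\|_{B^{\Omega}_{p,\theta}(\mathbb{R}^d)}=\Big(\sum_{s=0}^{\infty}\big(\Omega(2^{-s})\big)^{-\theta}\|q_s(f,\cdot)\|^{\theta}_{L_p(\mathbb{R}^d)}\Big)^{1/\theta}\ (1\leqslant\theta<\infty),\qquad \|f\|_{B^{\Omega}_{p,\infty}(\mathbb{R}^d)}=\sup_{s\geqslant0}\big(\Omega(2^{-s})\big)^{-1}\|q_s(f,\cdot)\|_{L_p(\mathbb{R}^d)}.$$ **Approximation quantity.** For $n\in\mathbb{N}$ let $\mathbb{V}_{n-1}(f,\cdot)=\sum_{s=0}^{n-1}q_s(f,\cdot)$, $\mathcal{E}_n(f)_{L_q(\mathbb{R}^d)}=\|f-\mathbb{V}_{n-1}(f,\cdot)\|_{L_q(\mathbb{R}^d)}\in[0,\infty]$, and for a class $F$ of functions $\mathcal{E}_n(F)_{L_q(\mathbb{R}^d)}=\sup_{f\in F}\mathcal{E}_n(f)_{L_q(\mathbb{R}^d)}$. *)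

(* Defs.v *)
From HB Require Import structures.
From mathcomp Require Import all_boot all_order all_algebra.
From mathcomp Require Import complex.
From mathcomp Require Import all_classical all_reals all_analysis.

Set Implicit Arguments.
Unset Strict Implicit.
Unset Printing Implicit Defensive.

Import Order.TTheory GRing.Theory Num.Theory.
Import numFieldNormedType.Exports.

Local Open Scope classical_set_scope.
Local Open Scope ring_scope.

(* R^d, with the product (= Borel) sigma-algebra that the library puts on
   tuples. *)
Notation Rd R d := (d.-tuple (measurableTypeR R)).

(** * Lebesgue measure on R^d *)

Definition cons_Rd {R : realType} {d : nat}
  (x : measurableTypeR R * Rd R d) : Rd R d.+1 := [tuple of x.1 :: x.2].

Lemma measurable_cons_Rd {R : realType} {d : nat} :
  measurable_fun setT (@cons_Rd R d).
Proof. exact: measurable_cons. Qed.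

Section lebesgue_measure_S.
Context {R : realType} {d : nat}.
Variable m : {sigma_finite_measure set (Rd R d) -> \bar R}.
Local Open Scope ereal_scope.

(* The product of the Lebesgue measure on R with m, carried to R^(d+1). *)
Definition lebesgue_measure_S : set (Rd R d.+1) -> \bar R :=
  pushforward (lebesgue_measure \x m) cons_Rd.

Let lms0 : lebesgue_measure_S set0 = 0.
Proof. by rewrite /lebesgue_measure_S /pushforward preimage_set0 measure0. Qed.

Let lms_ge0 A : 0 <= lebesgue_measure_S A.
Proof. exact: (@measure_ge0 _ _ _ (lebesgue_measure \x m)). Qed.

Let lms_sigma_additive : semi_sigma_additive lebesgue_measure_S.
Proof.
move=> F mF tF mUF; rewrite /lebesgue_measure_S /pushforward preimage_bigcup.
apply: measure_semi_sigma_additive.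
- by move=> n; rewrite -[X in measurable X]setTI; exact: measurable_cons_Rd.
- apply/trivIsetP => /= i j _ _ ij; rewrite -preimage_setI.
  by move/trivIsetP : tF => /(_ _ _ _ _ ij) ->//; rewrite preimage_set0.
- rewrite -preimage_bigcup -[X in measurable X]setTI.
  exact: measurable_cons_Rd.
Qed.

HB.instance Definition _ := isMeasure.Build _ _ _
  lebesgue_measure_S lms0 lms_ge0 lms_sigma_additive.

Let lms_sigma_finite : sigma_finite setT lebesgue_measure_S.
Proof.
have /sigma_finiteP[A [AT ndA Aoo]] := sigma_finiteT (@lebesgue_measure R).
have /sigma_finiteP[B [BT ndB Boo]] := sigma_finiteT m.
pose F k : set (measurableTypeR R * Rd R d) := A k `*` B k.
have FT : setT = \bigcup_k F k.
  rewrite -setXTT AT BT predeqE => -[x y]; split.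
    move=> [/= [n _ Anx] [k _ Bky]]; exists (maxn n k) => //; split.
    - by move: x Anx; exact/subsetPset/ndA/leq_maxl.
    - by move: y Bky; exact/subsetPset/ndB/leq_maxr.
  by move=> [n _ []/= ? ?]; split; exists n.
have mF k : measurable (F k) /\ (lebesgue_measure \x m) (F k) < +oo.
  have [? ?] := Aoo k; have [? ?] := Boo k.
  split; first exact: measurableX.
  by rewrite product_measure1E// lte_mul_pinfty// ge0_fin_numE.
pose G : Rd R d.+1 -> measurableTypeR R * Rd R d :=
  fun x => (thead x, [tuple of behead x]).
have mG : measurable_fun setT G.
  by apply/measurable_fun_pairP; split;
    [exact: measurable_tnth | exact: measurable_behead].
have GK (x : measurableTypeR R * Rd R d) : G (cons_Rd x) = x.
  by case: x => a t; rewrite /G /cons_Rd /= theadE; congr pair; exact/val_inj.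
exists (fun k => G @^-1` F k).
  by rewrite -preimage_bigcup -FT preimage_setT.
move=> k; have [mFk Fk] := mF k; split.
  by rewrite -[X in measurable X]setTI; exact: mG.
rewrite /lebesgue_measure_S /pushforward.
suff -> : cons_Rd @^-1` (G @^-1` F k) = F k by [].
by apply/seteqP; split => x /=; rewrite GK.
Qed.

HB.instance Definition _ := Measure_isSigmaFinite.Build _ _ _
  lebesgue_measure_S lms_sigma_finite.

End lebesgue_measure_S.

Fixpoint lebesgue_Rd (R : realType) (d : nat) :
    {sigma_finite_measure set (Rd R d) -> \bar R} :=
  match d with
  | 0 => \d_([tuple] : Rd R 0)
  | d'.+1 => lebesgue_measure_S (lebesgue_Rd R d')
  end.

(* The normalization: boxes have the product of the side measures. *)
Lemma lebesgue_Rd_box (R : realType) (d : nat)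
    (A : 'I_d -> set (measurableTypeR R)) :
  (forall i, measurable (A i)) ->
  lebesgue_Rd R d [set x | forall i, A i (tnth x i)] =
  (\prod_(i < d) lebesgue_measure (A i))%E.
Proof.
elim: d A => [|d IH] A mA /=.
  rewrite big_ord0 diracE mem_set//=; by case.
rewrite big_ord_recl -IH//.
rewrite /lebesgue_measure_S /pushforward -product_measure1E//; last first.
  rewrite [X in measurable X](_ : _ = \bigcap_(i : 'I_d)
      ((fun x : Rd R d => tnth x i) @^-1` A (lift ord0 i))); last first.
    by apply/seteqP; split=> x h i => [_|]; exact: h.
  apply: fin_bigcap_measurable => // i _.
  by rewrite -[X in measurable X]setTI; exact: measurable_tnth.
congr (_ _); apply/seteqP; split => -[a t] /=.
  move=> h; split; first by have := h ord0.
  by move=> i; have := h (lift ord0 i); rewrite tnthS.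
move=> [h0 h] i; case: (unliftP ord0 i) => [j ->|->//].
by rewrite tnthS; exact: h.
Qed.

(** * Complex-valued functions and their L_p spaces *)

(* Functions are Borel measurable representatives: every a.e. class of
   Lebesgue measurable functions contains one, and all the quantities below
   depend on the a.e. class only. *)

Section complex_Lp.
Context {disp : measure_display} {T : measurableType disp} {R : realType}.
Variable mu : {measure set T -> \bar R}.

Definition Cintegral (g : T -> R[i]) : R[i] :=
  Complex (\int[mu]_u complex.Re (g u)) (\int[mu]_u complex.Im (g u)).

Definition CLnorm (p : \bar R) (f : T -> R[i]) : \bar R :=
  ('N[mu]_p[EFin \o (fun x => Normc.normc (f x))])%E.

Definition CLspace (p : \bar R) : set (T -> R[i]) :=
  [set f | [/\ measurable_fun setT (fun x => complex.Re (f x)),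
               measurable_fun setT (fun x => complex.Im (f x)) &
               (CLnorm p f < +oo)%E]].

End complex_Lp.

(** * De la Vallee Poussin sums *)

Section vallee_poussin.
Context {R : realType} {d : nat}.
Implicit Types (f : Rd R d -> R[i]) (x u : Rd R d) (s n : nat).

Definition subRd x u : Rd R d :=
  [tuple (tnth x j : R) - (tnth u j : R) | j < d].

(* On the null set where some coordinate vanishes, x / 0 = 0 makes this 0
   instead of the continuous extension; the convolutions do not see it. *)
Definition VP_kernel s x : R :=
  (2 ^+ (s * d))^-1 *
  \prod_(j < d) ((cos (2 ^+ s * (tnth x j : R)) -
                  cos (2 ^+ s.+1 * (tnth x j : R))) / (tnth x j : R) ^+ 2).

Definition VP_sum s f x : R[i] :=
  ((pi ^+ d)^-1)%:C%C *
  Cintegral (lebesgue_Rd R d) (fun u => (VP_kernel s (subRd x u))%:C%C * f u).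

Definition VP_block s f x : R[i] :=
  if s is s'.+1 then VP_sum s f x - VP_sum s' f x else VP_sum 0 f x.

(* VP_partial n is the operator V_(n-1). *)
Definition VP_partial n f x : R[i] := \sum_(0 <= s < n) VP_block s f x.

Definition VP_error (q : \bar R) n f : \bar R :=
  CLnorm (lebesgue_Rd R d) q (fun x => f x - VP_partial n f x).

Definition VP_class_error (q : \bar R) n (F : set (Rd R d -> R[i])) : \bar R :=
  ereal_sup [set VP_error q n f | f in F].

(** * The Besov classes of generalized smoothness *)

(* Only the values theta >= 1 are meaningful; the case theta = +oo is the
   supremum. *)
Definition besov_norm (Omega : R -> R) (p theta : \bar R) f : \bar R :=
  match theta with
  | t%:E => (\sum_(0 <= s <oo)
      (Omega (2 ^- s) `^ (- t))%:E *
      CLnorm (lebesgue_Rd R d) p (VP_block s f) `^ t) `^ t^-1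
  | _ => ereal_sup [set
      ((Omega (2 ^- s))^-1)%:E * CLnorm (lebesgue_Rd R d) p (VP_block s f)
      | s in [set: nat]]
  end%E.

Definition besov_ball (Omega : R -> R) (p theta : \bar R) :
    set (Rd R d -> R[i]) :=
  [set f | CLspace (lebesgue_Rd R d) p f /\
           (besov_norm Omega p theta f <= 1)%E].

End vallee_poussin.

(* A function on [0, +oo[ is represented by Omega : R -> R whose values at
   negative arguments are irrelevant. *)
Record Phi {R : realType} (alpha : R) (l : nat) (Omega : R -> R) : Prop := {
  Phi_continuous : {within `[0, +oo[, continuous Omega} ;
  Phi_ge0 : forall t : R, 0 <= t -> 0 <= Omega t ;
  Phi_0 : Omega 0 = 0 ;
  Phi_gt0 : forall t : R, 0 < t -> 0 < Omega t ;
  Phi_nondecreasing : forall t1 t2 : R, 0 <= t1 -> t1 <= t2 ->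
    Omega t1 <= Omega t2 ;
  Phi_dilation : exists2 C1 : R, 0 < C1 &
    forall (n : nat) (t : R), 0 <= t -> Omega (n%:R * t) <= C1 * n%:R ^+ l * Omega t ;
  Phi_S_alpha : exists2 C2 : R, 0 < C2 &
    forall t1 t2 : R, 0 < t1 -> t1 <= t2 -> t2 <= 1 ->
      Omega t1 / t1 `^ alpha <= C2 * (Omega t2 / t2 `^ alpha) ;
  Phi_S_l : exists gamma : R, [/\ 0 < gamma, gamma < l%:R &
    exists2 C3 : R, 0 < C3 &
      forall t1 t2 : R, 0 < t1 -> t1 <= t2 -> t2 <= 1 ->
        Omega t1 / t1 `^ (l%:R - gamma) >=
        C3 * (Omega t2 / t2 `^ (l%:R - gamma))]
}.

(* Main.v *)
From HB Require Import structures.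
Require Import Defs.
From mathcomp Require Import all_boot all_order all_algebra.
From mathcomp Require Import complex ring lra.
From mathcomp Require Import all_classical all_reals all_analysis.
From mathcomp Require Import measurable_realfun ess_sup_inf.

Set Implicit Arguments.
Unset Strict Implicit.
Unset Printing Implicit Defensive.

Import Order.TTheory GRing.Theory Num.Theory.
Import numFieldNormedType.Exports.

Local Open Scope classical_set_scope.
Local Open Scope ring_scope.

(** The de la Vallee Poussin kernel is a difference of two Fejer kernels
    [hker a x = (1 - cos (a x)) / x^2], and [hker a] is the cosine transform of
    the triangle [a - t] on [[0, a]]. Hence [hker a] convolved with
    [hker c - hker b] is [pi (c - b) hker a] as soon as [a <= b, c]; this single
    identity says that sigma_(2^s) reproduces sigma_(2^m) for [m < s], and no
    other harmonic analysis is needed.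

    Upper bound: [q_s f] is reproduced by the kernel of level [s + 1], which is
    bounded by [2^((s + 1) d)] with bounded [L_1] norm, so that
    [|q_s f| <= C 2^(s d / p) ||q_s f||_p <= C 2^(s d / p) Omega (2^-s)]
    (Nikol'skii inequality, here through [y <= t + y^p t^(1 - p)] instead of
    Hoelder). By (S^alpha) and [alpha > d / p] these bounds decay geometrically,
    and the tail of the series gives the estimate. That the series converges to
    [f] a.e. is checked by integrating over boxes, which generate the
    sigma-algebra: there the kernel falls on the indicator of the box, and
    dominated convergence applies.

    Lower bound: the product of the functions [bump n], whose spectrum lies in
    [2^n <= |t| <= 2^(n + 1)], satisfies [sigma_(2^s) f = 0] for [s < n] and
    [sigma_(2^s) f = f] for [s > n]. Only the blocks [n] and [n + 1] survive,
    their [L_p] norms are bounded by interpolation between [L_1] and [L_oo], and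
    the error of approximation is [f] itself. *)

(** The kernels are real, so everything is done for real functions, and real and imaginary parts are
    recombined at the cost of a factor 2. Membership in L_p is used as a bound [B ^ p] on the
    integral of [|f| ^ p]. Two kinds of bound must be kept apart: a crude one on [f], which only
    makes the convolutions and Fubini legitimate, and the sharp one on each block, which enters the
    estimates. The obstacle in the upper bound is to recognise the uniform limit of the sums as [f]
    without density or maximal function arguments. Boxes work because the average of the
    one-dimensional kernel over a bounded interval is dominated, uniformly in the level, by a
    multiple of 1 / (1 + u^2); a tensor product of such weights is bounded and integrable, hence
    pairs with every L_p function. In the lower bound, level [s] has a multiplier equal to 1 up to
    frequency 2^s and to 0 beyond 2^(s+1). A low level kills the bump because convolving [hker a]
    with either of its two differences gives the same multiple of [hker a]: the middle frequency 3/2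
    * 2^n makes the two gaps equal. *)

Section reflected_translation.
Context {R : realType}.
Notation mu := (@lebesgue_measure R).

Definition refl_shift (x : R) (u : measurableTypeR R) : measurableTypeR R := x - u.

Lemma measurable_refl_shift (x : R) : measurable_fun setT (refl_shift x).
Proof. exact: (@measurable_funB _ (measurableTypeR R) R setT (cst x) id). Qed.

HB.instance Definition _ x :=
  isMeasurableFun.Build _ _ _ _ (refl_shift x) (measurable_refl_shift x).

(** By uniqueness of Lebesgue measure only intervals []a, b]] matter; their preimages [[x - b, x -
    a[] have the same length. *)
Lemma lebesgue_measure_refl_shift (x : R) (A : set (measurableTypeR R)) :
  measurable A -> pushforward mu (refl_shift x) A = mu A.
Proof.
move=> mA; apply/esym/lebesgue_measure_unique => //= _ [[a b]] _ <-.
rewrite /pushforward (_ : _ @^-1` _ = `[x - b, x - a[%classic); last first.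
  by apply/seteqP; split=> u /=; rewrite /refl_shift !in_itv/= => /andP[? ?];
    apply/andP; split; lra.
rewrite !lebesgue_measure_itv/= !lte_fin.
have -> : (x - b < x - a) = (a < b) by apply/idP/idP; lra.
by case: ifP => // _; congr (_%:E); lra.
Qed.

Local Open Scope ereal_scope.

Lemma ge0_integral_refl_shift (x : R) (f : R -> \bar R) :
  measurable_fun setT f -> (forall u, 0 <= f u) ->
  \int[mu]_u f (x - u)%R = \int[mu]_u f u.
Proof.
move=> mf f0; transitivity (\int[pushforward mu (refl_shift x)]_u f u).
  by rewrite ge0_integral_pushforward.
apply: eq_measure_integral => A mA _; exact: lebesgue_measure_refl_shift.
Qed.

Lemma integrable_refl_shift (x : R) (f : R -> \bar R) :
  mu.-integrable setT f -> mu.-integrable setT (fun u => f (x - u)%R).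
Proof.
move=> /integrableP[mf foo]; apply/integrableP; split.
  apply: (measurableT_comp mf); exact: measurable_refl_shift.
rewrite (@ge0_integral_refl_shift x (abse \o f))//.
  by apply: measurableT_comp => //; exact: measurableT_comp.
by move=> u; exact: abse_ge0.
Qed.

Lemma Rintegral_refl_shift (x : R) (f : R -> R) :
  mu.-integrable setT (EFin \o f) ->
  (\int[mu]_u f (x - u) = \int[mu]_u f u)%R.
Proof.
move=> intf; congr fine; have mf := measurable_int _ intf.
transitivity (\int[pushforward mu (refl_shift x)]_u (f u)%:E).
  rewrite integral_pushforward// preimage_setT.
  exact: (integrable_refl_shift x intf).
apply: eq_measure_integral => A mA _; exact: lebesgue_measure_refl_shift.
Qed.

End reflected_translation.

(** * Integrability and Fubini's theorem for real-valued functions *)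

Section real_integrable.
Context d (T : measurableType d) (R : realType) (m : {measure set T -> \bar R}).
Implicit Types f g : T -> R.

Lemma integrable_EFinD f g :
  m.-integrable setT (EFin \o f) -> m.-integrable setT (EFin \o g) ->
  m.-integrable setT (EFin \o (fun x => f x + g x)).
Proof. by move=> intf intg; exact: (integrableD measurableT intf intg). Qed.

Lemma integrable_EFinB f g :
  m.-integrable setT (EFin \o f) -> m.-integrable setT (EFin \o g) ->
  m.-integrable setT (EFin \o (fun x => f x - g x)).
Proof. by move=> intf intg; exact: (integrableB measurableT intf intg). Qed.

Lemma integrable_EFinZl (k : R) f :
  m.-integrable setT (EFin \o f) ->
  m.-integrable setT (EFin \o (fun x => k * f x)).
Proof. by move=> intf; exact: (integrableZl measurableT k intf). Qed.

Lemma integrable_EFinZlS (D : set T) (mD : measurable D) (k : R) f :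
  m.-integrable D (EFin \o f) ->
  m.-integrable D (EFin \o (fun x => k * f x)).
Proof. by move=> intf; exact: (integrableZl mD k intf). Qed.

Lemma integrable_EFinZr (k : R) f :
  m.-integrable setT (EFin \o f) ->
  m.-integrable setT (EFin \o (fun x => f x * k)).
Proof. by move=> intf; exact: (integrableZr measurableT k intf). Qed.

Lemma measurable_int_EFin f :
  m.-integrable setT (EFin \o f) -> measurable_fun setT f.
Proof. by move=> /measurable_int/measurable_EFinP. Qed.

Lemma le_integrable_EFin f g : measurable_fun setT f ->
  (forall x, `|f x| <= g x) -> m.-integrable setT (EFin \o g) ->
  m.-integrable setT (EFin \o f).
Proof.
move=> mf fg; apply: le_integrable => //; first exact/measurable_EFinP.
by move=> x _; rewrite /= lee_fin (le_trans (fg x))// ler_norm.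
Qed.

Lemma integrable_boundedM f g (M : R) : measurable_fun setT g ->
  (forall x, `|g x| <= M) -> m.-integrable setT (EFin \o f) ->
  m.-integrable setT (EFin \o (fun x => g x * f x)).
Proof.
move=> mg gM intf; apply: (@le_integrable_EFin _ (fun x => M * `|f x|)).
- by apply: measurable_funM => //; exact: measurable_int_EFin.
- by move=> x; rewrite normrM ler_wpM2r.
- by apply: integrable_EFinZl; exact: integrable_norm.
Qed.

Lemma integral_indicM (D : set T) f :
  (\int[m]_(x in D) (f x)%:E = \int[m]_x (f x * \1_D x)%:E)%E.
Proof.
rewrite integral_mkcond; apply: eq_integral => x _.
by rewrite patchE indicE; case: ifPn => xD; rewrite ?mulr1 ?mulr0.
Qed.

Lemma integrable_indicMP (D : set T) f : measurable D ->
  m.-integrable D (EFin \o f) <->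
  m.-integrable setT (EFin \o (fun x => f x * \1_D x)).
Proof.
move=> mD; rewrite (_ : EFin \o (fun x => f x * \1_D x) = (EFin \o f) \_ D).
  exact: integrable_mkcond.
apply/funext => x; rewrite patchE /= indicE.
by case: ifPn => xD; rewrite ?mulr1 ?mulr0.
Qed.

End real_integrable.

Section fubini_real.
Context d1 d2 (T1 : measurableType d1) (T2 : measurableType d2) (R : realType).
Variables (m1 : {sigma_finite_measure set T1 -> \bar R})
  (m2 : {sigma_finite_measure set T2 -> \bar R}).
Implicit Types F : T1 * T2 -> R.

(** Tonelli's criterion in the form that feeds [Fubini_Rintegral]: in each use [g] is a constant
    times a factor already known to be integrable. *)
Lemma integrable_prod_dominated F (g : T1 -> R) : measurable_fun setT F ->
  (forall x, \int[m2]_y `|(F (x, y))%:E| <= (g x)%:E)%E ->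
  m1.-integrable setT (EFin \o g) ->
  (m1 \x m2)%E.-integrable setT (EFin \o F).
Proof.
move=> mF Fg intg; have mEF : measurable_fun setT (EFin \o F) by exact/measurable_EFinP.
apply/(integrable12ltyP _ _ mEF).
have maF : measurable_fun setT (abse \o (EFin \o F)) by exact: measurableT_comp.
have /= mG := @measurable_fun_fubini_tonelli_F _ _ _ _ R m2 _ maF (fun z => abse_ge0 _).
apply: (@le_lt_trans _ _ (\int[m1]_x (g x)%:E)%E).
  apply: ge0_le_integral => //.
  - by move=> x _; exact: integral_ge0.
  - exact: measurable_int intg.
  - by move=> x _; exact: Fg.
by rewrite ltey_eq integrable_fin_num.
Qed.

(** Sections are assumed integrable everywhere, so that every inner integral is finite and [fine]
    can be undone pointwise. *)
Lemma Fubini_Rintegral F : (m1 \x m2)%E.-integrable setT (EFin \o F) ->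
  (forall x, m2.-integrable setT (fun y => (F (x, y))%:E)) ->
  (forall y, m1.-integrable setT (fun x => (F (x, y))%:E)) ->
  \int[m1]_x \int[m2]_y F (x, y) = \int[m2]_y \int[m1]_x F (x, y).
Proof.
move=> intF intx inty; congr fine.
rewrite (eq_integral (fun x => \int[m2]_y (F (x, y))%:E)%E); last first.
  by move=> x _; rewrite /Rintegral fineK//; exact: integrable_fin_num.
rewrite [RHS](eq_integral (fun y => \int[m1]_x (F (x, y))%:E)%E); last first.
  by move=> x _; rewrite /Rintegral fineK//; exact: integrable_fin_num.
exact: (Fubini intF).
Qed.

(** Tonelli gives measurability for the positive and negative parts; their difference is the
    integral by definition, whether finite or not. *)
Lemma measurable_Rintegral2 F : measurable_fun setT F ->
  measurable_fun setT (fun x => \int[m2]_y F (x, y)).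
Proof.
move=> mF; apply: (measurableT_comp (fine_measurable measurableT)).
have mEF : measurable_fun setT (EFin \o F) by exact/measurable_EFinP.
pose Fp z : \bar R := ((EFin \o F)^\+ z)%E; pose Fn z : \bar R := ((EFin \o F)^\- z)%E.
have mp : measurable_fun setT Fp by exact: measurable_funepos.
have mn : measurable_fun setT Fn by exact: measurable_funeneg.
rewrite (_ : (fun x => _) = (fun x => \int[m2]_y Fp (x, y) - \int[m2]_y Fn (x, y))%E).
  apply: emeasurable_funB.
    exact: (@measurable_fun_fubini_tonelli_F _ _ _ _ R m2 _ mp (fun=> funepos_ge0 _ _)).
  exact: (@measurable_fun_fubini_tonelli_F _ _ _ _ R m2 _ mn (fun=> funeneg_ge0 _ _)).
apply/funext => x; rewrite integralE.
by congr (_ - _)%E; apply: eq_integral => y _; rewrite /Fp /Fn ?funeposE ?funenegE.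
Qed.

End fubini_real.

(** * The Fejer kernel on the line *)

Section fejer_kernel.
Context {R : realType}.
Implicit Types (a b t u v x : R).

(* The value at 0 is the continuous extension. *)
Definition hker a x : R :=
  if x == 0 then a ^+ 2 / 2 else (1 - cos (a * x)) / x ^+ 2.

(** Inversion is read as the power -1; at 0 both sides take the value 0. *)
Lemma measurable_sqrV : measurable_fun setT (fun x : R => (x ^+ 2)^-1).
Proof.
rewrite (_ : (fun _ => _) = (fun x : R => (x ^+ 2) `^ (- 1))); last first.
  by apply/funext => x; rewrite powR_inv1// sqr_ge0.
apply: (@measurableT_comp _ _ _ _ _ _ (fun y : R => y `^ (-1))).
  exact: measurable_powR.
exact: exprn_measurable.
Qed.

Lemma measurable_cos_scale a : measurable_fun setT (fun x : R => cos (a * x)).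
Proof.
apply: (@measurableT_comp _ _ _ _ _ _ (@cos R)).
  by apply: continuous_measurable_fun; exact: continuous_cos.
exact: mulrl_measurable.
Qed.

Lemma measurable_hker a : measurable_fun setT (hker a).
Proof.
apply: measurable_fun_ifT.
- exact: measurable_fun_eqr.
- exact: measurable_cst.
- apply: measurable_funM; last exact: measurable_sqrV.
  by apply: measurable_funB => //; exact: measurable_cos_scale.
Qed.

Lemma hker_ge0 a x : 0 <= hker a x.
Proof.
rewrite /hker; case: ifP => _; first by rewrite divr_ge0// sqr_ge0.
by rewrite divr_ge0// ?sqr_ge0// subr_ge0 cos_le1.
Qed.

Lemma hkerN a x : hker a (- x) = hker a x.
Proof. by rewrite /hker oppr_eq0 mulrN cosN sqrrN. Qed.

Lemma hker0 x : hker 0 x = 0.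
Proof.
by rewrite /hker mul0r cos0 subrr mul0r expr0n/= mul0r; case: ifP.
Qed.

Lemma hker_tail a x : hker a x * x ^+ 2 <= 2.
Proof.
rewrite /hker; case: ifP => [/eqP ->|/negbT x0].
  by rewrite expr0n/= mulr0.
rewrite -mulrA mulVf ?mulr1 ?sqrf_eq0//; have := cos_geN1 (a * x); lra.
Qed.

Lemma norm_sin_le x : `|sin x| <= `|x|.
Proof.
have [] := @MVT_segment R sin cos (Num.min 0 x) (Num.max 0 x).
- by rewrite ge_min !le_max lexx.
- by apply/continuous_subspaceT => y; exact: continuous_sin.
move=> c _; have [x0|x0] := leP 0 x.
  rewrite sin0 !subr0 => ->; rewrite normrM ler_piMl//; exact: cos_max.
rewrite sin0 !sub0r => /eqP; rewrite eqr_oppLR mulrN opprK => /eqP ->.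
rewrite normrM ler_piMl//; exact: cos_max.
Qed.

(** From 1 - cos (2 z) = 2 sin(z)^2 <= 2 z^2 with z = a x / 2. *)
Lemma hker_le a x : hker a x <= a ^+ 2 / 2.
Proof.
rewrite /hker; case: ifP => // /negbT x0.
rewrite ler_pdivrMr ?exprn_even_gt0//.
have -> : a * x = (a * x / 2) *+ 2 by rewrite -mulr_natr; lra.
rewrite cos_mulr2n cos2sin2.
have : sin (a * x / 2) ^+ 2 <= (a * x / 2) ^+ 2.
  rewrite -(real_normK (num_real (sin _))) -(real_normK (num_real (a * x / 2))).
  by rewrite lerXn2r ?nnegrE// norm_sin_le.
by rewrite !exprMn; lra.
Qed.

(** Product-to-sum formula: modulation by cos (t x) moves each frequency by +t and -t, and in the
    difference the bare terms cos (t x) cancel. *)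
Lemma hkerM a b t x :
  cos (t * x) * (hker b x - hker a x) =
  2^-1 * (hker (b + t) x + hker (b - t) x - hker (a + t) x - hker (a - t) x).
Proof.
rewrite /hker; case: ifP => [/eqP ->|/negbT x0].
  rewrite mulr0 cos0; lra.
rewrite -mulrBl -!mulrDl -!mulrBl mulrA mulrA; congr (_ / _).
rewrite !mulrDl !mulNr !cosD !sinN !cosN; lra.
Qed.

End fejer_kernel.

(** * The total integral of the Fejer kernel *)

Section dirichlet_integral.
Context {R : realType}.
Notation mu := (@lebesgue_measure R).
Implicit Types (a b c t u v x : R).

Lemma cvg_expRNM0 c : 0 < c -> expR (- (c * t)) @[t --> +oo] --> (0 : R).
Proof.
move=> c0; apply: (cvg_comp (fun t => c * t) (fun y => expR (- y))).
  exact: gt0_cvgMry.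
exact: cvgr_expR.
Qed.

(** With c = |x| this writes the factor 1 / x^2 of [hker] as a Laplace integral. *)
Lemma integral_gamma2 c : 0 < c ->
  (\int[mu]_(t in `[0%R, +oo[) (t * expR (- (c * t)))%:E = (c ^- 2)%:E)%E.
Proof.
move=> c0.
pose F t := - ((t / c + c ^- 2) * expR (- (c * t))).
have dF t : is_derive t 1 F (t * expR (- (c * t))).
  apply: is_derive_eq; rewrite /GRing.scale/=.
  by field; rewrite gt_eqF.
have cF : continuous F.
  by move=> t; apply: differentiable_continuous; apply/derivable1_diffP; exact: ex_derive.
rewrite (@ge0_continuous_FTC2y _ _ F 0 0).
- by rewrite -EFinB /F mul0r add0r mulr0 oppr0 expR0 mulr1 opprK add0r.
- by move=> t t0; rewrite mulr_ge0// expR_ge0.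
- apply: continuous_subspaceT => t; apply: differentiable_continuous.
  apply/derivable1_diffP; exact: ex_derive.
- have K0 : 0 <= 2 / c * c^-1 + c ^- 2.
    by rewrite addr_ge0// ?invr_ge0 ?exprn_ge0 ?mulr_ge0 ?invr_ge0 ?ltW.
  rewrite -[X in _ --> X]oppr0; apply: cvgN.
  (* Half of the exponential absorbs the linear factor: t <= (2 / c) exp (c t / 2). *)
  apply: (@squeeze_cvgr _ _ _ _ (cst 0) (fun t => (2 / c * c^-1 + c ^- 2) * expR (- (c / 2 * t)))).
  + near=> t.
    have t0 : 0 <= t by near: t; exact: nbhs_pinfty_ge.
    apply/andP; split.
      by rewrite mulr_ge0 ?expR_ge0// addr_ge0// ?divr_ge0 ?invr_ge0 ?exprn_ge0// ltW.
    have -> : - (c * t) = - (c / 2 * t) + - (c / 2 * t) by lra.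
    rewrite expRD mulrA ler_wpM2r ?expR_ge0//.
    rewrite mulrDl lerD//.
      rewrite mulrAC ler_wpM2r// ?invr_ge0 ?(ltW c0)//.
      rewrite expRN ler_pdivrMr ?expR_gt0// -ler_pdivrMl ?divr_gt0//.
      rewrite invf_div (le_trans _ (expR_ge1Dx _))//; lra.
    rewrite ler_piMr ?invr_ge0 ?exprn_ge0 ?ltW//.
    by rewrite expR_lt1 oppr_lt0 mulr_gt0 ?divr_gt0.
  + exact: cvg_cst.
  + rewrite -[X in _ --> X](mulr0 (2 / c * c^-1 + c ^- 2)); apply: cvgM; first exact: cvg_cst.
    by apply: cvg_expRNM0; rewrite divr_gt0.
- by move=> t _; exact: ex_derive.
- by apply: cvg_at_right_filter; exact: cF.
- by move=> t _; rewrite derive1E; exact: derive_val.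
Unshelve. all: by end_near. Qed.

Lemma integral_cos_laplace a t : 0 < t ->
  (\int[mu]_(x in `[0%R, +oo[) ((1 - cos (a * x)) * expR (- (t * x)))%:E =
    (a ^+ 2 / (t * (t ^+ 2 + a ^+ 2)))%:E)%E.
Proof.
move=> t0.
have ta0 : 0 < t ^+ 2 + a ^+ 2 by rewrite ltr_pwDl ?exprn_gt0// sqr_ge0.
pose F x := expR (- (t * x)) *
  ((t * cos (a * x) - a * sin (a * x)) / (t ^+ 2 + a ^+ 2) - t^-1).
have dF x : is_derive x 1 F ((1 - cos (a * x)) * expR (- (t * x))).
  apply: is_derive_eq; rewrite /GRing.scale/=.
  by field; rewrite !gt_eqF.
have cF : continuous F.
  by move=> x; apply: differentiable_continuous; apply/derivable1_diffP; exact: ex_derive.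
rewrite (@ge0_continuous_FTC2y _ _ F 0 0).
- rewrite -EFinB /F !mulr0 oppr0 expR0 cos0 sin0 mulr0 subr0 mulr1 mul1r sub0r.
  by congr EFin; field; rewrite !gt_eqF.
- by move=> x _; rewrite mulr_ge0 ?expR_ge0// subr_ge0 cos_le1.
- apply: continuous_subspaceT => x; apply: differentiable_continuous.
  apply/derivable1_diffP; exact: ex_derive.
- pose K := (t + `|a|) / (t ^+ 2 + a ^+ 2) + t^-1.
  apply/cvgr0Pnorm_le => /= e e0.
  have : K * expR (- (t * x)) @[x --> +oo] --> (0 : R).
    by rewrite -[X in _ --> X](mulr0 K); apply: cvgM; [exact: cvg_cst|exact: cvg_expRNM0].
  move=> /cvgr0Pnorm_le/(_ e e0); apply: filterS => x; apply: le_trans.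
  rewrite /F mulrC !normrM ler_wpM2r// (le_trans (ler_normB _ _))//.
  rewrite [leRHS]ger0_norm ?addr_ge0 ?divr_ge0 ?invr_ge0 ?addr_ge0 ?sqr_ge0 ?(ltW t0)//.
  rewrite normrM !normfV (gtr0_norm t0) (gtr0_norm ta0) lerD2r ler_wpM2r ?invr_ge0 ?(ltW ta0)//.
  rewrite (le_trans (ler_normB _ _))// !normrM (gtr0_norm t0) lerD//.
    by rewrite ler_piMr ?cos_max ?ltW.
  by rewrite ler_piMr ?sin_max.
- by move=> x _; exact: ex_derive.
- by apply: cvg_at_right_filter; exact: cF.
- by move=> x _; rewrite derive1E; exact: derive_val.
Qed.

(** The integrand is t times the value in [integral_cos_laplace], doubled because [x] runs over both
    half-lines. *)
Lemma integral_arctan_density a : 0 < a ->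
  (\int[mu]_(t in `[0%R, +oo[) (2 * a ^+ 2 / (t ^+ 2 + a ^+ 2))%:E = (pi * a)%:E)%E.
Proof.
move=> a0.
have ta0 t : 0 < t ^+ 2 + a ^+ 2 by rewrite ltr_wpDl ?exprn_gt0// sqr_ge0.
pose F t := 2 * a * atan (a^-1 * t).
have dF t : is_derive t 1 F (2 * a ^+ 2 / (t ^+ 2 + a ^+ 2)).
  apply: is_derive_eq; rewrite /GRing.scale/=.
  have := ta0 t; have : 1 + (a^-1 * t) ^+ 2 != 0.
    by rewrite gt_eqF// ltr_pwDl// sqr_ge0.
  by move=> h1 h2; field; rewrite !gt_eqF.
have cF : continuous F.
  by move=> x; apply: differentiable_continuous; apply/derivable1_diffP; exact: ex_derive.
rewrite (@ge0_continuous_FTC2y _ _ F 0 (2 * a * (pi / 2))).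
- by rewrite -EFinB /F mulr0 atan0 mulr0 subr0; congr EFin; field.
- by move=> t _; rewrite divr_ge0 ?mulr_ge0 ?sqr_ge0// ltW.
- apply: continuous_subspaceT => t.
  apply: cvgM; first exact: cvg_cst.
  apply: cvgV; first by rewrite gt_eqF.
  apply: cvgD; last exact: cvg_cst.
  exact: exprn_continuous.
- apply: cvgM; first exact: cvg_cst.
  apply: (cvg_comp (fun t => a^-1 * t) atan).
    by apply: gt0_cvgMry => //; rewrite invr_gt0.
  exact: cvgy_atan.
- by move=> x _; exact: ex_derive.
- by apply: cvg_at_right_filter; exact: cF.
- by move=> x _; rewrite derive1E; exact: derive_val.
Qed.

(** Replace 1 / x^2 by the integral of t exp (- t |x|) over t > 0 and exchange the integrals.
    Everything is nonnegative, so Tonelli suffices, and the remaining integral in [t] is an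
    arctangent. *)
Lemma integral_hker_gt0 a : 0 < a ->
  (\int[mu]_x (hker a x)%:E = (pi * a)%:E)%E.
Proof.
move=> a0.
pose f (z : measurableTypeR R * measurableTypeR R) : \bar R :=
  ((1 - cos (a * z.1)) * (z.2 * expR (- (z.2 * `|z.1|))) * \1_(`]0, +oo[%classic : set R) z.2)%:E.
have mf : measurable_fun setT f.
  apply/measurable_EFinP; apply: measurable_funM; first apply: measurable_funM.
  - apply: measurable_funB => //.
    by apply: (@measurableT_comp _ _ _ _ _ _ (fun y : R => cos (a * y))) => //;
      exact: measurable_cos_scale.
  - apply: measurable_funM => //; apply: (@measurableT_comp _ _ _ _ _ _ (@expR R)) => //.
    apply: measurableT_comp => //; apply: measurable_funM => //.
    exact: (@measurableT_comp _ _ _ _ _ _ (@Num.norm R R)).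
  - apply: (@measurableT_comp _ _ _ _ _ _ (\1_(`]0, +oo[%classic : set R) : R -> R)) => //.
have f0 z : (0 <= f z)%E.
  rewrite lee_fin; case: z => x t /=; rewrite indicE.
  case: (boolP (t \in _)) => [|_]; last by rewrite mulr0.
  rewrite inE/= in_itv/= andbT => t0; rewrite mulr1 mulr_ge0 ?subr_ge0 ?cos_le1//.
  by rewrite mulr_ge0 ?expR_ge0// ltW.
transitivity (\int[mu]_x \int[mu]_t f (x, t))%E.
  apply: ge0_ae_eq_integral => //.
  - by apply/measurable_EFinP; exact: measurable_hker.
  - have := @measurable_fun_fubini_tonelli_F _ _ _ _ R mu f mf f0.
    exact.
  - by move=> x _; rewrite lee_fin hker_ge0.
  - by move=> x _; apply: integral_ge0.
  (* The point 0 is excluded: there [f] vanishes with 1 - cos, while [hker a 0] is a^2 / 2. *)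
  exists [set 0]; split => //; first exact: lebesgue_measure_set1.
  move=> x /=; apply: contra_notP => /eqP x0 _.
  rewrite -(integral_indicM mu `]0, +oo[%classic
    (fun t => (1 - cos (a * x)) * (t * expR (- (t * `|x|))))).
  under eq_integral do rewrite EFinM.
  rewrite ge0_integralZl//; last 2 first.
  - apply/measurable_EFinP; apply: measurable_funM => //.
    by apply: (@measurableT_comp _ _ _ _ _ _ (@expR R)) => //; apply: measurable_funTS;
      apply: measurableT_comp => //; exact: mulrr_measurable.
  - move=> t; rewrite /= in_itv/= andbT => t0.
    by rewrite lee_fin mulr_ge0 ?expR_ge0// ltW.
  rewrite integral_itv_obnd_cbnd; last first.
    apply/measurable_EFinP; apply: measurable_funM => //.
    by apply: (@measurableT_comp _ _ _ _ _ _ (@expR R)) => //; apply: measurable_funTS;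
      apply: measurableT_comp => //; exact: mulrr_measurable.
  under eq_integral do rewrite (mulrC _ `|x|).
  rewrite integral_gamma2 ?normr_gt0// -EFinM /hker (negbTE x0).
  by rewrite real_normK ?num_real.
rewrite fubini_tonelli//.
transitivity (\int[mu]_t (2 * a ^+ 2 / (t ^+ 2 + a ^+ 2) * \1_(`]0, +oo[%classic : set R) t)%:E)%E.
  apply: eq_integral => t _; rewrite /f/= indicE.
  have [|_] := boolP (t \in _); last first.
    by rewrite mulr0; under eq_integral do rewrite mulr0; rewrite integral0.
  rewrite inE/= in_itv/= andbT => t0.
  transitivity (\int[mu]_x (t%:E * ((1 - cos (a * x)) * expR (- (t * `|x|)))%:E))%E.
    by apply: eq_integral => x _; rewrite -EFinM mulr1; congr EFin; ring.
  have cg : continuous (fun x : R => (1 - cos (a * x)) * expR (- (t * `|x|))).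
    move=> x; apply: cvgM.
      apply: cvgB; first exact: cvg_cst.
      apply: (cvg_comp (fun x => a * x) cos); last exact: continuous_cos.
      by apply: cvgM; [exact: cvg_cst|exact: cvg_id].
    apply: (cvg_comp (fun x => - (t * `|x|)) expR); last exact: continuous_expR.
    by apply: cvgN; apply: cvgM; [exact: cvg_cst|exact: norm_continuous].
  have g0 x : 0 <= (1 - cos (a * x)) * expR (- (t * `|x|)).
    by rewrite mulr_ge0 ?expR_ge0// subr_ge0 cos_le1.
  rewrite ge0_integralZl//; last 2 first.
  - by apply/measurable_EFinP; exact: continuous_measurable_fun.
  - by rewrite lee_fin ltW.
  rewrite ge0_symfun_integralT//; last first.
    by move=> x /=; rewrite mulrN cosN normrN.
  rewrite -set_itvcy.
  have -> : (\int[mu]_(x in `[0%R, +oo[) ((1 - cos (a * x)) * expR (- (t * `|x|)))%:E =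
      \int[mu]_(x in `[0%R, +oo[) ((1 - cos (a * x)) * expR (- (t * x)))%:E)%E.
    by apply: eq_integral => x; rewrite inE/= in_itv/= andbT => x0; rewrite ger0_norm.
  rewrite integral_cos_laplace// -!EFinM mulr1; congr EFin; field.
  by rewrite !gt_eqF// ltr_wpDl ?exprn_gt0// sqr_ge0.
rewrite -integral_indicM integral_itv_obnd_cbnd ?integral_arctan_density//.
apply/measurable_EFinP; apply: measurable_funTS; apply: continuous_measurable_fun => t.
apply: cvgM; first exact: cvg_cst.
apply: cvgV; first by rewrite gt_eqF// ltr_wpDl ?exprn_gt0// sqr_ge0.
by apply: cvgD; [exact: exprn_continuous|exact: cvg_cst].
Qed.

Lemma integral_hker a : 0 <= a ->
  (\int[mu]_x (hker a x)%:E = (pi * a)%:E)%E.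
Proof.
rewrite le_eqVlt => /predU1P[<-|]; last exact: integral_hker_gt0.
by under eq_integral do rewrite hker0; rewrite integral0 mulr0.
Qed.

Lemma integrable_hker a : 0 <= a -> mu.-integrable setT (EFin \o hker a).
Proof.
move=> a0; apply/integrableP; split.
  by apply/measurable_EFinP; exact: measurable_hker.
under eq_integral do rewrite /= ger0_norm ?hker_ge0//.
by rewrite integral_hker// ltry.
Qed.

Lemma Rintegral_hker a : 0 <= a -> \int[mu]_x hker a x = pi * a.
Proof. by move=> a0; rewrite /Rintegral integral_hker. Qed.

End dirichlet_integral.

(** * Cosine transforms and convolutions of Fejer kernels *)

Section fejer_fourier.
Context {R : realType}.
Notation mu := (@lebesgue_measure R).
Implicit Types (a b c t u v x : R).

(** After [hkerM] four frequencies remain. The conditions on [t] keep them nonnegative, where the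
    integral pi a of [hker a] is linear in [a], so [t] drops out. *)
Lemma Rintegral_cos_hkerB a b t : 0 <= t -> t <= a -> t <= b ->
  \int[mu]_u (cos (t * u) * (hker b u - hker a u)) = pi * (b - a).
Proof.
move=> t0 ta tb.
under eq_Rintegral do rewrite hkerM.
have [? ?] : 0 <= b + t /\ 0 <= b - t by lra.
have [? ?] : 0 <= a + t /\ 0 <= a - t by lra.
have i1 : mu.-integrable setT (EFin \o (fun u => hker (b + t) u + hker (b - t) u)).
  by apply: integrable_EFinD; exact: integrable_hker.
have i2 : mu.-integrable setT (EFin \o
    (fun u => hker (b + t) u + hker (b - t) u - hker (a + t) u)).
  by apply: integrable_EFinB => //; exact: integrable_hker.
rewrite RintegralZl//; last by apply: integrable_EFinB => //; exact: integrable_hker.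
rewrite RintegralB ?RintegralB ?RintegralD ?Rintegral_hker//; try exact: integrable_hker.
lra.
Qed.

Lemma integrable_hkerB a b : 0 <= a -> 0 <= b ->
  mu.-integrable setT (fun u => (hker b u - hker a u)%:E).
Proof. by move=> a0 b0; apply: (@integrable_EFinB _ _ _ mu (hker b) (hker a)); exact: integrable_hker. Qed.

Lemma measurable_sin_scale t : measurable_fun setT (fun x : R => sin (t * x)).
Proof.
apply: (@measurableT_comp _ _ _ _ _ _ (@sin R)).
  by apply: continuous_measurable_fun; exact: continuous_sin.
exact: mulrl_measurable.
Qed.

(** The integrand is odd: reflection in 0 shows that the integral equals its opposite. *)
Lemma Rintegral_sin_hkerB a b t : 0 <= a -> 0 <= b ->
  \int[mu]_u (sin (t * u) * (hker b u - hker a u)) = 0.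
Proof.
move=> a0 b0.
have intf : mu.-integrable setT (EFin \o (fun u => sin (t * u) * (hker b u - hker a u))).
  apply: integrable_boundedM; last exact: integrable_hkerB.
    exact: measurable_sin_scale.
  by move=> x; exact: sin_max.
have := Rintegral_refl_shift 0 intf.
under eq_Rintegral do rewrite sub0r mulrN sinN !hkerN mulNr -mulN1r.
rewrite RintegralZl// => /eqP; lra.
Qed.

(** Substituting u = x - v and expanding cos (t x - t v), the sine term integrates to 0 and the
    cosine term is [Rintegral_cos_hkerB]. *)
Lemma Rintegral_cos_hkerB_shift a b t x : 0 <= t -> t <= a -> t <= b ->
  \int[mu]_u (cos (t * u) * (hker b (x - u) - hker a (x - u))) =
  pi * (b - a) * cos (t * x).
Proof.
move=> t0 ta tb.
have [a0 b0] : 0 <= a /\ 0 <= b by lra.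
have ic : mu.-integrable setT (EFin \o (fun u => cos (t * u) * (hker b u - hker a u))).
  apply: integrable_boundedM; last exact: integrable_hkerB.
    exact: measurable_cos_scale.
  by move=> ?; exact: cos_max.
have is_ : mu.-integrable setT (EFin \o (fun u => sin (t * u) * (hker b u - hker a u))).
  apply: integrable_boundedM; last exact: integrable_hkerB.
    exact: measurable_sin_scale.
  by move=> ?; exact: sin_max.
have eqf v : cos (t * (x - v)) * (hker b v - hker a v) =
    cos (t * x) * (cos (t * v) * (hker b v - hker a v)) +
    sin (t * x) * (sin (t * v) * (hker b v - hker a v)).
  by rewrite (_ : t * (x - v) = t * x - t * v) ?cosB; ring.
have ifx : mu.-integrable setT
    (EFin \o (fun v => cos (t * (x - v)) * (hker b v - hker a v))).
  apply: integrable_boundedM; last exact: integrable_hkerB.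
    apply: (@measurableT_comp _ _ _ _ _ _ (fun y : R => cos (t * y))).
      exact: measurable_cos_scale.
    exact: measurable_refl_shift.
  by move=> ?; exact: cos_max.
transitivity (\int[mu]_v (cos (t * (x - v)) * (hker b v - hker a v))).
  rewrite -(Rintegral_refl_shift x ifx).
  by apply: eq_Rintegral => u _; rewrite subKr.
under eq_Rintegral do rewrite eqf.
rewrite RintegralD//; [|exact: integrable_EFinZl|exact: integrable_EFinZl].
rewrite !RintegralZl// Rintegral_sin_hkerB// Rintegral_cos_hkerB//; ring.
Qed.

Lemma Rintegral_cos_hker a u : 0 <= a ->
  \int[mu]_(t in `[0, a]) ((a - t) * cos (t * u)) = hker a u.
Proof.
rewrite le_eqVlt => /predU1P[<-|a0].
  by rewrite set_itv1 Rintegral_set1 hker0.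
have cf : {within `[0, a], continuous (fun t => (a - t) * cos (t * u))}.
  apply: continuous_subspaceT => t; apply: cvgM.
    by apply: cvgB; [exact: cvg_cst|exact: cvg_id].
  apply: (cvg_comp (fun t => t * u) cos); last exact: continuous_cos.
  by apply: cvgM; [exact: cvg_id|exact: cvg_cst].
have FTC (F : R -> R) : (forall t, is_derive t 1 F ((a - t) * cos (t * u))) ->
    \int[mu]_(t in `[0, a]) ((a - t) * cos (t * u)) = F a - F 0.
  move=> dF; have cF : continuous F.
    by move=> t; apply: differentiable_continuous; apply/derivable1_diffP; exact: ex_derive.
  rewrite /Rintegral (@continuous_FTC2 _ _ F)//.
    by split; [move=> t _; exact: ex_derive|apply: cvg_at_right_filter|apply: cvg_at_left_filter]; exact: cF.
  by move=> t _; rewrite derive1E; exact: derive_val.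
have [u0|u0] := eqVneq u 0.
  have dF t : is_derive t 1 (fun t => a * t - t ^+ 2 / 2) ((a - t) * cos (t * u)).
    by rewrite u0 mulr0 cos0; apply: is_derive_eq; rewrite /GRing.scale/=; lra.
  by rewrite (FTC _ dF) /hker u0 eqxx; lra.
have dF t : is_derive t 1 (fun t => (a - t) * (sin (t * u) / u) - cos (t * u) / u ^+ 2)
    ((a - t) * cos (t * u)).
  by apply: is_derive_eq; rewrite /GRing.scale/=; field.
by rewrite (FTC _ dF) /hker (negbTE u0) subrr !mul0r sin0 cos0; lra.
Qed.

(** The half t >= 0 of the even triangle a - |t|; cosines see no more. It is extended by 0 to the
    line so that Fubini applies there. *)
Definition triangle a t : R := (a - t) * \1_(`[0, a]%classic : set R) t.

Lemma triangle_ge0 a t : 0 <= triangle a t.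
Proof.
rewrite /triangle indicE; case: (boolP (t \in _)) => [|_]; last by rewrite mulr0.
by rewrite inE/= in_itv/= => /andP[? ?]; rewrite mulr1; lra.
Qed.

Lemma measurable_triangle a : measurable_fun setT (triangle a).
Proof. by apply: measurable_funM; [exact: measurable_funB|exact: measurable_indic]. Qed.

Lemma integrable_triangle a : mu.-integrable setT (EFin \o triangle a).
Proof.
apply: (@le_integrable_EFin _ _ R mu _ (fun t => a * \1_(`[0, a]%classic : set R) t)).
- exact: measurable_triangle.
- move=> t; rewrite ger0_norm ?triangle_ge0// /triangle indicE.
  case: (boolP (t \in _)) => [|_]; last by rewrite !mulr0.
  by rewrite inE/= in_itv/= => /andP[? ?]; rewrite !mulr1; lra.
- by apply: integrable_EFinZl; exact: integrable_indic_itv.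
Qed.

Lemma Rintegral_cos_triangle a u : 0 <= a ->
  \int[mu]_t (cos (t * u) * triangle a t) = hker a u.
Proof.
move=> a0; rewrite -(Rintegral_cos_hker _ a0) /Rintegral [in RHS]integral_indicM.
by congr fine; apply: eq_integral => t _; rewrite /triangle mulrCA mulrA.
Qed.

(** [hker a] is a superposition of cosines of frequencies t <= a, and convolution with the
    difference multiplies each of them by the same number pi (c - b). *)
Lemma hker_conv a b c x : 0 <= a -> a <= b -> a <= c ->
  \int[mu]_u (hker a u * (hker c (x - u) - hker b (x - u))) =
  pi * (c - b) * hker a x.
Proof.
move=> a0 ab ac.
have [b0 c0] : 0 <= b /\ 0 <= c by lra.
pose D u := hker c (x - u) - hker b (x - u).
have iD : mu.-integrable setT (EFin \o D).
  exact: (integrable_refl_shift x (integrable_hkerB b0 c0)).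
have mD : measurable_fun setT D by exact: measurable_int_EFin iD.
pose F (z : measurableTypeR R * measurableTypeR R) : R :=
  cos (z.1 * z.2) * triangle a z.1 * D z.2.
have mF : measurable_fun setT F.
  apply: measurable_funM; first apply: measurable_funM.
  - apply: (@measurableT_comp _ _ _ _ _ _ (@cos R)).
      by apply: continuous_measurable_fun; exact: continuous_cos.
    exact: measurable_funM.
  - apply: (@measurableT_comp _ _ _ _ _ _ (triangle a)) => //; exact: measurable_triangle.
  - exact: (@measurableT_comp _ _ _ _ _ _ D).
have iaD := integrable_norm iD.
have intF : (mu \x mu)%E.-integrable setT (EFin \o F).
  apply: (@integrable_prod_dominated _ _ _ _ R mu mu F
    (fun t => (\int[mu]_u `|D u|) * triangle a t)) => //; last first.
    by apply: integrable_EFinZl; exact: integrable_triangle.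
  move=> t; rewrite mulrC EFinM fineK; last by apply: integrable_fin_num => //; exact: iaD.
  rewrite -ge0_integralZl_EFin//; [|by apply/measurable_EFinP; exact: measurableT_comp|exact: triangle_ge0].
  apply: ge0_le_integral => //.
  - apply/measurable_EFinP; apply: measurableT_comp => //.
    by apply: (measurableT_comp mF); exact: measurable_pair1.
  - by apply: measurable_funeM; apply/measurable_EFinP; exact: measurableT_comp.
  - move=> u _; rewrite -EFinM lee_fin /F/= normrM ler_wpM2r// normrM.
    by rewrite (ger0_norm (triangle_ge0 _ _)) ler_piMl ?triangle_ge0// cos_max.
have i1 t : mu.-integrable setT (fun u => (F (t, u))%:E).
  apply: (@integrable_boundedM _ _ R mu D (fun u => cos (t * u) * triangle a t) (triangle a t)) => //.
    by apply: measurable_funM => //; exact: measurable_cos_scale.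
  by move=> u; rewrite normrM (ger0_norm (triangle_ge0 _ _)) ler_piMl ?triangle_ge0// cos_max.
have i0 u : mu.-integrable setT (EFin \o (fun t => cos (t * u) * triangle a t)).
  apply: (integrable_boundedM (M := 1)); last exact: integrable_triangle.
    by under eq_fun do rewrite mulrC; exact: measurable_cos_scale.
  by move=> t; exact: cos_max.
have i2 u : mu.-integrable setT (fun t => (F (t, u))%:E).
  exact: (integrable_EFinZr (D u) (i0 u)).
transitivity (\int[mu]_u \int[mu]_t F (t, u)).
  apply: eq_Rintegral => u _; rewrite /F/= RintegralZr// -/(D u).
  by rewrite Rintegral_cos_triangle.
rewrite -(@Fubini_Rintegral _ _ _ _ R mu mu)//.
transitivity (\int[mu]_t (pi * (c - b) * (cos (t * x) * triangle a t))).
  apply: eq_Rintegral => t _; rewrite /F/=.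
  have [ta|ta] := boolP (t \in `[0, a]); last first.
    rewrite /triangle indicE (_ : (t \in _) = false); last by apply/negP; rewrite inE; exact/negP.
    under eq_Rintegral do rewrite !mulr0 mul0r.
    by rewrite /Rintegral integral0 !mulr0.
  move: ta; rewrite in_itv/= => /andP[t0 ta].
  have it : mu.-integrable setT (EFin \o (fun u => cos (t * u) * D u)).
    apply: (integrable_boundedM (M := 1)) => //; first exact: measurable_cos_scale.
    by move=> ?; exact: cos_max.
  transitivity (\int[mu]_u (triangle a t * (cos (t * u) * D u))).
    by apply: eq_Rintegral => u _; rewrite mulrAC mulrC.
  by rewrite RintegralZl// Rintegral_cos_hkerB_shift; [ring|lra..].
by rewrite RintegralZl// Rintegral_cos_triangle.
Qed.

End fejer_fourier.

(** * Integration over boxes and of tensor products *)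

Section integral_Rd.
Context {R : realType}.
Notation mu := (@lebesgue_measure R).
Notation lam d := (lebesgue_Rd R d).

Lemma ge0_integral_Rd_S d (f : Rd R d.+1 -> \bar R) :
  measurable_fun setT f -> (forall x, 0 <= f x)%E ->
  (\int[lam d.+1]_x f x = \int[mu]_a \int[lam d]_t f (cons_Rd (a, t)))%E.
Proof.
move=> mf f0.
transitivity (\int[mu \x lam d]_z f (cons_Rd z))%E.
  by apply: (ge0_integral_pushforward measurable_cons_Rd (mu \x lam d)%E measurableT mf).
by rewrite fubini_tonelli1//; apply: (measurableT_comp mf); exact: measurable_cons_Rd.
Qed.

Lemma Rintegral_Rd_S d (f : Rd R d.+1 -> R) :
  (lam d.+1).-integrable setT (EFin \o f) ->
  (forall a, (lam d).-integrable setT (fun t => (f (cons_Rd (a, t)))%:E)) ->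
  \int[lam d.+1]_x f x = \int[mu]_a \int[lam d]_t f (cons_Rd (a, t)).
Proof.
move=> intf ints; have mf := measurable_int _ intf.
have mfc : measurable_fun setT (EFin \o f \o @cons_Rd R d).
  by apply: (measurableT_comp mf); exact: measurable_cons_Rd.
have intfc : (mu \x lam d)%E.-integrable setT (EFin \o f \o @cons_Rd R d).
  apply/integrableP; split => //.
  case/integrableP : intf => _; apply: le_lt_trans.
  rewrite (_ : (\int[lam d.+1]_x _)%E = (\int[mu \x lam d]_z `|(EFin \o f \o @cons_Rd R d) z|)%E)//.
  have mf' : measurable_fun setT (abse \o (EFin \o f)) by exact: measurableT_comp.
  apply: (ge0_integral_pushforward measurable_cons_Rd (mu \x lam d)%E measurableT mf').
  by move=> y _; exact: abse_ge0.
transitivity (fine (\int[mu \x lam d]_z (f (cons_Rd z))%:E)%E).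
  congr fine; apply: (integral_pushforward measurable_cons_Rd mf _ measurableT).
  by rewrite preimage_setT.
rewrite -integral12_prod_meas1//; congr fine; apply: eq_integral => a _ /=.
by rewrite /fubini_F /Rintegral fineK//; exact: integrable_fin_num.
Qed.

Definition prodfun d (g : 'I_d -> R -> R) (x : Rd R d) : R :=
  \prod_(j < d) g j (tnth x j).

Lemma prodfun_cons d (g : 'I_d.+1 -> R -> R) a (t : Rd R d) :
  prodfun g (cons_Rd (a, t)) = g ord0 a * prodfun (fun j => g (lift ord0 j)) t.
Proof.
rewrite /prodfun big_ord_recl; congr (_ * _).
by apply: eq_bigr => j _; rewrite tnthS.
Qed.

Lemma measurable_prodfun d (g : 'I_d -> R -> R) :
  (forall j, measurable_fun setT (g j)) -> measurable_fun setT (prodfun g).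
Proof.
move=> mg; apply: measurable_prod => j _.
exact: (measurableT_comp (mg j) (measurable_tnth j)).
Qed.

Lemma prodfun_ge0 d (g : 'I_d -> R -> R) x :
  (forall j y, 0 <= g j y) -> 0 <= prodfun g x.
Proof. by move=> g0; apply: prodr_ge0. Qed.

Lemma normr_prodfun d (g : 'I_d -> R -> R) x :
  `|prodfun g x| = prodfun (fun j y => `|g j y|) x.
Proof. by rewrite /prodfun normr_prod. Qed.

Lemma ge0_integral_prodfun d (g : 'I_d -> R -> R) :
  (forall j, measurable_fun setT (g j)) -> (forall j y, 0 <= g j y) ->
  (\int[lam d]_x (prodfun g x)%:E = \prod_(j < d) \int[mu]_y (g j y)%:E)%E.
Proof.
elim: d g => [|d IH] g mg g0.
  rewrite big_ord0 /= integral_dirac// ?diracE ?mem_set ?mul1e//.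
    by rewrite /prodfun big_ord0.
  by apply/measurable_EFinP; exact: measurable_prodfun.
rewrite ge0_integral_Rd_S; last 2 first.
- by apply/measurable_EFinP; exact: measurable_prodfun.
- by move=> x; rewrite lee_fin prodfun_ge0.
under eq_integral do under eq_integral do rewrite prodfun_cons EFinM.
rewrite big_ord_recl -IH//.
rewrite -ge0_integralZr//; last 3 first.
- by apply/measurable_EFinP; exact: mg.
- by move=> y _; rewrite lee_fin.
- by apply: integral_ge0 => x _; rewrite lee_fin prodfun_ge0.
apply: eq_integral => a _; rewrite ge0_integralZl ?lee_fin//.
- by apply/measurable_EFinP; exact: measurable_prodfun.
- by move=> x _; rewrite lee_fin prodfun_ge0.
Qed.

Lemma integrable_prodfun d (g : 'I_d -> R -> R) :
  (forall j, mu.-integrable setT (EFin \o g j)) ->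
  (lam d).-integrable setT (EFin \o prodfun g).
Proof.
move=> ig; have mg j : measurable_fun setT (g j) := measurable_int_EFin (ig j).
apply/integrableP; split; first by apply/measurable_EFinP; exact: measurable_prodfun.
under eq_integral do rewrite /= normr_prodfun.
rewrite ge0_integral_prodfun//; last by move=> j; exact: measurableT_comp.
rewrite (eq_bigr (fun j => (\int[mu]_y `|g j y|)%:E)); last first.
  move=> j _; rewrite /Rintegral fineK//; apply: integrable_fin_num => //.
  exact: integrable_norm (ig j).
by rewrite prodEFin ltry.
Qed.

Lemma Rintegral_prodfun d (g : 'I_d -> R -> R) :
  (forall j, mu.-integrable setT (EFin \o g j)) ->
  \int[lam d]_x prodfun g x = \prod_(j < d) \int[mu]_y g j y.
Proof.
elim: d g => [|d IH] g ig.
  rewrite big_ord0 /Rintegral /= integral_dirac// ?diracE ?mem_set ?mul1e//.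
    by rewrite /prodfun big_ord0.
  by apply/measurable_EFinP; apply: measurable_prodfun => -[].
rewrite Rintegral_Rd_S; last 2 first.
- exact: integrable_prodfun.
- move=> a; under eq_fun do rewrite prodfun_cons.
  by apply: integrable_EFinZl; exact: integrable_prodfun.
rewrite big_ord_recl -IH// -RintegralZr//.
apply: eq_Rintegral => a _.
rewrite -RintegralZl//; last exact: integrable_prodfun.
by apply: eq_Rintegral => t _; rewrite prodfun_cons.
Qed.

Lemma lebesgue_Rd_hyperplane d (i : 'I_d) (c : R) :
  lam d [set x | tnth x i = c] = 0%E.
Proof.
rewrite (_ : [set x | _] =
    [set x | forall j, (if j == i then [set c] else setT) (tnth x j)]); last first.
  apply/seteqP; split=> x /=.
    by move=> xc j; case: eqP => // ->.
  by move=> /(_ i); rewrite eqxx.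
rewrite (@lebesgue_Rd_box R d (fun j => if j == i then [set c] else setT)); last first.
  by move=> j; case: ifP => _ //; exact: (@measurable_set1 R c).
rewrite (bigD1 i)//= eqxx -[X in (X * _)%E]/(lebesgue_measure [set c]).
by rewrite lebesgue_measure_set1 mul0e.
Qed.

(** Serves twice: to discard the points where the quotient in [VP_kernel] is 0 / 0, and the faces of
    a box, where the averages of the kernel are not controlled. *)
Lemma ae_neq_coord d (c : 'I_d -> R) :
  {ae lam d, forall x, forall i, tnth x i != c i}.
Proof.
have H i : {ae lam d, forall x, tnth x i != c i}.
  exists [set x | tnth x i = c i]; split.
  - rewrite -[X in measurable X]setTI.
    exact: (@measurable_tnth _ (measurableTypeR R) d i measurableT [set c i] (@measurable_set1 R (c i))).
  - exact: lebesgue_Rd_hyperplane.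
  - by move=> x /= /negP; rewrite negbK => /eqP.
exact: (@filter_forall _ _ _ (almost_everywhere (lam d)) (ae_filter_ringOfSetsType (lam d)) H).
Qed.

(** No order is imposed on [a] and [b]: empty boxes count, so that boxes are stable under
    intersection. *)
Definition box d (a b : 'I_d -> R) : set (Rd R d) :=
  [set x | forall i, `]a i, b i]%classic (tnth x i)].

Lemma measurable_box d (a b : 'I_d -> R) : measurable (box a b).
Proof.
rewrite (_ : box a b = \bigcap_(i : 'I_d)
    ((fun x : Rd R d => tnth x i) @^-1` `]a i, b i]%classic)); last first.
  by apply/seteqP; split => x h i => [_|]; exact: h.
apply: fin_bigcap_measurable => // i _.
by rewrite -[X in measurable X]setTI; exact: measurable_tnth.
Qed.

Lemma boxI d (a b a' b' : 'I_d -> R) : box a b `&` box a' b' =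
  box (fun i => Num.max (a i) (a' i)) (fun i => Num.min (b i) (b' i)).
Proof.
apply/seteqP; split => x /=.
  move=> [h h'] i; have := h i; have := h' i.
  by rewrite /= !in_itv/= gt_max le_min => /andP[-> ->] /andP[-> ->].
move=> h; split => i; have := h i;
  by rewrite /= !in_itv/= gt_max le_min => /andP[/andP[? ?]/andP[? ?]]; apply/andP; split.
Qed.

(** A slab, with one coordinate in []a, b]], is the union over [k] of the boxes whose other sides
    are []-k, k]]; slabs generate the product sigma-algebra. *)
Lemma measurable_Rd_box d :
  @measurable _ (Rd R d) = <<s [set A | exists a b : 'I_d -> R, A = box a b] >>.
Proof.
set G := [set A | _].
have GM : G `<=` @measurable _ (Rd R d) by move=> _ [a [b ->]]; exact: measurable_box.
apply/seteqP; split; last first.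
  by apply: smallest_sub => //; exact: sigma_algebra_measurable.
apply: smallest_sub; first exact: smallest_sigma_algebra.
have bigE (H : 'I_d -> set (set (Rd R d))) A :
    (\big[setU/set0]_(i < d) H i) A -> exists i, H i A.
  elim/big_ind : _ A => [//|X Y hX hY A [/hX|/hY]//|i _ A h].
  by exists i.
move=> A /bigE[i [B mB <-]]; rewrite setTI.
pose S : set (set R) := [set B | <<s G >> ((fun x : Rd R d => tnth x i) @^-1` B)].
suff : <<s (@ocitv R) >> `<=` S by apply.
apply: smallest_sub.
  split.
  - by rewrite /S /= preimage_set0; exact: sigma_algebra0.
  - by move=> C SC; rewrite /S /= setTD -preimage_setC -setTD; exact: sigma_algebraCD.
  - by move=> F SF; rewrite /S /= preimage_bigcup; exact: sigma_algebra_bigcup.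
move=> _ [[a b] _ <-]; rewrite /S /=.
rewrite (_ : _ @^-1` _ = \bigcup_k box (fun j => if j == i then a else - k%:R)
    (fun j => if j == i then b else k%:R)).
  apply: sigma_algebra_bigcup => k; apply: sub_gen_smallest.
  by exists (fun j => if j == i then a else - k%:R), (fun j => if j == i then b else k%:R).
apply/seteqP; split => x /=; last first.
  by move=> [k _ /(_ i)]; rewrite eqxx.
(* [K] exceeds every coordinate of [x] in absolute value. *)
move=> xi; pose K := (\max_(j < d) `|Num.ceil `|tnth x j| |%N).+1.
exists K => // j; case: eqP => [->//|_]; rewrite /= in_itv/=.
have : `|tnth x j| < K%:R.
  rewrite /K -natr1 ltr_pwDr// (le_trans (ceil_ge _))//.
  rewrite -[leRHS]/((_%:Z)%:~R) ler_int (le_trans (lez_abs _))//.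
  by rewrite lez_nat (@leq_bigmax _ (fun j => `|Num.ceil `|tnth x j| |%N)).
by rewrite ltr_norml => /andP[-> /ltW].
Qed.

(** Dynkin's pi-lambda argument. It is run inside the fixed cube [D k], on which [F] is integrable;
    globally [F] need not be. The cubes exhaust the space. *)
Lemma ae_eq0_box d (F : Rd R d -> R) : measurable_fun setT F ->
  (forall a b : 'I_d -> R, (lam d).-integrable (box a b) (EFin \o F)) ->
  (forall a b : 'I_d -> R, \int[lam d]_(x in box a b) F x = 0) ->
  {ae lam d, forall x, F x = 0}.
Proof.
move=> mF iF F0.
pose D k : set (Rd R d) := box (fun=> - k%:R) (fun=> k%:R).
have mD k : measurable (D k) by exact: measurable_box.
have main k A : measurable A -> (\int[lam d]_(x in A `&` D k) (F x)%:E = 0)%E.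
  rewrite {1}(measurable_Rd_box d) => sA.
  apply: (@dynkin_induction _ _ _
    (fun A => (\int[lam d]_(x in A `&` D k) (F x)%:E = 0)%E) (measurable_Rd_box d)) sA.
  - by move=> _ _ [a [b ->]] [a' [b' ->]]; rewrite boxI; do 2 eexists.
  - rewrite setTI -[LHS]fineK ?[fine _]F0//.
    by apply: integrable_fin_num => //; exact: iF.
  - move=> _ [a [b ->]]; rewrite boxI -[LHS]fineK ?[fine _]F0//.
    by apply: integrable_fin_num; [exact: measurable_box|exact: iF].
  - move=> S mS S0.
    (* Complements: the integrals over the two pieces add up to the integral over the box [D k],
       which is 0. *)
    have DE : D k = (S `&` D k) `|` (~` S `&` D k) by rewrite -setIUl setUv setTI.
    have := F0 (fun=> - k%:R) (fun=> k%:R); rewrite -/(D k) {1}DE.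
    have iS B : measurable B -> (lam d).-integrable (B `&` D k) (EFin \o F).
      by move=> mB; apply: (integrableS (mD k)) => //; [exact: measurableI|exact: iF].
    rewrite Rintegral_setU//; last 4 first.
    + exact: measurableI.
    + by apply: measurableI => //; exact: measurableC.
    + by rewrite -DE; exact: iF.
    + by apply/disj_setPS => x [[? ?] []].
    rewrite /Rintegral S0 add0r => h.
    rewrite -[LHS]fineK ?h//; apply: integrable_fin_num.
      by apply: measurableI => //; exact: measurableC.
    by apply: iS; exact: measurableC.
  - move=> B mB tB B0; rewrite setI_bigcupl integral_bigcup//.
    + by apply: eseries0 => n _ _.
    + by apply: trivIset_setIr.
    + by move=> n; exact: measurableI.
    + rewrite -setI_bigcupl; apply: (integrableS (mD k)) => //; last exact: iF.
      by apply: measurableI => //; exact: bigcupT_measurable.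
have aeD k : {ae lam d, forall x, D k x -> F x = 0}.
  have := @integral_ae_eq _ _ R (lam d) (D k) (mD k) (cst 0%E) (EFin \o F) (iF _ _).
  case.
  - exact: measurable_cst.
  - by move=> E ED mE; rewrite -(setIidl ED) main// integral0.
  move=> N [mN N0 subN]; exists N; split => // x /= h; apply: subN => /= h'.
  by apply: h => /h' [].
have := ae_foralln aeD; apply: filterS => x h.
pose K := (\max_(j < d) `|Num.ceil `|tnth x j| |%N).+1.
apply: (h K) => j; rewrite /= in_itv/=.
have : `|tnth x j| < K%:R.
  rewrite /K -natr1 ltr_pwDr// (le_trans (ceil_ge _))//.
  rewrite -[leRHS]/((_%:Z)%:~R) ler_int (le_trans (lez_abs _))//.
  by rewrite lez_nat (@leq_bigmax _ (fun j => `|Num.ceil `|tnth x j| |%N)).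
by rewrite ltr_norml => /andP[-> /ltW].
Qed.

End integral_Rd.

(** * The de la Vallee Poussin kernel *)

Section vp_kernel_1d.
Context {R : realType}.
Notation mu := (@lebesgue_measure R).
Implicit Types (s m : nat) (u x y : R).

(* [V_(2^s) / pi] in dimension one, with its continuous extension at 0. *)
Definition kern s y : R :=
  (pi * 2 ^+ s)^-1 * (hker (2 ^+ s.+1) y - hker (2 ^+ s) y).

Let pi2_gt0 s : 0 < (pi * 2 ^+ s : R).
Proof. by rewrite mulr_gt0 ?pi_gt0 ?exprn_gt0. Qed.

Let exp2_ge0 s : 0 <= (2 ^+ s : R).
Proof. by rewrite exprn_ge0. Qed.

Lemma measurable_kern s : measurable_fun setT (kern s).
Proof.
by apply: measurable_funM => //; apply: measurable_funB; exact: measurable_hker.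
Qed.

Lemma kernN s y : kern s (- y) = kern s y.
Proof. by rewrite /kern !hkerN. Qed.

Lemma kernC s x y : kern s (x - y) = kern s (y - x).
Proof. by rewrite -kernN opprB. Qed.

Lemma integrable_kern s : mu.-integrable setT (EFin \o kern s).
Proof.
by apply: integrable_EFinZl; apply: integrable_EFinB; exact: integrable_hker.
Qed.

Lemma Rintegral_kern s : \int[mu]_y kern s y = 1.
Proof.
rewrite RintegralZl//; last by apply: integrable_EFinB; exact: integrable_hker.
rewrite RintegralB//; [|exact: integrable_hker|exact: integrable_hker].
rewrite !Rintegral_hker// -mulrBr exprS (_ : 2 * 2 ^+ s - 2 ^+ s = 2 ^+ s); last lra.
by rewrite mulVf// gt_eqF.
Qed.

Lemma norm_kern_hker s y :
  `|kern s y| <= (pi * 2 ^+ s)^-1 * (hker (2 ^+ s.+1) y + hker (2 ^+ s) y).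
Proof.
rewrite normrM ger0_norm ?invr_ge0 ?(ltW (pi2_gt0 s))//.
rewrite ler_wpM2l ?invr_ge0 ?(ltW (pi2_gt0 s))//.
by rewrite (le_trans (ler_normB _ _))// !ger0_norm ?hker_ge0.
Qed.

(** 3 = 2 + 1: the two Fejer kernels have integrals pi 2^(s+1) and pi 2^s. *)
Lemma integral_norm_kern s : (\int[mu]_y `|kern s y|%:E <= 3%:E)%E.
Proof.
have i2 : mu.-integrable setT (EFin \o
    (fun y => (pi * 2 ^+ s)^-1 * (hker (2 ^+ s.+1) y + hker (2 ^+ s) y))).
  by apply: integrable_EFinZl; apply: integrable_EFinD; exact: integrable_hker.
apply: (@le_trans _ _
    (\int[mu]_y ((pi * 2 ^+ s)^-1 * (hker (2 ^+ s.+1) y + hker (2 ^+ s) y))%:E)%E).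
  apply: ge0_le_integral => //.
  - by apply/measurable_EFinP; apply: measurableT_comp => //; exact: measurable_kern.
  - exact: measurable_int i2.
  - by move=> y _; rewrite lee_fin norm_kern_hker.
rewrite -[leLHS]fineK; last by apply: integrable_fin_num => //; exact: i2.
rewrite lee_fin -/(Rintegral _ _ _) RintegralZl//; last first.
  by apply: integrable_EFinD; exact: integrable_hker.
rewrite RintegralD//; [|exact: integrable_hker|exact: integrable_hker].
rewrite !Rintegral_hker// -mulrDr exprS (_ : 2 * 2 ^+ s + 2 ^+ s = 2 ^+ s * 3); last lra.
by rewrite mulrA mulKf// gt_eqF.
Qed.

(** Both Fejer kernels lie between 0 and 2 * 4^s, hence so does the modulus of their difference;
    dividing by pi 2^s, it remains to use pi >= 2. *)
Lemma norm_kern_le s y : `|kern s y| <= 2 ^+ s.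
Proof.
rewrite normrM gtr0_norm ?invr_gt0// ler_pdivrMl//.
have h1 := hker_ge0 (2 ^+ s.+1) y; have h2 := hker_ge0 (2 ^+ s) y.
have h3 := hker_le (2 ^+ s.+1) y; have h4 := hker_le (2 ^+ s) y.
move: h3 h4; rewrite exprS exprMn => h3 h4.
have p2 := pi_ge2 R.
have : 2 * (2 ^+ s) ^+ 2 <= pi * 2 ^+ s * 2 ^+ s :> R.
  by rewrite -mulrA -expr2 ler_wpM2r ?sqr_ge0.
move: h1 h3; rewrite exprS => h1 h3; rewrite ler_norml => h; apply/andP; split; lra.
Qed.

Lemma kern_tail s y : `|kern s y| * y ^+ 2 <= 1.
Proof.
rewrite normrM gtr0_norm ?invr_gt0// -mulrA ler_pdivrMl// mulr1.
have h1 := hker_ge0 (2 ^+ s.+1) y; have h2 := hker_ge0 (2 ^+ s) y.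
have h3 := hker_tail (2 ^+ s.+1) y; have h4 := hker_tail (2 ^+ s) y.
have p2 := pi_ge2 R.
have e1 : 1 <= 2 ^+ s :> R by rewrite exprn_ege1// ler1n.
have : 2 <= pi * 2 ^+ s :> R.
  by rewrite (le_trans p2)// ler_peMr// (le_trans _ p2).
apply: le_trans; rewrite -[X in _ * X]ger0_norm ?sqr_ge0// -normrM mulrBl.
have y2 := sqr_ge0 y.
have h5 := mulr_ge0 h1 y2; have h6 := mulr_ge0 h2 y2.
rewrite ler_norml; apply/andP; split; lra.
Qed.

(** The gain 2^-s over [kern_tail] gives concentration at the origin as [s] grows; [kern_tail]
    serves for bounds uniform in [s]. *)
Lemma kern_tail_scale s y : 2 ^+ s * (`|kern s y| * y ^+ 2) <= 1.
Proof.
rewrite normrM gtr0_norm ?invr_gt0//.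
have s0 : 0 < 2 ^+ s :> R by rewrite exprn_gt0.
rewrite (_ : _ * _ = pi^-1 * (`|hker (2 ^+ s.+1) y - hker (2 ^+ s) y| * y ^+ 2)); last first.
  have E (N q A B : R) : N != 0 -> q != 0 -> N * ((q * N)^-1 * A * B) = q^-1 * (A * B).
    by move=> N0 q0; field; rewrite ?N0 ?q0.
  by apply: E; rewrite gt_eqF ?pi_gt0.
rewrite ler_pdivrMl ?pi_gt0// mulr1.
have h1 := hker_ge0 (2 ^+ s.+1) y; have h2 := hker_ge0 (2 ^+ s) y.
have h3 := hker_tail (2 ^+ s.+1) y; have h4 := hker_tail (2 ^+ s) y.
have p2 := pi_ge2 R; apply: le_trans p2.
rewrite -[X in _ * X]ger0_norm ?sqr_ge0// -normrM mulrBl.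
have y2 := sqr_ge0 y.
have h5 := mulr_ge0 h1 y2; have h6 := mulr_ge0 h2 y2.
rewrite ler_norml; apply/andP; split; lra.
Qed.

(** [hker_conv] with b = 2^s and c = 2^(s+1): the gap c - b = 2^s is what the normalization of
    [kern] divides by. *)
Lemma kern_conv_hker s a x : 0 <= a -> a <= 2 ^+ s ->
  \int[mu]_u (kern s (x - u) * hker a u) = hker a x.
Proof.
move=> a0 as_.
have bs : (2 ^+ s : R) <= 2 ^+ s.+1 by rewrite ler_eXn2l ?ltr1n.
transitivity (\int[mu]_u ((pi * 2 ^+ s)^-1 *
    (hker a u * (hker (2 ^+ s.+1) (x - u) - hker (2 ^+ s) (x - u))))).
  by apply: eq_Rintegral => u _; rewrite /kern; ring.
rewrite RintegralZl//; last first.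
  apply: (@integrable_boundedM _ _ R mu
    (fun u => hker (2 ^+ s.+1) (x - u) - hker (2 ^+ s) (x - u)) (hker a) (a ^+ 2 / 2)).
  - exact: measurable_hker.
  - by move=> u; rewrite ger0_norm ?hker_ge0// hker_le.
  - exact: (integrable_refl_shift x (integrable_hkerB (exp2_ge0 s) (exp2_ge0 s.+1))).
rewrite hker_conv// ?(le_trans as_)// exprS (_ : 2 * 2 ^+ s - 2 ^+ s = 2 ^+ s); last lra.
by rewrite mulKf// gt_eqF.
Qed.

Lemma measurable_kern_shift s x : measurable_fun setT (fun u => kern s (x - u)).
Proof.
apply: (@measurableT_comp _ _ _ _ _ _ (kern s)); first exact: measurable_kern.
exact: measurable_refl_shift.
Qed.

Lemma integrable_kern_shift s x :
  mu.-integrable setT (EFin \o (fun u => kern s (x - u))).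
Proof. exact: (integrable_refl_shift x (integrable_kern s)). Qed.

Lemma integral_norm_kern_shift s x :
  (\int[mu]_u `|kern s (x - u)|%:E <= 3%:E)%E.
Proof.
rewrite (@ge0_integral_refl_shift R x (fun u => `|kern s u|%:E))//.
  exact: integral_norm_kern.
by apply/measurable_EFinP; apply: measurableT_comp => //; exact: measurable_kern.
Qed.

Lemma integrable_kernM s x (g : R -> R) (M : R) : measurable_fun setT g ->
  (forall y, `|g y| <= M) ->
  mu.-integrable setT (EFin \o (fun u => kern s (x - u) * g u)).
Proof.
move=> mg gM; under eq_fun do rewrite mulrC.
by apply: (@integrable_boundedM _ _ R mu (fun u => kern s (x - u)) g M) => //; exact: integrable_kern_shift.
Qed.

Lemma kern_conv m s x : (m < s)%N ->
  \int[mu]_u (kern s (x - u) * kern m u) = kern m x.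
Proof.
move=> ms.
have ih a : mu.-integrable setT (EFin \o (fun u => kern s (x - u) * hker a u)).
  apply: (@integrable_kernM s x (hker a) (a ^+ 2 / 2)); first exact: measurable_hker.
  by move=> u; rewrite ger0_norm ?hker_ge0// hker_le.
transitivity (\int[mu]_u ((pi * 2 ^+ m)^-1 *
   (kern s (x - u) * hker (2 ^+ m.+1) u - kern s (x - u) * hker (2 ^+ m) u))).
  by apply: eq_Rintegral => u _; rewrite {2}/kern; ring.
rewrite RintegralZl//; last by apply: integrable_EFinB; exact: ih.
rewrite RintegralB//.
by rewrite !kern_conv_hker// ler_weXn2l ?ler1n// ltnW.
Qed.

Lemma kern_repro m s x u : (m < s)%N ->
  \int[mu]_y (kern s (x - y) * kern m (y - u)) = kern m (x - u).
Proof.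
move=> ms.
have i1 : mu.-integrable setT (EFin \o (fun w => kern s w * kern m (x - u - w))).
  under eq_fun do rewrite mulrC.
  apply: (integrable_boundedM (M := 2 ^+ m)); last exact: integrable_kern.
    exact: measurable_kern_shift.
  by move=> w; exact: norm_kern_le.
transitivity (\int[mu]_w (kern s w * kern m (x - u - w))).
  rewrite -(Rintegral_refl_shift x i1); apply: eq_Rintegral => y _.
  by congr (_ * kern _ _); lra.
rewrite -(Rintegral_refl_shift (x - u) i1) -(kern_conv (x - u) ms).
by apply: eq_Rintegral => y _; rewrite subKr.
Qed.

End vp_kernel_1d.

(** * Pairing an L_p function with a bounded integrable kernel *)

Section Lp_pairing.
Context d (T : measurableType d) (R : realType) (m : {measure set T -> \bar R}).
Implicit Types f g : T -> R.

(** If y > t, then y = y^p y^(1-p) <= y^p t^(1-p), because 1 - p <= 0. *)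
Lemma le_young_powR (p y t : R) : 1 <= p -> 0 <= y -> 0 < t ->
  y <= t + y `^ p * t `^ (1 - p).
Proof.
move=> p1 y0 t0; have [yt|ty] := leP y t.
  by rewrite (le_trans yt)// lerDl mulr_ge0// powR_ge0.
have y1 : 0 < y by exact: lt_trans ty.
rewrite -[leLHS]add0r lerD ?(ltW t0)//.
have E : y = y `^ p * y `^ (1 - p).
  by rewrite -powRD ?(gt_eqF y1) ?implybT// addrC subrK powRr1 ?(ltW y1).
rewrite {1}E ler_wpM2l ?powR_ge0//.
rewrite -(opprB p 1) !powRN lef_pV2 ?posrE ?powR_gt0//.
by rewrite ge0_ler_powR ?nnegrE ?(ltW t0) ?(ltW y1) ?(ltW ty)// subr_ge0.
Qed.

Lemma measurable_norm_powR p f : measurable_fun setT f ->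
  measurable_fun setT (fun x => `|f x| `^ p).
Proof.
move=> mf; apply: (@measurableT_comp _ _ _ _ _ _ (fun y : R => y `^ p)).
  exact: measurable_powR.
exact: measurableT_comp.
Qed.

(** The threshold [t] is left free: t = 1 is enough for integrability, and a balanced choice gives
    the Nikol'skii inequality. *)
Lemma Lp_pairing (p M I B t : R) f g :
  1 <= p -> 0 < t -> measurable_fun setT f -> measurable_fun setT g ->
  0 <= M -> (forall x, `|g x| <= M) ->
  (\int[m]_x `|g x|%:E <= I%:E)%E ->
  (\int[m]_x (`|f x| `^ p)%:E <= B%:E)%E ->
  (\int[m]_x `|g x * f x|%:E <= (t * I + M * t `^ (1 - p) * B)%:E)%E.
Proof.
move=> p1 t0 mf mg M0 gM gI fB.
have mpf := measurable_norm_powR p mf.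
have mag : measurable_fun setT (fun x => `|g x|) by exact: measurableT_comp.
have Mt0 : 0 <= M * t `^ (1 - p) by rewrite mulr_ge0 ?powR_ge0.
apply: (@le_trans _ _ (\int[m]_x ((t * `|g x|)%:E + (M * t `^ (1 - p) * `|f x| `^ p)%:E))%E).
  apply: ge0_le_integral => //.
  - by apply/measurable_EFinP; apply: measurableT_comp => //; exact: measurable_funM.
  - by apply: emeasurable_funD; apply/measurable_EFinP; exact: measurable_funM.
  - move=> x _; rewrite -EFinD lee_fin normrM.
    apply: (@le_trans _ _ (`|g x| * (t + `|f x| `^ p * t `^ (1 - p)))).
      by rewrite ler_wpM2l// le_young_powR.
    rewrite mulrDr mulrC lerD2l -mulrA (mulrC (_ `^ p)).
    by rewrite ler_wpM2r// mulr_ge0 ?powR_ge0.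
rewrite ge0_integralD//; last 4 first.
- by move=> x _; rewrite lee_fin mulr_ge0// ltW.
- by apply/measurable_EFinP; exact: measurable_funM.
- by move=> x _; rewrite lee_fin mulr_ge0// powR_ge0.
- by apply/measurable_EFinP; exact: measurable_funM.
rewrite EFinD leeD//.
  under eq_integral do rewrite EFinM.
  rewrite ge0_integralZl_EFin//; [|exact/measurable_EFinP|exact: ltW].
  by rewrite EFinM lee_wpmul2l// lee_fin ltW.
under eq_integral do rewrite EFinM.
rewrite ge0_integralZl_EFin//; last exact/measurable_EFinP.
by rewrite [in leRHS]EFinM lee_wpmul2l.
Qed.

Lemma integrable_Lp_pairing (p M I B : R) f g :
  1 <= p -> measurable_fun setT f -> measurable_fun setT g ->
  0 <= M -> (forall x, `|g x| <= M) ->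
  (\int[m]_x `|g x|%:E <= I%:E)%E ->
  (\int[m]_x (`|f x| `^ p)%:E <= B%:E)%E ->
  m.-integrable setT (EFin \o (fun x => g x * f x)).
Proof.
move=> p1 mf mg M0 gM gI fB; apply/integrableP; split.
  by apply/measurable_EFinP; exact: measurable_funM.
by apply: le_lt_trans (Lp_pairing p1 ltr01 mf mg M0 gM gI fB) _; exact: ltry.
Qed.

Lemma norm_Rintegral_le f (M : R) : m.-integrable setT (EFin \o f) ->
  (\int[m]_x `|f x|%:E <= M%:E)%E -> `|\int[m]_x f x| <= M.
Proof.
move=> intf fM; rewrite (le_trans (le_normr_Rintegral _ _))//.
by rewrite -lee_fin /Rintegral fineK//; apply: integrable_fin_num => //; exact: integrable_norm.
Qed.

End Lp_pairing.

(** * Convolution operators and blocks for real functions on R^d *)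

Section vp_convolution.
Context {R : realType} {d : nat}.
Notation lam := (lebesgue_Rd R d).
Implicit Types (p A B M : R) (s m : nat) (x u y : Rd R d) (f g : Rd R d -> R).

(** This is pi^(-d) V_(2^s) (x - u), continuously extended, kept as a tensor product in [u]. *)
Definition Kern s x u : R := prodfun (fun j w => kern s (tnth x j - w)) u.

Lemma measurable_Kern s x : measurable_fun setT (Kern s x).
Proof. by apply: measurable_prodfun => j; exact: measurable_kern_shift. Qed.

Lemma measurable_Kern2 s :
  measurable_fun setT (fun z : Rd R d * Rd R d => Kern s z.1 z.2).
Proof.
apply: measurable_prod => j _.
apply: (@measurableT_comp _ _ _ _ _ _ (kern s)); first exact: measurable_kern.
apply: measurable_funB.
  apply: (@measurableT_comp _ _ _ _ _ _ (fun x : Rd R d => tnth x j)) => //.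
  exact: measurable_tnth.
apply: (@measurableT_comp _ _ _ _ _ _ (fun x : Rd R d => tnth x j)) => //.
exact: measurable_tnth.
Qed.

Lemma KernC s x u : Kern s x u = Kern s u x.
Proof. by apply: eq_bigr => j _; rewrite kernC. Qed.

Lemma integrable_Kern s x : lam.-integrable setT (EFin \o Kern s x).
Proof. by apply: integrable_prodfun => j; exact: integrable_kern_shift. Qed.

Lemma integral_norm_Kern s x : (\int[lam]_u `|Kern s x u|%:E <= (3 ^+ d)%:E)%E.
Proof.
under eq_integral do rewrite normr_prodfun.
rewrite ge0_integral_prodfun//; last first.
  by move=> j; apply: measurableT_comp => //; exact: measurable_kern_shift.
rewrite (eq_bigr (fun j =>
    (\int[lebesgue_measure]_w `|kern s (tnth x j - w)|)%:E)); last first.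
  move=> j _; rewrite /Rintegral fineK//; apply: integrable_fin_num => //.
  exact: integrable_norm (integrable_kern_shift s (tnth x j)).
rewrite prodEFin lee_fin -[X in 3 ^+ X](card_ord d) -prodr_const.
apply: ler_prod => j _; rewrite Rintegral_ge0//= -lee_fin /Rintegral fineK.
  exact: integral_norm_kern_shift.
apply: integrable_fin_num => //.
exact: integrable_norm (integrable_kern_shift s (tnth x j)).
Qed.

Lemma norm_Kern_le s x u : `|Kern s x u| <= 2 ^+ (s * d).
Proof.
rewrite normr_prodfun exprM -[X in _ ^+ X](card_ord d) -prodr_const.
by apply: ler_prod => j _; rewrite normr_ge0/= norm_kern_le.
Qed.

Lemma Kern_repro m s x u : (m < s)%N ->
  \int[lam]_y (Kern s x y * Kern m y u) = Kern m x u.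
Proof.
move=> ms.
transitivity (\int[lam]_y prodfun
    (fun j w => kern s (tnth x j - w) * kern m (w - tnth u j)) y).
  by apply: eq_Rintegral => y _; rewrite /Kern /prodfun -big_split.
rewrite Rintegral_prodfun; first by apply: eq_bigr => j _; rewrite kern_repro.
move=> j; apply: (@integrable_kernM _ s (tnth x j) _ (2 ^+ m)).
  under eq_fun do rewrite kernC; exact: measurable_kern_shift.
by move=> y; exact: norm_kern_le.
Qed.

Definition conv s f x : R := \int[lam]_u (Kern s x u * f u).

(** For B >= 0 this says that the L_p norm is at most [B], without taking a root. *)
Definition Lp_le (p B : R) f :=
  measurable_fun setT f /\ (\int[lam]_x (`|f x| `^ p)%:E <= (B `^ p)%:E)%E.

Lemma measurable_KernM s f x : measurable_fun setT f ->
  measurable_fun setT (fun u => Kern s x u * f u).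
Proof. by move=> mf; apply: measurable_funM => //; exact: measurable_Kern. Qed.

Lemma measurable_conv s f : measurable_fun setT f -> measurable_fun setT (conv s f).
Proof.
move=> mf; apply: (@measurable_Rintegral2 _ _ _ _ R lam
  (fun z : Rd R d * Rd R d => Kern s z.1 z.2 * f z.2)).
apply: measurable_funM; first exact: measurable_Kern2.
exact: (@measurableT_comp _ _ _ _ _ _ f).
Qed.

Lemma integrable_conv p B s f x : 1 <= p -> Lp_le p B f ->
  lam.-integrable setT (EFin \o (fun u => Kern s x u * f u)).
Proof.
move=> p1 [mf fB].
apply: (integrable_Lp_pairing p1 mf (measurable_Kern s x) _ (norm_Kern_le s x)
  (integral_norm_Kern s x) fB).
by rewrite exprn_ge0.
Qed.

Lemma integral_conv_le p B s f x : 1 <= p -> 0 < B -> Lp_le p B f ->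
  (\int[lam]_u `|Kern s x u * f u|%:E <=
    ((3 ^+ d + 1) * (2 `^ ((s * d)%:R / p) * B))%:E)%E.
Proof.
move=> p1 B0 [mf fB]; have p0 : 0 < p by exact: lt_le_trans p1.
(* The balancing threshold: t^p = 2^(s d) B^p, so the second term of [Lp_pairing] is exactly [t],
   which explains the constant 3^d + 1. *)
set t := 2 `^ _ * B.
have t0 : 0 < t by rewrite mulr_gt0// powR_gt0.
have e0 : 0 <= 2 ^+ (s * d) :> R by rewrite exprn_ge0.
have := Lp_pairing p1 t0 mf (measurable_Kern s x) e0 (norm_Kern_le s x)
  (integral_norm_Kern s x) fB.
congr (_ <= _%:E)%E.
have tp : t `^ p = 2 ^+ (s * d) * B `^ p.
  rewrite /t powRM ?powR_ge0 ?(ltW B0)// -powRrM divfK ?gt_eqF//.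
  by rewrite powR_mulrn.
rewrite -mulrA (mulrCA (2 ^+ _)) -tp -powRD ?(gt_eqF t0) ?implybT// subrK powRr1 ?ltW//.
by rewrite mulrDl mul1r mulrC.
Qed.

Lemma norm_conv_le p B s f x : 1 <= p -> 0 < B -> Lp_le p B f ->
  `|conv s f x| <= (3 ^+ d + 1) * (2 `^ ((s * d)%:R / p) * B).
Proof.
move=> p1 B0 fB; apply: norm_Rintegral_le; first exact: (integrable_conv s x p1 fB).
exact: integral_conv_le.
Qed.

Lemma integrable_Kern_bounded s g M x : measurable_fun setT g ->
  (forall y, `|g y| <= M) ->
  lam.-integrable setT (EFin \o (fun u => Kern s x u * g u)).
Proof.
move=> mg gM; under eq_fun do rewrite mulrC.
by apply: (@integrable_boundedM _ _ R lam (Kern s x) g M) => //; exact: integrable_Kern.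
Qed.

(** Associativity by Fubini, then [Kern_repro]. Joint integrability holds because the inner
    convolution is absolutely bounded by [C], uniformly in [y]. *)
Lemma conv_repro p B m s f x : 1 <= p -> 0 < B -> Lp_le p B f -> (m < s)%N ->
  conv s (conv m f) x = conv m f x.
Proof.
move=> p1 B0 fB ms; have [mf _] := fB.
pose C := (3 ^+ d + 1) * (2 `^ ((m * d)%:R / p) * B).
pose F (z : Rd R d * Rd R d) : R := Kern s x z.1 * (Kern m z.1 z.2 * f z.2).
have mF : measurable_fun setT F.
  apply: measurable_funM.
    by apply: (@measurableT_comp _ _ _ _ _ _ (Kern s x)) => //; exact: measurable_Kern.
  apply: measurable_funM; first exact: measurable_Kern2.
  exact: (@measurableT_comp _ _ _ _ _ _ f).
have i1 y : lam.-integrable setT (fun u => (F (y, u))%:E).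
  exact: (integrable_EFinZl (Kern s x y) (integrable_conv m y p1 fB)).
have iKK u : lam.-integrable setT (EFin \o (fun y => Kern s x y * Kern m y u)).
  apply: (@integrable_Kern_bounded s (fun y => Kern m y u) (2 ^+ (m * d))).
    by under eq_fun do rewrite KernC; exact: measurable_Kern.
  by move=> y; exact: norm_Kern_le.
have i2 u : lam.-integrable setT (fun y => (F (y, u))%:E).
  rewrite (_ : (fun y => _) = EFin \o (fun y => Kern s x y * Kern m y u * f u)).
    exact: integrable_EFinZr.
  by apply/funext => y; rewrite /F/= mulrA.
have intF : (lam \x lam)%E.-integrable setT (EFin \o F).
  apply: (@integrable_prod_dominated _ _ _ _ R lam lam F (fun y => C * `|Kern s x y|)) => //.
    move=> y; rewrite mulrC EFinM.
    under eq_integral do rewrite /F/= normrM EFinM.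
    rewrite ge0_integralZl_EFin//; last first.
      by apply/measurable_EFinP; apply: measurableT_comp => //; exact: measurable_KernM.
    by rewrite lee_wpmul2l ?lee_fin//; exact: integral_conv_le.
  by apply: integrable_EFinZl; exact: integrable_norm (integrable_Kern s x).
transitivity (\int[lam]_y \int[lam]_u F (y, u)).
  apply: eq_Rintegral => y _; rewrite /F/= RintegralZl//.
  exact: (integrable_conv m y p1 fB).
rewrite (@Fubini_Rintegral _ _ _ _ R lam lam)//.
apply: eq_Rintegral => u _; rewrite -(Kern_repro x u ms) -RintegralZr//.
by apply: eq_Rintegral => y _; rewrite /F/= mulrA.
Qed.

Lemma conv_boundedB s g1 g2 M x : measurable_fun setT g1 -> measurable_fun setT g2 ->
  (forall y, `|g1 y| <= M) -> (forall y, `|g2 y| <= M) ->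
  conv s (fun y => g1 y - g2 y) x = conv s g1 x - conv s g2 x.
Proof.
move=> mg1 mg2 g1M g2M; rewrite /conv -RintegralB//.
- by apply: eq_Rintegral => u _; rewrite mulrBr.
- exact: (integrable_Kern_bounded s x mg1 g1M).
- exact: (integrable_Kern_bounded s x mg2 g2M).
Qed.

Definition block s f x : R :=
  if s is s'.+1 then conv s f x - conv s' f x else conv 0 f x.

Lemma block_repro p B s f x : 1 <= p -> 0 < B -> Lp_le p B f ->
  conv s.+1 (block s f) x = block s f x.
Proof.
move=> p1 B0 fB; have [mf _] := fB.
case: s => [|s]; first exact: conv_repro fB _.
rewrite (_ : block s.+1 f = fun y => conv s.+1 f y - conv s f y)//.
(* One bound must serve for both levels; the larger level provides it. *)
rewrite (@conv_boundedB _ _ _ ((3 ^+ d + 1) * (2 `^ ((s.+1 * d)%:R / p) * B))).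
- by rewrite !(conv_repro x p1 B0 fB).
- exact: measurable_conv.
- exact: measurable_conv.
- by move=> y; exact: norm_conv_le.
- move=> y; apply: le_trans (norm_conv_le s y p1 B0 fB) _.
  rewrite ler_wpM2l ?addr_ge0 ?exprn_ge0// ler_wpM2r ?(ltW B0)//.
  rewrite ler_powR ?ler1n// ler_wpM2r ?invr_ge0 ?(le_trans ler01 p1)//.
  by rewrite ler_nat leq_mul2r leqnSn orbT.
Qed.

(** Nikol'skii's inequality for a block: it is its own convolution at level s + 1. The bound [A] on
    [f] legitimates this and does not enter the estimate. *)
Lemma norm_block_le p A B s f x : 1 <= p -> 0 < A -> 0 < B -> Lp_le p A f ->
  Lp_le p B (block s f) ->
  `|block s f x| <= (3 ^+ d + 1) * (2 `^ ((s.+1 * d)%:R / p) * B).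
Proof.
by move=> p1 A0 B0 fA fB; rewrite -(block_repro s x p1 A0 fA); exact: norm_conv_le fB.
Qed.

Lemma sum_block n f x : \sum_(0 <= s < n.+1) block s f x = conv n f x.
Proof.
elim: n => [|n IH]; first by rewrite big_nat1.
by rewrite big_nat_recr//= IH addrC subrK.
Qed.

Lemma sum_block_sub n N f x : (n <= N)%N ->
  conv N f x - conv n f x = \sum_(n.+1 <= s < N.+1) block s f x.
Proof.
move=> nN; rewrite -!sum_block [X in X - _](@big_cat_nat _ _ _ n.+1)//=.
by rewrite addrAC subrr add0r.
Qed.

End vp_convolution.

(** * Almost everywhere convergence *)

Section vp_interval.
Context {R : realType}.
Notation mu := (@lebesgue_measure R).
Implicit Types (N : nat) (a b u x y : R).

(** The integrable majorant for dominated convergence. *)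
Definition cauchy_weight x : R := (1 + x ^+ 2)^-1.

Let w_gt0 x : 0 < 1 + x ^+ 2.
Proof. by rewrite ltr_pwDl// sqr_ge0. Qed.

Lemma cauchy_weight_ge0 x : 0 <= cauchy_weight x.
Proof. by rewrite invr_ge0 ltW. Qed.

Lemma cauchy_weight_le1 x : cauchy_weight x <= 1.
Proof. by rewrite invf_le1// lerDl sqr_ge0. Qed.

Lemma continuous_cauchy_weight : continuous cauchy_weight.
Proof.
move=> x; apply: cvgV; first by rewrite gt_eqF.
by apply: cvgD; [exact: cvg_cst|exact: exprn_continuous].
Qed.

Lemma integrable_cauchy_weight : mu.-integrable setT (EFin \o cauchy_weight).
Proof.
apply/integrableP; split.
  by apply/measurable_EFinP; apply: continuous_measurable_fun; exact: continuous_cauchy_weight.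
under eq_integral do rewrite /= ger0_norm ?cauchy_weight_ge0//.
rewrite ge0_symfun_integralT.
- rewrite -set_itvcy integral0y_oneDsqr -EFinM; exact: ltry.
- exact: cauchy_weight_ge0.
- exact: continuous_cauchy_weight.
- by move=> x /=; rewrite /cauchy_weight sqrrN.
Qed.

(** The kernel applied to the indicator of []a, b]]: one factor of what remains when the integral of
    a convolution over a box is exchanged by Fubini. *)
Definition interval_avg N a b u : R := \int[mu]_(x in `]a, b]) kern N (u - x).

Lemma integrable_kern_shiftS N u (A : set R) : measurable A ->
  mu.-integrable A (EFin \o (fun x => kern N (u - x))).
Proof.
by move=> mA; apply: (integrableS measurableT) => //; exact: integrable_kern_shift.
Qed.

Lemma interval_avg_le3 N a b u : `|interval_avg N a b u| <= 3.
Proof.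
have iS := integrable_kern_shiftS N u (measurable_itv `]a, b]).
rewrite (le_trans (le_normr_Rintegral _ iS))//.
rewrite -lee_fin /Rintegral fineK; last first.
  by apply: integrable_fin_num => //; exact: integrable_norm iS.
apply: le_trans (integral_norm_kern_shift N u).
apply: ge0_subset_integral => //.
apply/measurable_EFinP; apply: measurableT_comp => //; exact: measurable_kern_shift.
Qed.

Lemma Rintegral_kern_shift N u : \int[mu]_x kern N (u - x) = 1.
Proof. by rewrite (Rintegral_refl_shift u (integrable_kern N)) Rintegral_kern. Qed.

(** From [kern_tail_scale], since 1 + y^2 <= (1 + delta^-2) y^2 as soon as |y| >= delta. *)
Lemma kern_far (delta : R) N y : 0 < delta -> delta <= `|y| ->
  `|kern N y| <= (1 + delta ^- 2) * cauchy_weight y / 2 ^+ N.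
Proof.
move=> d0 dy; have y0 : 0 < `|y| by exact: lt_le_trans dy.
have yy : 0 < y ^+ 2 by rewrite exprn_even_gt0//= -normr_gt0.
have N0 : 0 < 2 ^+ N :> R by rewrite exprn_gt0.
rewrite ler_pdivlMr// mulrC -(ler_pM2r yy) -mulrA.
rewrite (le_trans (kern_tail_scale N y))//.
have dd : delta ^+ 2 <= y ^+ 2.
  by rewrite -(real_normK (num_real y)) lerXn2r ?nnegrE ?(ltW d0) ?(ltW y0).
rewrite /cauchy_weight mulrAC ler_pdivlMr// mul1r mulrDl mul1r addrC lerD2l.
by rewrite mulrC ler_pdivlMr ?exprn_gt0// mul1r.
Qed.

Lemma Rintegral_kern_far (delta : R) u (A : set R) : measurable A -> 0 < delta ->
  (forall x, A x -> delta <= `|u - x|) ->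
  exists C : R, forall N, `|\int[mu]_(x in A) kern N (u - x)| <= C / 2 ^+ N.
Proof.
move=> mA d0 Ad; pose k := 1 + delta ^- 2.
have k0 : 0 <= k by rewrite addr_ge0// invr_ge0 exprn_ge0// ltW.
have iw : mu.-integrable A (EFin \o (fun x => cauchy_weight (u - x))).
  apply: (integrableS measurableT) => //.
  exact: (integrable_refl_shift u integrable_cauchy_weight).
exists (k * \int[mu]_(x in A) cauchy_weight (u - x)) => N.
have iK := integrable_kern_shiftS N u mA.
rewrite (le_trans (le_normr_Rintegral _ iK))// mulrAC -RintegralZl//.
apply: le_Rintegral => //; first exact: integrable_norm iK.
  exact: (@integrable_EFinZlS _ (measurableTypeR R) R mu A mA (k / 2 ^+ N) _ iw).
by move=> x Ax; rewrite mulrAC; apply: kern_far => //; exact: Ad.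
Qed.

Lemma cvg_geo_bound (v : R^nat) l (C : R) :
  (forall N, `|v N - l| <= C / 2 ^+ N) -> v N @[N --> \oo] --> l.
Proof.
move=> vC; apply/subr_cvg0/norm_cvg0P.
apply: (@squeeze_cvgr _ _ _ _ (cst 0) (fun N => C * 2^-1 ^+ N)).
- by apply: nearW => N; rewrite normr_ge0/= exprVn vC.
- exact: cvg_cst.
- rewrite -[X in _ --> X](mulr0 C); apply: cvgM; first exact: cvg_cst.
  by apply: cvg_expr; rewrite ger0_norm ?invr_ge0// invf_lt1// ltr1n.
Qed.

(** Off the endpoints [u] has positive distance either to the interval or to its complement, and the
    mass of the kernel at that distance is O(2^-N). *)
Lemma interval_avg_cvg a b u : u != a -> u != b ->
  interval_avg N a b u @[N --> \oo] --> (\1_(`]a, b]%classic : set R) u : R).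
Proof.
move=> ua ub; rewrite indicE.
have [|nuab] := boolP (u \in _).
  rewrite inE/= in_itv/= => /andP[au ub'].
  have {}ub' : u < b by rewrite lt_neqAle ub.
  have mC : measurable (~` `]a, b]%classic : set R) by exact: measurableC.
  have d0 : 0 < Num.min (u - a) (b - u) by rewrite lt_min !subr_gt0 au.
  have [|C hC] := @Rintegral_kern_far _ u _ mC d0.
    move=> x /= /negP; rewrite in_itv/= negb_and -leNgt -ltNge ge_min => /orP[xa|bx].
      by rewrite ger0_norm ?subr_ge0 ?(le_trans xa)// ?(ltW au)// lerD2l lerN2 xa.
    by rewrite ler0_norm ?opprB ?subr_le0 ?(ltW (lt_trans ub' _))// [X in _ || X]lerD2r (ltW bx) orbT.
  apply: (@cvg_geo_bound _ _ C) => N.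
  (* The kernel has total mass 1. *)
  suff -> : interval_avg N a b u - true%:R = - \int[mu]_(x in ~` `]a, b]) kern N (u - x).
    by rewrite normrN.
  have := Rintegral_kern_shift N u.
  rewrite -{1}(setUv `]a, b]%classic) Rintegral_setU//; last 2 first.
  - by rewrite setUv; exact: integrable_kern_shift.
  - by apply/disj_setPS => x [].
  rewrite /interval_avg -[true%:R]/(1 : R); lra.
have hu : u < a \/ b < u \/ b <= a.
  move: nuab; rewrite notin_setE/= in_itv/= => /negP; rewrite negb_and -leNgt -ltNge.
  by rewrite le_eqVlt (negbTE ua)/= => /orP[|]; tauto.
have [ba|ab] := leP b a.
  rewrite /interval_avg set_itv_ge ?bnd_simp -?leNgt//.
  by under eq_cvg do rewrite Rintegral_set0; exact: cvg_cst.
have {}hu : u < a \/ b < u by case: hu => [|[|]]; [left|right|rewrite leNgt ab].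
have [delta d0 hd] : exists2 delta : R, 0 < delta & forall x, `]a, b]%classic x -> delta <= `|u - x|.
  case: hu => h.
    exists (a - u); first by rewrite subr_gt0.
    move=> x /=; rewrite in_itv/= => /andP[ax _].
    by rewrite ler0_norm; lra.
  exists (u - b); first by rewrite subr_gt0.
  move=> x /=; rewrite in_itv/= => /andP[_ xb].
  by rewrite ger0_norm; lra.
have [C hC] := @Rintegral_kern_far _ u _ (measurable_itv `]a, b]) d0 hd.
by apply: (@cvg_geo_bound _ _ C) => N; rewrite subr0; exact: hC.
Qed.

Lemma interval_avg_dominated a b :
  exists M : R, forall N u, `|interval_avg N a b u| <= M * cauchy_weight u.
Proof.
pose r := Num.max 1 (Num.max `|a| `|b|).
have r1 : 1 <= r by rewrite le_max lexx.
have ra : `|a| <= r by rewrite !le_max lexx !orbT.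
have rb : `|b| <= r by rewrite !le_max lexx !orbT.
have L0 : 0 <= fine (mu `]a, b]%classic) by rewrite fine_ge0.
(* The first term covers |u| <= 2 r, where the average is at most 3. For |u| > 2 r and |x| <= r one
   has |u| <= 2 |u - x|, hence 1 + u^2 <= 2 u^2 <= 8 (u - x)^2, and [kern_tail] gives the second
   term. *)
exists (3 * (1 + (2 * r) ^+ 2) + 8 * fine (mu `]a, b]%classic)) => N u.
have [ur|ur] := leP `|u| (2 * r).
  rewrite (le_trans (interval_avg_le3 N a b u))// /cauchy_weight ler_pdivlMr//.
  rewrite ler_wpDr ?mulr_ge0// ler_wpM2l// lerD2l.
  by rewrite -(real_normK (num_real u)) lerXn2r ?nnegrE ?(le_trans (normr_ge0 u)).
have iS := integrable_kern_shiftS N u (measurable_itv `]a, b]).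
rewrite mulrDl ler_wpDl//.
  by rewrite mulr_ge0 ?cauchy_weight_ge0// mulr_ge0// ltW.
rewrite (le_trans (le_normr_Rintegral _ iS))// mulrAC -Rintegral_cst//.
apply: le_Rintegral => //; first exact: integrable_norm iS.
  apply/integrableP; split; first exact: measurable_cst.
  have muf : (mu `]a, b]%classic < +oo)%E.
    by rewrite lebesgue_measure_itv/=; case: ifP => _; rewrite ?ltry// -EFinD ltry.
  by rewrite /= integral_cst// lte_mul_pinfty ?lee_fin.
move=> x /=; rewrite in_itv/= => /andP[ax xb].
have xr : `|x| <= r.
  rewrite ler_norml; apply/andP; split.
    by move: ra; rewrite ler_norml => /andP[? _]; lra.
  by move: rb; rewrite ler_norml => /andP[_ ?]; lra.
have h1 : `|u| <= 2 * `|u - x|.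
  have := ler_normD (u - x) x; rewrite subrK; lra.
have u1 : 1 <= `|u| by lra.
have ux : 0 < (u - x) ^+ 2 by rewrite exprn_even_gt0//= -normr_gt0; lra.
rewrite /cauchy_weight ler_pdivlMr// -(ler_pM2r ux).
have t := kern_tail N (u - x).
have u2 : 1 + u ^+ 2 <= 8 * (u - x) ^+ 2.
  rewrite -(real_normK (num_real u)) -(real_normK (num_real (u - x))).
  have : `|u| ^+ 2 <= (2 * `|u - x|) ^+ 2 by rewrite lerXn2r ?nnegrE ?mulr_ge0.
  have : 1 <= `|u| ^+ 2 by rewrite exprn_ege1.
  rewrite exprMn; lra.
rewrite mulrAC (le_trans (ler_wpM2r (ltW (w_gt0 u)) t))// mul1r//.
Qed.

Lemma measurable_interval_avg N a b : measurable_fun setT (interval_avg N a b).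
Proof.
rewrite (_ : interval_avg N a b = fun u => \int[mu]_x (kern N (u - x) * \1_(`]a, b]%classic : set R) x)).
  apply: (@measurable_Rintegral2 _ _ _ _ R mu
    (fun z : measurableTypeR R * measurableTypeR R =>
      kern N (z.1 - z.2) * \1_(`]a, b]%classic : set R) z.2)).
  apply: measurable_funM.
    apply: (@measurableT_comp _ _ _ _ _ _ (kern N)); first exact: measurable_kern.
    exact: measurable_funB.
  exact: (@measurableT_comp _ _ _ _ _ _ (\1_(`]a, b]%classic : set R) : R -> R)).
by apply/funext => u; rewrite /interval_avg /Rintegral integral_indicM.
Qed.

End vp_interval.

Lemma cvg_prodr {R : realType} (I : Type) (r : seq I) (v : I -> R^nat) (l : I -> R) :
  (forall i, v i N @[N --> \oo] --> l i) ->
  \prod_(i <- r) v i N @[N --> \oo] --> \prod_(i <- r) l i.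
Proof.
move=> vl; elim: r => [|i r IH].
  by rewrite big_nil; under eq_cvg do rewrite big_nil; exact: cvg_cst.
by rewrite big_cons; under eq_cvg do rewrite big_cons; apply: cvgM.
Qed.

Section vp_convergence.
Context {R : realType} {d : nat}.
Notation lam := (lebesgue_Rd R d).
Notation mu := (@lebesgue_measure R).
Implicit Types (x u : Rd R d) (f : Rd R d -> R) (a b : 'I_d -> R).

Lemma indic_box a b x :
  \1_(box a b) x = prodfun (fun j => \1_(`]a j, b j]%classic : set R) : R -> R) x.
Proof.
rewrite indicE /prodfun; have [xab|xab] := boolP (x \in _).
  rewrite big1// => j _; rewrite indicE mem_set//.
  by move: xab; rewrite inE => /(_ j).
move: xab; rewrite notin_setE => /existsNP[j xj].
by rewrite (bigD1 j)//= indicE memNset// mul0r.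
Qed.

Lemma integrable_indic_box a b : lam.-integrable setT (EFin \o \1_(box a b)).
Proof.
rewrite (_ : \1_(box a b) = prodfun (fun j => \1_(`]a j, b j]%classic : set R) : R -> R)).
  by apply: integrable_prodfun => j; exact: integrable_indic_itv.
by apply/funext => x; rewrite indic_box.
Qed.

(** Fubini moves the integration over the box onto the kernel, where it factors over the
    coordinates. *)
Lemma conv_box (p B : R) N f a b : 1 <= p -> 0 < B -> Lp_le p B f ->
  \int[lam]_(x in box a b) conv N f x =
  \int[lam]_u (prodfun (fun j => interval_avg N (a j) (b j)) u * f u).
Proof.
move=> p1 B0 fB; have [mf _] := fB.
pose C := (3 ^+ d + 1) * (2 `^ ((N * d)%:R / p) * B).
pose I : Rd R d -> R := \1_(box a b).
have mI : measurable_fun setT I by apply: measurable_indic; exact: measurable_box.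
pose F (z : Rd R d * Rd R d) : R := I z.1 * (Kern N z.1 z.2 * f z.2).
have I01 x : 0 <= I x <= 1 by rewrite /I indicE; case: (_ \in _); rewrite ler01 lexx.
have mF : measurable_fun setT F.
  apply: measurable_funM; first exact: (@measurableT_comp _ _ _ _ _ _ I).
  apply: measurable_funM; first exact: measurable_Kern2.
  exact: (@measurableT_comp _ _ _ _ _ _ f).
have i1 x : lam.-integrable setT (fun u => (F (x, u))%:E).
  exact: (integrable_EFinZl (I x) (integrable_conv N x p1 fB)).
have i2 u : lam.-integrable setT (fun x => (F (x, u))%:E).
  rewrite (_ : (fun x => _) = EFin \o (fun x => (Kern N x u * f u) * I x)).
    apply: (@integrable_boundedM _ _ R lam I _ (2 ^+ (N * d) * `|f u|)).
    - by apply: measurable_funM => //; under eq_fun do rewrite KernC; exact: measurable_Kern.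
    - by move=> x; rewrite normrM ler_wpM2r// norm_Kern_le.
    - exact: integrable_indic_box.
  by apply/funext => x; rewrite /F/= mulrC.
have intF : (lam \x lam)%E.-integrable setT (EFin \o F).
  apply: (@integrable_prod_dominated _ _ _ _ R lam lam F (fun x => C * I x)) => //.
    move=> x; rewrite mulrC EFinM.
    under eq_integral do rewrite /F/= normrM EFinM.
    rewrite ge0_integralZl_EFin//; last first.
      by apply/measurable_EFinP; apply: measurableT_comp => //; exact: measurable_KernM.
    have /andP[Ix0 Ix1] := I01 x; rewrite (ger0_norm Ix0).
    by rewrite lee_wpmul2l ?lee_fin//; exact: integral_conv_le.
  by apply: integrable_EFinZl; exact: integrable_indic_box.
transitivity (\int[lam]_x \int[lam]_u F (x, u)).
  rewrite /Rintegral integral_indicM; congr fine; apply: eq_integral => x _.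
  rewrite /F/= -/(Rintegral _ _ _) RintegralZl//; first by rewrite mulrC.
  exact: (integrable_conv N x p1 fB).
rewrite (@Fubini_Rintegral _ _ _ _ R lam lam)//.
apply: eq_Rintegral => u _.
pose g j y := kern N (tnth u j - y) * \1_(`]a j, b j]%classic : set R) y.
have ig j : mu.-integrable setT (EFin \o g j).
  apply: (@integrable_kernM _ N (tnth u j) (\1_(`]a j, b j]%classic : set R)) 1).
    exact: measurable_indic.
  by move=> y; rewrite indicE; case: (_ \in _); rewrite ?normr1 ?normr0.
transitivity (\int[lam]_x (prodfun g x * f u)).
  apply: eq_Rintegral => x _.
  rewrite /F/= /I indic_box mulrA KernC mulrC [RHS]mulrC; congr (_ * _).
  by rewrite /Kern /prodfun -big_split/=; apply: eq_bigr => j _; rewrite mulrC.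
rewrite RintegralZr//; last exact: integrable_prodfun.
rewrite Rintegral_prodfun//; congr (_ * _); apply: eq_bigr => j _.
by rewrite /interval_avg /Rintegral [in RHS]integral_indicM.
Qed.

Lemma integrable_Lp_box (p B : R) f a b : 1 <= p -> Lp_le p B f ->
  lam.-integrable (box a b) (EFin \o f).
Proof.
move=> p1 [mf fB]; apply/integrable_indicMP; first exact: measurable_box.
have i1 := integrable_indic_box a b.
have E : (\int[lam]_x `|\1_(box a b) x|%:E =
    (\int[lam]_x `|\1_(box a b) x : R|)%:E :> \bar R)%E.
  by rewrite /Rintegral fineK//; apply: integrable_fin_num => //; exact: integrable_norm i1.
under eq_fun do rewrite mulrC.
apply: (@integrable_Lp_pairing _ _ R lam p 1 (\int[lam]_x `|\1_(box a b) x|) (B `^ p)) => //.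
- exact: measurable_int_EFin i1.
- by move=> x; rewrite indicE; case: (_ \in _); rewrite ?normr1 ?normr0.
- by rewrite -E.
Qed.

Lemma conv_box_cvg (p B : R) f a b : 1 <= p -> 0 < B -> Lp_le p B f ->
  \int[lam]_(x in box a b) conv N f x @[N --> \oo] --> \int[lam]_(x in box a b) f x.
Proof.
move=> p1 B0 fB; have [mf fB'] := fB.
under eq_cvg do rewrite (conv_box _ _ _ p1 B0 fB).
have [M hM] := choice (fun j => interval_avg_dominated (a j) (b j)).
(* Absolute values because the sign of the chosen [M j] is not recorded. The weight is bounded and
   integrable, so [w * f] is integrable by [integrable_Lp_pairing]. *)
pose w := prodfun (fun j y => `|M j| * cauchy_weight y).
have iw : lam.-integrable setT (EFin \o w).
  by apply: integrable_prodfun => j; apply: integrable_EFinZl; exact: integrable_cauchy_weight.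
have w0 x : 0 <= w x by apply: prodfun_ge0 => j y; rewrite mulr_ge0// cauchy_weight_ge0.
have iwf : lam.-integrable setT (EFin \o (fun x => w x * f x)).
  apply: (@integrable_Lp_pairing _ _ R lam p (\prod_(j < d) `|M j|) (\int[lam]_x `|w x|) (B `^ p)) => //.
  - exact: measurable_int_EFin iw.
  - exact: prodr_ge0.
  - move=> x; rewrite ger0_norm// /w /prodfun ler_prod// => j _.
    by rewrite mulr_ge0 ?cauchy_weight_ge0//= ler_piMr ?cauchy_weight_le1.
  - by rewrite /Rintegral fineK//; apply: integrable_fin_num => //; exact: integrable_norm iw.
have ibf := integrable_Lp_box a b p1 fB.
have mB := measurable_box a b.
apply: fine_cvg; rewrite fineK; last exact: integrable_fin_num.
rewrite integral_indicM.
have [] := @dominated_convergence _ _ R lam setT measurableT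
  (fun N u => (prodfun (fun j => interval_avg N (a j) (b j)) u * f u)%:E)
  (fun u => (f u * \1_(box a b) u)%:E) (fun u => `|w u * f u|%:E); last by [].
- move=> N; apply/measurable_EFinP; apply: measurable_funM => //.
  by apply: measurable_prodfun => j; exact: measurable_interval_avg.
- apply/measurable_EFinP; apply: measurable_funM => //; exact: measurable_indic.
- have := ae_neq_coord a; have := ae_neq_coord b.
  apply: (@filterS2 _ (almost_everywhere lam) (ae_filter_ringOfSetsType lam)).
  move=> u ub ua _; apply: cvg_EFin; first exact: nearW.
  rewrite /comp/= mulrC indic_box; apply: cvgM; last exact: cvg_cst.
  by apply: cvg_prodr => j; exact: interval_avg_cvg.
- exact: integrable_norm iwf.
- apply: nearW => u N _; rewrite lee_fin !normrM ler_wpM2r// (ger0_norm (w0 u)).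
  rewrite normr_prodfun; apply: ler_prod => j _; rewrite normr_ge0/=.
  by rewrite (le_trans (hM j N _))// ler_wpM2r ?cauchy_weight_ge0// ler_norm.
Qed.

(** The pointwise limit [h] inherits the bound [E]. It equals [f] almost everywhere because over
    every box the integrals of the convolutions tend both to that of [f], by [conv_box_cvg], and to
    that of [h], by bounded convergence. *)
Lemma conv_cvg_ae (p A : R) n f (E : R) : 1 <= p -> 0 < A -> Lp_le p A f ->
  (forall x, cvgn (fun N => conv N f x)) ->
  (forall x N, (n <= N)%N -> `|conv N f x - conv n f x| <= E) ->
  {ae lam, forall x, `|f x - conv n f x| <= E}.
Proof.
move=> p1 A0 fA cvgf fE; have [mf _] := fA.
pose h x := limn (fun N => conv N f x).
have ch x : conv N f x @[N --> \oo] --> h x by exact: cvgf.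
have mh : measurable_fun setT h.
  apply: (measurable_fun_cvg (h := fun N x => conv N f x)).
    by move=> N; exact: measurable_conv.
  by move=> x _; exact: ch.
have hE x : `|h x - conv n f x| <= E.
  have c : `|conv N f x - conv n f x| @[N --> \oo] --> `|h x - conv n f x|.
    by apply: cvg_norm; apply: cvgB; [exact: ch|exact: cvg_cst].
  rewrite -(cvg_lim _ c)//; apply: limr_le; first by apply/cvg_ex; eexists; exact: c.
  by near=> N; apply: fE; near: N; exact: nbhs_infty_ge.
pose C := (3 ^+ d + 1) * (2 `^ ((n * d)%:R / p) * A) + E.
(* The origin is only a point at which to read that a norm is at most [E]. *)
have E0 : 0 <= E by rewrite (le_trans _ (fE (nseq_tuple d 0) n (leqnn n))).
have nC x N : (n <= N)%N -> `|conv N f x| <= C.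
  move=> nN; rewrite -(subrK (conv n f x) (conv N f x)) addrC.
  rewrite (le_trans (ler_normD _ _))// lerD//; first exact: norm_conv_le.
  exact: fE.
have hC x : `|h x| <= C.
  rewrite -(subrK (conv n f x) (h x)) addrC.
  by rewrite (le_trans (ler_normD _ _))// lerD//; exact: norm_conv_le.
have ihb a b : lam.-integrable (box a b) (EFin \o h).
  apply/integrable_indicMP; first exact: measurable_box.
  by apply: (@integrable_boundedM _ _ R lam _ h C) => //; exact: integrable_indic_box.
have ifb a b := integrable_Lp_box a b p1 fA.
have hf : {ae lam, forall x, h x - f x = 0}.
  apply: ae_eq0_box.
  - exact: measurable_funB.
  - move=> a b; have mB := measurable_box a b.
    exact: (integrableB mB (ihb a b) (ifb a b)).
  - move=> a b; have mB := measurable_box a b.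
    rewrite RintegralB//.
    have c1 := @conv_box_cvg p A f a b p1 A0 fA.
    suff c2 : \int[lam]_(x in box a b) conv N f x @[N --> \oo] -->
        \int[lam]_(x in box a b) h x.
      by rewrite (cvg_unique _ c1 c2) ?subrr.
    apply: fine_cvg; rewrite fineK; last exact: integrable_fin_num.
    (* The uniform bound [C] holds from level [n] on. *)
    rewrite -(cvg_shiftn n).
    have [] := @dominated_convergence _ _ R lam (box a b) mB
      (fun N u => (conv (N + n) f u)%:E) (fun u => (h u)%:E) (fun u => (C * 1)%:E); last by [].
    + move=> N; apply/measurable_EFinP; apply: measurable_funTS; exact: measurable_conv.
    + by apply/measurable_EFinP; exact: measurable_funTS.
    + apply: nearW => u _; apply: cvg_EFin; first exact: nearW.
      by have := ch u; rewrite -(cvg_shiftn n).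
    + apply/integrable_indicMP => //; under eq_fun do rewrite mulr1.
      by apply: integrable_EFinZl; exact: integrable_indic_box.
    + by apply: nearW => u N _; rewrite lee_fin mulr1 nC// leq_addl.
apply: (@filterS _ (almost_everywhere lam) (ae_filter_ringOfSetsType lam)) hf => x /eqP.
by rewrite subr_eq0 => /eqP <-; exact: hE.
Unshelve. all: by end_near. Qed.

End vp_convergence.

(** * Geometric decay of the blocks and the tail of their series *)

Section upper_bound.
Context {R : realType} {d : nat}.
Notation lam := (lebesgue_Rd R d).
Implicit Types (x u : Rd R d) (f : Rd R d -> R) (p : R).

Lemma powR2_exprn p k : 2 `^ ((k * d)%:R / p) = (2 `^ (d%:R / p)) ^+ k :> R.
Proof. by rewrite natrM -mulrA mulrC powRrM powR_mulrn ?powR_ge0. Qed.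

Lemma sum_geometric_le (rho : R) n N : 0 <= rho -> rho < 1 ->
  \sum_(n <= s < N) rho ^+ (s - n) <= (1 - rho)^-1.
Proof.
move=> r0 r1; have r1' : 0 < 1 - rho by rewrite subr_gt0.
have [Nn|nN] := leqP N n.
  by rewrite big_geq// invr_ge0 ltW.
rewrite -{1}(add0n n) big_addn; under eq_bigr do rewrite addnK.
have -> : \sum_(0 <= i < N - n) rho ^+ i = series (geometric 1 rho) (N - n)%N.
  by rewrite /series/=; apply: eq_bigr => i _; rewrite mul1r.
rewrite (geometric_seriesE 1 (negbT (lt_eqF r1)))/=.
rewrite mul1r ler_pdivrMr// mulVf ?gt_eqF// gerBl.
exact: exprn_ge0.
Qed.

(** [gam] stands for 2^alpha. Nikol'skii's inequality costs 2^(d/p) per level and (S^alpha) gains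
    [gam], so the blocks decay with ratio [rho] < 1. *)
Lemma vp_error_ae p (A C2 gam : R) (Om : R^nat) n f :
  1 <= p -> 0 < A -> Lp_le p A f -> (forall s, 0 < Om s) ->
  (forall s, Lp_le p (Om s) (block s f)) -> 0 <= C2 ->
  2 `^ (d%:R / p) < gam ->
  (forall m s, (m <= s)%N -> Om s <= C2 * Om m * (gam ^+ m / gam ^+ s)) ->
  {ae lam, forall x, `|f x - conv n f x| <=
    (3 ^+ d + 1) * 2 `^ (d%:R / p) * C2 / (1 - 2 `^ (d%:R / p) / gam) *
      (Om n.+1 * 2 `^ ((n.+1 * d)%:R / p))}.
Proof.
move=> p1 A0 fA Om0 fOm C20 bg OmS; set b := 2 `^ (d%:R / p).
have b0 : 0 < b by rewrite powR_gt0.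
have g0 : 0 < gam by exact: lt_trans bg.
pose rho := b / gam.
have rho0 : 0 <= rho by rewrite divr_ge0 ?ltW.
have rho1 : rho < 1 by rewrite ltr_pdivrMr// mul1r.
(* The isolated factor [b] is the price of reproducing block [s] at level s + 1. *)
pose K m := (3 ^+ d + 1) * b * C2 * (Om m * b ^+ m).
have K0 m : 0 <= K m.
  by rewrite /K !mulr_ge0 ?addr_ge0 ?exprn_ge0 ?(ltW b0) ?(ltW (Om0 _)).
have bl m s x : (m <= s)%N -> `|block s f x| <= K m * rho ^+ (s - m).
  move=> ms; apply: le_trans (norm_block_le x p1 A0 (Om0 s) fA (fOm s)) _.
  rewrite powR2_exprn -/b.
  apply: (@le_trans _ _ ((3 ^+ d + 1) * (b ^+ s.+1 * (C2 * Om m * (gam ^+ m / gam ^+ s))))).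
    rewrite ler_wpM2l ?addr_ge0 ?exprn_ge0// ler_wpM2l ?exprn_ge0 ?(ltW b0)//.
    exact: OmS.
  rewrite /K /rho expr_div_n exprS -{1}(subnK ms) -{2}(subnK ms) !exprD.
  rewrite le_eqVlt; apply/orP; left; apply/eqP.
  by field; rewrite !expf_neq0 ?gt_eqF.
have fE x N : (n <= N)%N -> `|conv N f x - conv n f x| <= K n.+1 / (1 - rho).
  move=> nN; rewrite sum_block_sub// (le_trans (ler_norm_sum _ _ _))//.
  apply: (@le_trans _ _ (\sum_(n.+1 <= s < N.+1) K n.+1 * rho ^+ (s - n.+1))).
    by rewrite big_nat_cond [leRHS]big_nat_cond; apply: ler_sum => s /andP[/andP[ns _] _]; exact: bl.
  by rewrite -mulr_sumr ler_wpM2l// sum_geometric_le.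
have cf x : cvgn (fun N => conv N f x).
  have cb : cvgn (series (fun s => block s f x)).
    apply: normed_cvg.
    apply: (@series_le_cvg _ _ (geometric (K 0%N) rho)).
    - by move=> s; rewrite /= normr_ge0.
    - by move=> s; rewrite mulr_ge0 ?exprn_ge0.
    - by move=> s; rewrite /geometric/=; have := bl 0%N s x (leq0n s); rewrite subn0.
    - by apply: is_cvg_geometric_series; rewrite ger0_norm.
  rewrite (_ : (fun N => conv N f x) = (fun N => series (fun s => block s f x) N.+1)).
    by apply/cvg_ex; case/cvg_ex : cb => l cl; exists l; rewrite (cvg_shiftS (series _)).
  by apply/funext => N; rewrite /series/= sum_block.
have := conv_cvg_ae p1 A0 fA cf fE.
apply: (@filterS _ (almost_everywhere lam) (ae_filter_ringOfSetsType lam)) => x.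
by rewrite powR2_exprn -/b -/rho => /le_trans; apply; rewrite /K mulrAC.
Qed.

End upper_bound.

(** * Complex-valued functions *)

Section complex_bridge.
Context {R : realType} {d : nat}.
Notation lam := (lebesgue_Rd R d).
Implicit Types (x u : Rd R d) (f : Rd R d -> R[i]) (g : Rd R d -> R) (p : R).

Lemma measurable_VP_kernel s x :
  measurable_fun setT (fun u : Rd R d => VP_kernel s (subRd x u)).
Proof.
apply: measurable_funM => //; apply: measurable_prod => j _.
have mq : measurable_fun setT
    (fun y : R => (cos (2 ^+ s * y) - cos (2 ^+ s.+1 * y)) / y ^+ 2).
  apply: measurable_funM; last exact: measurable_sqrV.
  by apply: measurable_funB; exact: measurable_cos_scale.
rewrite (_ : (fun u => _) = (fun y : R => (cos (2 ^+ s * y) - cos (2 ^+ s.+1 * y)) / y ^+ 2) \o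
    (fun u : Rd R d => tnth x j - tnth u j)); last first.
  by apply/funext => u; rewrite /= tnth_mktuple.
apply: measurableT_comp mq _; apply: measurable_funB => //.
exact: measurable_tnth.
Qed.

Lemma VP_kernelE s x u : (forall j, tnth u j != tnth x j) ->
  VP_kernel s (subRd x u) = pi ^+ d * Kern s x u.
Proof.
move=> ux; rewrite /VP_kernel /Kern /prodfun exprM.
rewrite -[X in _ ^+ X](card_ord d) -prodr_const -prodfV -big_split/=.
rewrite -[X in pi ^+ X](card_ord d) -prodr_const -big_split/=.
apply: eq_bigr => j _; rewrite tnth_mktuple /kern /hker.
have -> : (tnth x j - tnth u j == 0) = false.
  by apply/negbTE; rewrite subr_eq0 eq_sym.
have E (q N A B Y : R) : q != 0 -> N != 0 ->
    N^-1 * ((A - B) * Y) = q * ((q * N)^-1 * ((1 - B) * Y - (1 - A) * Y)).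
  by move=> q0 N0; field; rewrite ?q0 ?N0.
by apply: E; rewrite gt_eqF ?pi_gt0 ?exprn_gt0.
Qed.

(** The two kernels differ only where some coordinates of [x] and [u] agree, a null set. *)
Lemma Rintegral_VP_kernel s x g : measurable_fun setT g ->
  lam.-integrable setT (EFin \o (fun u => Kern s x u * g u)) ->
  (pi ^+ d)^-1 * \int[lam]_u (VP_kernel s (subRd x u) * g u) = conv s g x.
Proof.
move=> mg iK.
have -> : \int[lam]_u (VP_kernel s (subRd x u) * g u) =
    \int[lam]_u (pi ^+ d * (Kern s x u * g u)).
  congr fine; apply: ae_eq_integral => //.
  - by apply/measurable_EFinP; apply: measurable_funM => //; exact: measurable_VP_kernel.
  - by apply/measurable_EFinP; apply: measurable_funM => //; exact: measurable_KernM.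
  have := ae_neq_coord (fun j => tnth x j).
  apply: (@filterS _ (almost_everywhere lam) (ae_filter_ringOfSetsType lam)) => u ux _.
  by rewrite VP_kernelE// mulrA.
by rewrite RintegralZl// mulKf// expf_neq0 ?gt_eqF ?pi_gt0.
Qed.

Definition reC f : Rd R d -> R := fun x => complex.Re (f x).
Definition imC f : Rd R d -> R := fun x => complex.Im (f x).

Lemma VP_sumE s f x : measurable_fun setT (reC f) -> measurable_fun setT (imC f) ->
  lam.-integrable setT (EFin \o (fun u => Kern s x u * reC f u)) ->
  lam.-integrable setT (EFin \o (fun u => Kern s x u * imC f u)) ->
  VP_sum s f x = Complex (conv s (reC f) x) (conv s (imC f) x).
Proof.
move=> mr mi ir ii; rewrite /VP_sum /Cintegral.
rewrite -(Rintegral_VP_kernel mr ir) -(Rintegral_VP_kernel mi ii).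
have rE (k : R) z : complex.Re (k%:C%C * z) = k * complex.Re z.
  by case: z => a b /=; rewrite mul0r subr0.
have iE (k : R) z : complex.Im (k%:C%C * z) = k * complex.Im z.
  by case: z => a b /=; rewrite mul0r addr0.
rewrite (_ : \int[lam]_u complex.Re _ =
    \int[lam]_u (VP_kernel s (subRd x u) * reC f u)); last first.
  by apply: eq_Rintegral => u _; rewrite rE.
rewrite (_ : \int[lam]_u complex.Im _ =
    \int[lam]_u (VP_kernel s (subRd x u) * imC f u)); last first.
  by apply: eq_Rintegral => u _; rewrite iE.
by apply/eqP; rewrite eq_complex rE iE/= !eqxx.
Qed.

Lemma normr_Re_le (z : R[i]) : `|complex.Re z| <= Normc.normc z.
Proof.
case: z => a b /=; rewrite -sqrtr_sqr ler_wsqrtr// lerDl sqr_ge0//.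
Qed.

Lemma normr_Im_le (z : R[i]) : `|complex.Im z| <= Normc.normc z.
Proof.
case: z => a b /=; rewrite -sqrtr_sqr ler_wsqrtr// lerDr sqr_ge0//.
Qed.

Lemma normc_le (z : R[i]) : Normc.normc z <= `|complex.Re z| + `|complex.Im z|.
Proof.
case: z => a b /=; rewrite -[leRHS]ger0_norm ?addr_ge0// -sqrtr_sqr ler_wsqrtr//.
have := mulr_ge0 (normr_ge0 a) (normr_ge0 b).
by rewrite sqrrD !real_normK ?num_real// -mulr_natr; lra.
Qed.

Lemma normc_ge0 (z : R[i]) : 0 <= Normc.normc z.
Proof. by case: z => a b /=; rewrite sqrtr_ge0. Qed.

Lemma CLnorm_powR_le p (B : R) f : 1 <= p -> 0 <= B ->
  (CLnorm lam p%:E f <= B%:E)%E ->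
  (\int[lam]_x (Normc.normc (f x) `^ p)%:E <= (B `^ p)%:E)%E.
Proof.
move=> p1 B0 fB; have p0 : 0 < p by exact: lt_le_trans p1.
rewrite (_ : (\int[lam]_x _)%E = (CLnorm lam p%:E f `^ p)%E); last first.
  rewrite /CLnorm poweR_Lnorm; last by rewrite gt_eqF.
  apply: eq_integral => x _; rewrite -poweR_EFin; congr (_ `^ _)%E.
  by rewrite -[RHS]/(`|Normc.normc (f x)|%:E) ger0_norm ?normc_ge0.
rewrite -poweR_EFin; apply: gt0_ler_poweR => //; first exact: ltW.
- by rewrite in_itv/= Lnorm_ge0 leey.
- by rewrite in_itv/= lee_fin B0 leey.
Qed.

Lemma Lp_le_dominated p (B : R) f g : 1 <= p -> 0 <= B ->
  (CLnorm lam p%:E f <= B%:E)%E -> measurable_fun setT g ->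
  (forall x, `|g x| <= Normc.normc (f x)) ->
  measurable_fun setT (fun x => Normc.normc (f x)) -> Lp_le p B g.
Proof.
move=> p1 B0 fB mg gf mf; split => //.
apply: le_trans (CLnorm_powR_le p1 B0 fB).
apply: ge0_le_integral => //.
- by apply/measurable_EFinP; exact: measurable_norm_powR.
- apply/measurable_EFinP; apply: (@measurableT_comp _ _ _ _ _ _ (fun y : R => y `^ p)) => //.
- move=> x _; rewrite lee_fin ge0_ler_powR ?nnegrE ?normc_ge0//.
  by rewrite (le_trans ler01).
Qed.

Lemma measurable_normc f : measurable_fun setT (reC f) -> measurable_fun setT (imC f) ->
  measurable_fun setT (fun x => Normc.normc (f x)).
Proof.
move=> mr mi; rewrite (_ : (fun x => _) = fun x => Num.sqrt (reC f x ^+ 2 + imC f x ^+ 2)).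
  apply: (@measurableT_comp _ _ _ _ _ _ (@Num.sqrt R)).
    by apply: continuous_measurable_fun; exact: sqrt_continuous.
  by apply: measurable_funD; exact: measurable_funX.
by apply/funext => x; rewrite /reC /imC; case: (f x).
Qed.

Lemma Lp_le_ReIm p (B : R) f : 1 <= p -> 0 <= B ->
  measurable_fun setT (reC f) -> measurable_fun setT (imC f) ->
  (CLnorm lam p%:E f <= B%:E)%E -> Lp_le p B (reC f) /\ Lp_le p B (imC f).
Proof.
move=> p1 B0 mr mi fB; split; apply: (Lp_le_dominated p1 B0 fB) => //;
  do ?[exact: measurable_normc].
- by move=> x; exact: normr_Re_le.
- by move=> x; exact: normr_Im_le.
Qed.

Lemma CLnorm_infty_le f (E : R) :
  0 <= E -> {ae lam, forall x, Normc.normc (f x) <= E} -> (CLnorm lam +oo f <= E%:E)%E.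
Proof.
move=> E0 fE; rewrite /CLnorm unlock /=; case: ifP => _; last by rewrite lee_fin.
(* The other case of the definition, a space of measure 0 with norm 0, has just been closed. *)
apply/ess_supP; move: fE.
apply: (@filterS _ (almost_everywhere lam) (ae_filter_ringOfSetsType lam)) => x fx.
by rewrite /= lee_fin ger0_norm ?normc_ge0.
Qed.

End complex_bridge.

(** * The extremal functions *)

Section bump.
Context {R : realType}.
Notation mu := (@lebesgue_measure R).
Implicit Types (n s : nat) (a u x y t : R).

(* Up to a factor, the Fourier transform of [bump n] is the sum of the two
   triangles of width [2 ^ n] centred at [+- 3/2 * 2 ^ n]. *)
Definition bump n y : R :=
  (2 ^+ n) ^- 2 * ((hker (2 ^+ n.+1) y - hker (3 / 2 * 2 ^+ n) y) -
                   (hker (3 / 2 * 2 ^+ n) y - hker (2 ^+ n) y)).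

Let N_gt0 n : 0 < (2 ^+ n : R).
Proof. by rewrite exprn_gt0. Qed.

Let N_ge0 n : 0 <= (2 ^+ n : R).
Proof. by rewrite exprn_ge0. Qed.

Lemma measurable_bump n : measurable_fun setT (bump n).
Proof.
apply: measurable_funM => //.
by do 2 (apply: measurable_funB); exact: measurable_hker.
Qed.

Lemma norm_bump_hker n y : `|bump n y| <= (2 ^+ n) ^- 2 *
  ((hker (2 ^+ n.+1) y + hker (3 / 2 * 2 ^+ n) y) +
   (hker (3 / 2 * 2 ^+ n) y + hker (2 ^+ n) y)).
Proof.
rewrite normrM gtr0_norm ?invr_gt0 ?exprn_gt0// ler_wpM2l ?invr_ge0 ?exprn_ge0//.
have := hker_ge0 (2 ^+ n.+1) y; have := hker_ge0 (2 ^+ n) y.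
have := hker_ge0 (3 / 2 * 2 ^+ n) y.
by move=> h1 h2 h3; rewrite ler_norml; apply/andP; split; lra.
Qed.

(** [hker_le] gives 19/4; the value 25 is chosen to serve also for the L_1 norm, which is at most 6
    pi / 2^n. *)
Lemma norm_bump_le n y : `|bump n y| <= 25.
Proof.
rewrite (le_trans (norm_bump_hker n y))// ler_pdivrMl ?exprn_gt0//.
have := hker_le (2 ^+ n.+1) y; have := hker_le (2 ^+ n) y.
have := hker_le (3 / 2 * 2 ^+ n) y; rewrite (exprS (2 : R) n).
by have := sqr_ge0 (2 ^+ n : R); move: (2 ^+ n : R) => N; rewrite !expr2; lra.
Qed.

Lemma integral_norm_bump n : (\int[mu]_y `|bump n y|%:E <= (25 / 2 ^+ n)%:E)%E.
Proof.
pose F y := (2 ^+ n) ^- 2 *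
  ((hker (2 ^+ n.+1) y + hker (3 / 2 * 2 ^+ n) y) +
   (hker (3 / 2 * 2 ^+ n) y + hker (2 ^+ n) y)).
have i1 : mu.-integrable setT (EFin \o (fun y => hker (2 ^+ n.+1) y + hker (3 / 2 * 2 ^+ n) y)).
  by apply: integrable_EFinD; exact: integrable_hker.
have i2 : mu.-integrable setT (EFin \o (fun y => hker (3 / 2 * 2 ^+ n) y + hker (2 ^+ n) y)).
  by apply: integrable_EFinD; exact: integrable_hker.
have iF : mu.-integrable setT (EFin \o F).
  by apply: integrable_EFinZl; exact: integrable_EFinD.
apply: (@le_trans _ _ (\int[mu]_y (F y)%:E)%E).
  apply: ge0_le_integral => //.
  - by apply/measurable_EFinP; apply: measurableT_comp => //; exact: measurable_bump.
  - exact: measurable_int iF.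
  - by move=> y _; rewrite lee_fin norm_bump_hker.
rewrite -[leLHS]fineK; last by apply: integrable_fin_num => //; exact: iF.
rewrite lee_fin -/(Rintegral _ _ _) RintegralZl//; last exact: integrable_EFinD.
rewrite RintegralD// !RintegralD//; do ?exact: integrable_hker.
rewrite !Rintegral_hker// ler_pdivlMr// (exprS (2 : R) n).
have E (N q : R) : N != 0 ->
    N ^- 2 * (q * (2 * N) + q * (3 / 2 * N) + (q * (3 / 2 * N) + q * N)) * N = 6 * q.
  by move=> N0; field; rewrite N0.
rewrite E ?gt_eqF//.
have := pihalf_lt2 R; lra.
Qed.

(** [hker_conv] is used with the roles exchanged: the kernel of level [s] is made of [hker a] with a
    <= 2^n, and the bump is a difference of two differences with the same gap 2^n / 2, whose
    contributions cancel. *)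
Lemma bump_conv_low s n x : (s < n)%N ->
  \int[mu]_u (kern s (x - u) * bump n u) = 0.
Proof.
move=> sn.
have sn1 : (2 ^+ s.+1 : R) <= 2 ^+ n by rewrite ler_weXn2l ?ler1n.
have s1 : (2 ^+ s : R) <= 2 ^+ s.+1 by rewrite ler_weXn2l ?ler1n.
have n1 : (2 ^+ n : R) <= 3 / 2 * 2 ^+ n by have := N_ge0 n; lra.
have n2 : (2 ^+ n : R) <= 2 ^+ n.+1 by rewrite ler_weXn2l ?ler1n.
pose D b c u := hker c (x - u) - hker b (x - u).
have iD a b c : 0 <= b -> 0 <= c ->
    mu.-integrable setT (EFin \o (fun u => hker a u * D b c u)).
  move=> b0 c0; apply: (@integrable_boundedM _ _ R mu (D b c) (hker a) (a ^+ 2 / 2)).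
  - exact: measurable_hker.
  - by move=> u; rewrite ger0_norm ?hker_ge0// hker_le.
  - exact: (integrable_refl_shift x (integrable_hkerB b0 c0)).
have H a : 0 <= a -> a <= 2 ^+ n ->
    \int[mu]_u (hker a u * bump n (x - u)) = 0 /\
    mu.-integrable setT (EFin \o (fun u => hker a u * bump n (x - u))).
  move=> a0 an.
  have -> : (fun u => hker a u * bump n (x - u)) = (fun u => (2 ^+ n) ^- 2 *
     (hker a u * D (3 / 2 * 2 ^+ n) (2 ^+ n.+1) u - hker a u * D (2 ^+ n) (3 / 2 * 2 ^+ n) u)).
    by apply/funext => u; rewrite /bump /D; ring.
  split; last by apply: integrable_EFinZl; apply: integrable_EFinB; exact: iD.
  rewrite RintegralZl//; last by apply: integrable_EFinB; exact: iD.
  rewrite RintegralB//; [|exact: iD|exact: iD].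
  rewrite !hker_conv ?(le_trans an)//.
  have -> : 2 ^+ n.+1 - 3 / 2 * 2 ^+ n = 3 / 2 * 2 ^+ n - 2 ^+ n :> R.
    by rewrite (exprS (2 : R) n); lra.
  by rewrite subrr mulr0.
have [e1 i1] := H _ (N_ge0 s.+1) sn1.
have [e2 i2] := H _ (N_ge0 s) (le_trans s1 sn1).
pose F u := (pi * 2 ^+ s)^-1 * (hker (2 ^+ s.+1) u * bump n (x - u) - hker (2 ^+ s) u * bump n (x - u)).
have iF : mu.-integrable setT (EFin \o F).
  by apply: integrable_EFinZl; exact: integrable_EFinB.
transitivity (\int[mu]_u F u).
  rewrite -(Rintegral_refl_shift x iF); apply: eq_Rintegral => u _.
  by rewrite /F subKr /kern; ring.
rewrite RintegralZl//; last exact: integrable_EFinB.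
by rewrite RintegralB// e1 e2 subrr mulr0.
Qed.

Lemma bump_conv_high s n x : (n < s)%N ->
  \int[mu]_u (kern s (x - u) * bump n u) = bump n x.
Proof.
move=> ns.
have ns1 : (2 ^+ n.+1 : R) <= 2 ^+ s by rewrite ler_weXn2l ?ler1n.
have n2 : (3 / 2 * 2 ^+ n : R) <= 2 ^+ n.+1 by rewrite exprS; have := N_ge0 n; lra.
have n1 : (2 ^+ n : R) <= 2 ^+ n.+1 by rewrite ler_weXn2l ?ler1n.
have ih a : mu.-integrable setT (EFin \o (fun u => kern s (x - u) * hker a u)).
  apply: (@integrable_kernM _ s x (hker a) (a ^+ 2 / 2)); first exact: measurable_hker.
  by move=> u; rewrite ger0_norm ?hker_ge0// hker_le.
pose G a b u := kern s (x - u) * hker a u - kern s (x - u) * hker b u.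
have iG a b : mu.-integrable setT (EFin \o G a b) by exact: integrable_EFinB.
transitivity (\int[mu]_u ((2 ^+ n) ^- 2 *
    (G (2 ^+ n.+1) (3 / 2 * 2 ^+ n) u - G (3 / 2 * 2 ^+ n) (2 ^+ n) u))).
  by apply: eq_Rintegral => u _; rewrite /bump /G; ring.
rewrite RintegralZl//; last exact: integrable_EFinB.
rewrite RintegralB// !RintegralB//.
by rewrite !kern_conv_hker// ?(le_trans n1)// ?(le_trans n2).
Qed.

(** Level [n] neither kills nor reproduces the bump, so its convolution is only estimated: 75 = 3 *
    25, in L_oo and in L_1. *)
Definition bump_avg n y : R := \int[mu]_u (kern n (y - u) * bump n u).

Lemma measurable_kern2 s : measurable_fun setT
  (fun z : measurableTypeR R * measurableTypeR R => kern s (z.1 - z.2)).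
Proof.
apply: (@measurableT_comp _ _ _ _ _ _ (kern s)); first exact: measurable_kern.
exact: measurable_funB.
Qed.

Lemma measurable_bump_avg n : measurable_fun setT (bump_avg n).
Proof.
apply: (@measurable_Rintegral2 _ _ _ _ R mu
  (fun z : measurableTypeR R * measurableTypeR R => kern n (z.1 - z.2) * bump n z.2)).
apply: measurable_funM; first exact: measurable_kern2.
by apply: (@measurableT_comp _ _ _ _ _ _ (bump n)) => //; exact: measurable_bump.
Qed.

Lemma integrable_kern_bump n s x :
  mu.-integrable setT (EFin \o (fun u => kern s (x - u) * bump n u)).
Proof.
apply: (@integrable_kernM _ s x (bump n) 25); first exact: measurable_bump.
exact: norm_bump_le.
Qed.

Lemma norm_bump_avg_le n y : `|bump_avg n y| <= 75.
Proof.
apply: norm_Rintegral_le; first exact: integrable_kern_bump.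
have mk : measurable_fun setT (fun u => `|kern n (y - u)|).
  by apply: measurableT_comp => //; exact: measurable_kern_shift.
apply: (@le_trans _ _ (\int[mu]_u (25%:E * `|kern n (y - u)|%:E))%E).
  apply: ge0_le_integral => //.
  - apply/measurable_EFinP; apply: measurableT_comp => //; apply: measurable_funM.
      exact: measurable_kern_shift.
    exact: measurable_bump.
  - by apply: measurable_funeM; exact/measurable_EFinP.
  - by move=> u _; rewrite -EFinM lee_fin normrM mulrC ler_wpM2r// norm_bump_le.
rewrite ge0_integralZl_EFin//; last exact/measurable_EFinP.
rewrite (_ : 75 = 25 * 3); last lra.
by rewrite EFinM lee_wpmul2l ?lee_fin// integral_norm_kern_shift.
Qed.

Lemma integral_norm_bump_avg n :
  (\int[mu]_y `|bump_avg n y|%:E <= (75 / 2 ^+ n)%:E)%E.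
Proof.
have mF : measurable_fun setT
    (fun z : measurableTypeR R * measurableTypeR R => `|kern n (z.1 - z.2) * bump n z.2|%:E).
  apply/measurable_EFinP; apply: measurableT_comp => //.
  apply: measurable_funM; first exact: measurable_kern2.
  by apply: (@measurableT_comp _ _ _ _ _ _ (bump n)) => //; exact: measurable_bump.
have mab : measurable_fun setT (fun u => `|bump n u|).
  by apply: measurableT_comp => //; exact: measurable_bump.
apply: (@le_trans _ _ (\int[mu]_y \int[mu]_u `|kern n (y - u) * bump n u|%:E)%E).
  apply: ge0_le_integral => //.
  - by apply/measurable_EFinP; apply: measurableT_comp => //; exact: measurable_bump_avg.
  - exact: (@measurable_fun_fubini_tonelli_F _ _ _ _ R mu _ mF).
  - move=> y _; rewrite -[leRHS]fineK; last first.
      by apply: integrable_fin_num => //; exact: integrable_norm (integrable_kern_bump n n y).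
    by rewrite lee_fin; apply: le_normr_Rintegral => //; exact: integrable_kern_bump.
rewrite (@fubini_tonelli _ _ _ _ R mu mu _ mF)//=.
apply: (@le_trans _ _ (\int[mu]_u (3%:E * `|bump n u|%:E))%E).
  apply: ge0_le_integral => //.
  - by move=> u _; exact: integral_ge0.
  - exact: (@measurable_fun_fubini_tonelli_G _ _ _ _ R mu _ mF).
  - by apply: measurable_funeM; exact/measurable_EFinP.
  - move=> u _; under eq_integral do rewrite normrM mulrC EFinM kernC.
    rewrite ge0_integralZl_EFin//; last first.
      by apply/measurable_EFinP; apply: measurableT_comp => //; exact: measurable_kern_shift.
    by rewrite muleC lee_wpmul2r ?lee_fin// integral_norm_kern_shift.
rewrite ge0_integralZl_EFin//; last exact/measurable_EFinP.
rewrite (_ : 75 = 3 * 25); last lra.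
by rewrite -mulrA EFinM lee_wpmul2l ?lee_fin// integral_norm_bump.
Qed.

(** [bump n y] depends only on t = 2^n y and equals 2 cos (3t/2) (1 - cos (t/2)) / t^2. On 1/4 <= t
    <= 1/2 the factors are at least cos 1, 1 - cos (1/8) and 4, uniformly in [n]. *)
Lemma bump_pos : exists2 c : R, 0 < c &
  forall n y, `](4 * 2 ^+ n)^-1, (2 * 2 ^+ n)^-1]%classic y -> c <= bump n y.
Proof.
have cos_mono (x y : R) : 0 <= x -> x <= y -> y <= 1 -> cos y <= cos x.
  move=> x0 xy y1; have p2 := pi_ge2 R.
  have [->//|xny] := eqVneq x y.
  apply/ltW; rewrite ltr_cos ?in_itv/=; [|lra|lra].
  by rewrite lt_neqAle xny.
have c8 : cos 8^-1 < (1 : R).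
  have p2 := pi_ge2 R; rewrite -[ltRHS]cos0 ltr_cos ?in_itv/=; [|lra|lra].
  by rewrite invr_gt0.
exists (8 * (cos 1 * (1 - cos 8^-1))).
  by rewrite !mulr_gt0 ?cos1_gt0 ?subr_gt0.
move=> n y /=; rewrite in_itv/= => /andP[y1 y2].
have y0 : 0 < y by rewrite (le_lt_trans _ y1)// invr_ge0 mulr_ge0.
set N := (2 ^+ n : R); have N0 : 0 < N by exact: N_gt0.
set t := N * y.
have t1 : 4^-1 <= t.
  by rewrite ltW// /t -ltr_pdivrMl// -invfM mulrC.
have t2 : t <= 2^-1.
  by rewrite /t -ler_pdivlMl// -invfM mulrC.
have ty : t != 0 by rewrite gt_eqF// mulr_gt0.
have -> : bump n y = 2 * cos (3 / 2 * t) * (1 - cos (2^-1 * t)) * t ^- 2.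
  rewrite /bump /hker (gt_eqF y0) -/N.
  have -> : 2 ^+ n.+1 * y = 3 / 2 * t + 2^-1 * t by rewrite exprS -/N /t; lra.
  have -> : N * y = 3 / 2 * t - 2^-1 * t by rewrite -/t; lra.
  have -> : 3 / 2 * N * y = 3 / 2 * t by rewrite /t mulrA.
  rewrite cosD cosB -!mulrBl.
  have -> : t ^- 2 = N ^- 2 * y ^- 2 by rewrite /t exprMn invfM.
  ring.
have ct : cos 1 <= cos (3 / 2 * t) by apply: cos_mono; lra.
have c2 : cos (2^-1 * t) <= cos 8^-1 by apply: cos_mono; lra.
have c1 := @cos1_gt0 R.
have t4 : 4 <= t ^- 2.
  rewrite -[leLHS]invrK lef_pV2 ?posrE ?invr_gt0 ?exprn_even_gt0//.
  have -> : (4^-1 : R) = 2^-1 ^+ 2 by rewrite exprVn; congr (_^-1); ring.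
  by rewrite lerXn2r ?nnegrE//; lra.
have s1 : cos 1 * (1 - cos 8^-1) <= cos (3 / 2 * t) * (1 - cos (2^-1 * t)).
  by rewrite ler_pM ?(ltW c1)// ?subr_ge0 ?(ltW c8)// lerD2l lerN2.
have s0 : 0 <= cos 1 * (1 - cos 8^-1) :> R by rewrite mulr_ge0 ?(ltW c1)// subr_ge0 ltW.
rewrite -mulrA.
have : cos 1 * (1 - cos 8^-1) * 4 <= cos (3 / 2 * t) * (1 - cos (2^-1 * t)) * t ^- 2.
  by rewrite ler_pM.
move: (cos (3 / 2 * t)) (cos (2^-1 * t)) (t ^- 2) => A B C; lra.
Qed.

End bump.

(** * Tensor products of bumps and their blocks *)

Section extremal_function.
Context {R : realType} {d : nat}.
Notation lam := (lebesgue_Rd R d).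
Notation mu := (@lebesgue_measure R).
Implicit Types (x u : Rd R d) (n s : nat) (g : Rd R d -> R) (p : R).

Definition ext (lambda : R) n x : R := lambda * prodfun (fun=> bump n) x.

Lemma measurable_ext lambda n : measurable_fun setT (ext lambda n).
Proof.
by apply: measurable_funM => //; apply: measurable_prodfun => _; exact: measurable_bump.
Qed.

Lemma norm_prodfun_le (v : R -> R) (M : R) x : (forall y, `|v y| <= M) ->
  `|prodfun (fun=> v) x| <= M ^+ d.
Proof.
move=> vM; rewrite normr_prodfun -[X in _ ^+ X](card_ord d) -prodr_const.
by apply: ler_prod => j _; rewrite normr_ge0/=.
Qed.

Lemma integral_norm_prodfun_le (v : R -> R) (M : R) : measurable_fun setT v ->
  (\int[mu]_y `|v y|%:E <= M%:E)%E ->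
  (\int[lam]_x `|prodfun (fun=> v) x|%:E <= (M ^+ d)%:E)%E.
Proof.
move=> mv vM; under eq_integral do rewrite normr_prodfun.
rewrite ge0_integral_prodfun//; last by move=> _; exact: measurableT_comp.
have fn : (\int[mu]_y `|v y|%:E)%E \is a fin_num.
  by rewrite ge0_fin_numE ?integral_ge0// (le_lt_trans vM) ?ltry.
rewrite -(fineK fn) prodEFin lee_fin -[X in M ^+ X](card_ord d) -prodr_const.
apply: ler_prod => j _; rewrite fine_ge0 ?integral_ge0//=.
by rewrite -lee_fin fineK.
Qed.

Lemma conv_ext lambda n s x : conv s (ext lambda n) x =
  lambda * \prod_(j < d) \int[mu]_u (kern s (tnth x j - u) * bump n u).
Proof.
rewrite -Rintegral_prodfun; last by move=> j; exact: integrable_kern_bump.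
rewrite -RintegralZl//; last first.
  by apply: integrable_prodfun => j; exact: integrable_kern_bump.
apply: eq_Rintegral => u _; rewrite /ext mulrCA; congr (_ * _).
by rewrite /Kern /prodfun -big_split.
Qed.

Lemma conv_ext_low lambda n s x : (0 < d)%N -> (s < n)%N ->
  conv s (ext lambda n) x = 0.
Proof.
move=> d0 sn; rewrite conv_ext (bigD1 (Ordinal d0))//=.
by rewrite bump_conv_low// mul0r mulr0.
Qed.

Lemma conv_ext_high lambda n s x : (n < s)%N ->
  conv s (ext lambda n) x = ext lambda n x.
Proof.
move=> ns; rewrite conv_ext; congr (_ * _); apply: eq_bigr => j _.
by rewrite bump_conv_high.
Qed.

Lemma conv_ext_eq lambda n x :
  conv n (ext lambda n) x = lambda * prodfun (fun=> bump_avg n) x.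
Proof. by rewrite conv_ext. Qed.

Lemma block_ext_low lambda n s x : (0 < d)%N -> (s < n)%N ->
  block s (ext lambda n) x = 0.
Proof.
move=> d0; case: s => [|s] sn /=; first exact: conv_ext_low.
by rewrite !conv_ext_low ?subrr// ltnW.
Qed.

Lemma block_ext_eq lambda n x : (0 < d)%N -> (0 < n)%N ->
  block n (ext lambda n) x = lambda * prodfun (fun=> bump_avg n) x.
Proof.
move=> d0; case: n => // n _; rewrite [LHS]/= conv_ext_eq.
by rewrite (@conv_ext_low _ n.+1 n)// subr0.
Qed.

Lemma block_ext_next lambda n x : block n.+1 (ext lambda n) x =
  lambda * (prodfun (fun=> bump n) x - prodfun (fun=> bump_avg n) x).
Proof. by rewrite /= conv_ext_high// conv_ext_eq mulrBr. Qed.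

Lemma block_ext_high lambda n s x : (n.+1 < s)%N ->
  block s (ext lambda n) x = 0.
Proof.
case: s => // s; rewrite ltnS => ns /=.
by rewrite !conv_ext_high ?subrr// ltnW.
Qed.

(** Interpolation |g|^p <= (B M)^(p-1) |g|. Here [M] is the amplitude 2^(n d / p), so that M^(-p) is
    the volume of a cube of side 2^-n. *)
Lemma Lp_of_sup_L1 p (B M : R) g : 1 <= p -> 0 <= B -> 0 < M ->
  measurable_fun setT g -> (forall x, `|g x| <= B * M) ->
  (\int[lam]_x `|g x|%:E <= (B * M / M `^ p)%:E)%E -> Lp_le p B g.
Proof.
move=> p1 B0 M0 mg gBM gI; split => //; have p0 : 0 < p by exact: lt_le_trans p1.
have BM0 : 0 <= B * M by rewrite mulr_ge0// ltW.
have splitp (y : R) : 0 <= y -> y `^ p = y `^ (p - 1) * y.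
  move=> y0; rewrite -{3}(powRr1 y0) -powRD ?subrK//.
  by apply/implyP => /eqP p_0; rewrite p_0 ltxx in p0.
have BMp0 : 0 <= (B * M) `^ (p - 1) by rewrite powR_ge0.
apply: (@le_trans _ _ (\int[lam]_x (((B * M) `^ (p - 1))%:E * `|g x|%:E))%E).
  apply: ge0_le_integral => //.
  - by apply/measurable_EFinP; exact: measurable_norm_powR.
  - by apply: measurable_funeM; apply/measurable_EFinP; exact: measurableT_comp.
  - move=> x _; rewrite -EFinM lee_fin splitp// ler_wpM2r//.
    by rewrite ge0_ler_powR ?nnegrE// subr_ge0.
rewrite ge0_integralZl_EFin//; last by apply/measurable_EFinP; exact: measurableT_comp.
apply: (@le_trans _ _ (((B * M) `^ (p - 1))%:E * (B * M / M `^ p)%:E)%E).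
  by rewrite lee_wpmul2l.
rewrite -EFinM lee_fin mulrA -splitp// powRM ?(ltW M0)// mulfK// gt_eqF// powR_gt0//.
Qed.

End extremal_function.

Section extremal_bounds.
Context {R : realType} {d : nat}.
Notation lam := (lebesgue_Rd R d).
Implicit Types (x u : Rd R d) (n s : nat) (p : R).

(** A sum, so as to bound the product of bumps, the product of averages and their difference, which
    is block n + 1. *)
Definition ext_cst : R := 25 ^+ d + 75 ^+ d.

Lemma ext_cst_gt0 : 0 < ext_cst.
Proof. by rewrite addr_gt0 ?exprn_gt0. Qed.

Lemma scaled_Lp_le p (kappa : R) n (P : Rd R d -> R) : 1 <= p -> 0 <= kappa ->
  measurable_fun setT P -> (forall x, `|P x| <= ext_cst) ->
  (\int[lam]_x `|P x|%:E <= (ext_cst / 2 ^+ (n * d))%:E)%E ->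
  Lp_le p (kappa * ext_cst)
    (fun x => kappa * 2 `^ ((n * d)%:R / p) * P x).
Proof.
move=> p1 k0 mP Pc PI; have p0 : 0 < p by exact: lt_le_trans p1.
set M := 2 `^ _; have M0 : 0 < M by rewrite powR_gt0.
have kM0 : 0 <= kappa * M by rewrite mulr_ge0// ltW.
have c0 := ext_cst_gt0.
apply: (@Lp_of_sup_L1 _ _ p _ M) => //.
- by rewrite mulr_ge0// ltW.
- exact: measurable_funM.
- by move=> x; rewrite normrM (ger0_norm kM0) [leRHS]mulrAC ler_wpM2l.
- under eq_integral do rewrite normrM (ger0_norm kM0) EFinM.
  rewrite ge0_integralZl_EFin//; last by apply/measurable_EFinP; exact: measurableT_comp.
  apply: (@le_trans _ _ ((kappa * M)%:E * (ext_cst / 2 ^+ (n * d))%:E)%E).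
    by rewrite lee_wpmul2l ?lee_fin.
  rewrite -EFinM lee_fin /M -powRrM divfK ?gt_eqF// powR_mulrn//.
  by rewrite -/M mulrA (mulrAC kappa).
Qed.

Lemma norm_bump_prod_le n x : `|prodfun (fun=> bump n) x| <= 25 ^+ d.
Proof. by apply: norm_prodfun_le => y; exact: norm_bump_le. Qed.

Lemma norm_bump_avg_prod_le n x : `|prodfun (fun=> bump_avg n) x| <= 75 ^+ d.
Proof. by apply: norm_prodfun_le => y; exact: norm_bump_avg_le. Qed.

Lemma integral_bump_prod_le n :
  (\int[lam]_x `|prodfun (fun=> bump n) x|%:E <= (25 ^+ d / 2 ^+ (n * d))%:E)%E.
Proof.
rewrite exprM -expr_div_n; apply: integral_norm_prodfun_le.
  exact: measurable_bump.
exact: integral_norm_bump.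
Qed.

Lemma integral_bump_avg_prod_le n :
  (\int[lam]_x `|prodfun (fun=> bump_avg n) x|%:E <= (75 ^+ d / 2 ^+ (n * d))%:E)%E.
Proof.
rewrite exprM -expr_div_n; apply: integral_norm_prodfun_le.
  exact: measurable_bump_avg.
exact: integral_norm_bump_avg.
Qed.

Let mb n : measurable_fun setT (prodfun (fun=> bump n) : Rd R d -> R).
Proof. by apply: measurable_prodfun => _; exact: measurable_bump. Qed.

Let mba n : measurable_fun setT (prodfun (fun=> bump_avg n) : Rd R d -> R).
Proof. by apply: measurable_prodfun => _; exact: measurable_bump_avg. Qed.

Let e25 : 0 <= (25 ^+ d : R). Proof. by rewrite exprn_ge0. Qed.
Let e75 : 0 <= (75 ^+ d : R). Proof. by rewrite exprn_ge0. Qed.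
Let eN n : 0 <= (2 ^+ (n * d))^-1 :> R. Proof. by rewrite invr_ge0 exprn_ge0. Qed.

Lemma ext_Lp_le p (kappa : R) n : 1 <= p -> 0 <= kappa ->
  Lp_le p (kappa * ext_cst) (ext (d := d) (kappa * 2 `^ ((n * d)%:R / p)) n).
Proof.
move=> p1 k0; apply: scaled_Lp_le => //.
- by move=> x; rewrite (le_trans (norm_bump_prod_le n x))// lerDl.
- apply: le_trans (integral_bump_prod_le n) _.
  by rewrite lee_fin ler_wpM2r// lerDl.
Qed.

Lemma block_ext_Lp_le p (kappa : R) n s : (0 < d)%N -> (0 < n)%N -> 1 <= p -> 0 <= kappa ->
  Lp_le p (kappa * ext_cst) (block s (ext (d := d) (kappa * 2 `^ ((n * d)%:R / p)) n)).
Proof.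
move=> d0 n0 p1 k0; have c0 := ext_cst_gt0.
have Lp0 : Lp_le p (kappa * ext_cst) (fun _ : Rd R d => 0).
  split => //; under eq_integral do rewrite normr0 powR0 ?gt_eqF ?(lt_le_trans ltr01 p1)//.
  by rewrite integral0 lee_fin powR_ge0.
have [sn|ns|->] := ltngtP s n.
- by rewrite (_ : block s _ = fun=> 0)//; apply/funext => x; exact: block_ext_low.
- have [->|sn1] := eqVneq s n.+1.
    rewrite (_ : block n.+1 _ = fun x => kappa * 2 `^ ((n * d)%:R / p) *
        (prodfun (fun=> bump n) x - prodfun (fun=> bump_avg n) x)); last first.
      by apply/funext => x; rewrite block_ext_next.
    apply: scaled_Lp_le => //; first exact: measurable_funB.
      move=> x; rewrite (le_trans (ler_normB _ _))// lerD//.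
        exact: norm_bump_prod_le.
      exact: norm_bump_avg_prod_le.
    apply: (@le_trans _ _ (\int[lam]_x (`|prodfun (fun=> bump n) x|%:E +
        `|prodfun (fun=> bump_avg n) x|%:E))%E).
      apply: ge0_le_integral => //.
      - by apply/measurable_EFinP; apply: measurableT_comp => //; exact: measurable_funB.
      - by apply: emeasurable_funD; apply/measurable_EFinP; exact: measurableT_comp.
      - by move=> x _; rewrite -EFinD lee_fin ler_normB.
    rewrite ge0_integralD//; [|by apply/measurable_EFinP; exact: measurableT_comp..].
    by rewrite mulrDl EFinD leeD ?integral_bump_prod_le ?integral_bump_avg_prod_le.
  rewrite (_ : block s _ = fun=> 0)//; apply/funext => x; apply: block_ext_high.
  by rewrite ltn_neqAle eq_sym sn1.
- rewrite (_ : block n _ = fun x => kappa * 2 `^ ((n * d)%:R / p) *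
      prodfun (fun=> bump_avg n) x); last first.
    by apply/funext => x; rewrite block_ext_eq.
  apply: scaled_Lp_le => //.
    by move=> x; rewrite (le_trans (norm_bump_avg_prod_le n x))// lerDr.
  apply: le_trans (integral_bump_avg_prod_le n) _.
  by rewrite lee_fin ler_wpM2r// lerDr.
Qed.

(** A bound valid almost everywhere must hold at some point of the cube given by [bump_pos], which
    has positive measure. *)
Lemma ext_sup_ge : exists2 c : R, 0 < c & forall (lambda : R) n (E : R), 0 <= lambda ->
  {ae lam, forall x, `|ext lambda n x| <= E} -> lambda * c <= E.
Proof.
have [c c0 hc] := @bump_pos R.
exists (c ^+ d); first by rewrite exprn_gt0.
move=> lambda n E l0 [N [mN N0 subN]].
pose Q := box (fun _ : 'I_d => (4 * 2 ^+ n)^-1 : R) (fun=> (2 * 2 ^+ n)^-1).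
have Q0 : (0 < lam Q)%E.
  rewrite /Q /box (@lebesgue_Rd_box R d
    (fun=> `](4 * 2 ^+ n)^-1, (2 * 2 ^+ n)^-1]%classic))//.
  rewrite (eq_bigr (fun _ => ((2 * 2 ^+ n)^-1 - (4 * 2 ^+ n)^-1)%:E)); last first.
    move=> j _; rewrite lebesgue_measure_itv/= lte_fin ltf_pV2 ?posrE ?mulr_gt0 ?exprn_gt0//.
    by rewrite ltr_pM2r ?exprn_gt0// ltr_nat -EFinD.
  rewrite prodEFin lte_fin prodr_gt0// => j _; rewrite subr_gt0.
  rewrite ltf_pV2 ?posrE ?mulr_gt0 ?exprn_gt0//.
  by rewrite ltr_pM2r ?exprn_gt0// ltr_nat.
have [x Qx Nx] : exists2 x, Q x & ~ N x.
  apply: contrapT => h.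
  have QN : Q `<=` N.
    by move=> x Qx; apply: contrapT => nN; apply: h; exists x.
  have : (lam Q <= 0)%E.
    by rewrite -N0; exact: (le_measure lam (mem_set (measurable_box _ _)) (mem_set mN) QN).
  by rewrite leNgt Q0.
have Ex : `|ext lambda n x| <= E by apply: contrapT => h; apply: Nx; exact: subN.
apply: le_trans Ex; rewrite /ext normrM (ger0_norm l0) ler_wpM2l//.
rewrite normr_prodfun -[X in _ ^+ X](card_ord d) -prodr_const.
apply: ler_prod => j _; rewrite (ltW c0)/= (le_trans _ (ler_norm _))//.
by apply: hc; exact: Qx.
Qed.

End extremal_bounds.

Lemma ge0_in_itv0y {R : realType} (N : \bar R) : (0 <= N)%E -> N \in `[0%E, +oo%E].
Proof. by move=> N0; rewrite in_itv/= N0 leey. Qed.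

(** * The two estimates *)

Section vp_operators.
Context {R : realType} {d : nat}.
Notation lam := (lebesgue_Rd R d).
Implicit Types (x u : Rd R d) (f : Rd R d -> R[i]) (g : Rd R d -> R) (p : R) (n s : nat).

Lemma VP_sum_conv p (B : R) s f x : 1 <= p -> Lp_le p B (reC f) -> Lp_le p B (imC f) ->
  VP_sum s f x = Complex (conv s (reC f) x) (conv s (imC f) x).
Proof.
move=> p1 fr fi; apply: VP_sumE; [by case: fr|by case: fi|..].
- exact: (integrable_conv s x p1 fr).
- exact: (integrable_conv s x p1 fi).
Qed.

Lemma VP_block_block p (B : R) s f x : 1 <= p -> Lp_le p B (reC f) -> Lp_le p B (imC f) ->
  VP_block s f x = Complex (block s (reC f) x) (block s (imC f) x).
Proof.
move=> p1 fr fi; case: s => [|s] /=; first exact: (VP_sum_conv 0 x p1 fr fi).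
by rewrite (VP_sum_conv s.+1 x p1 fr fi) (VP_sum_conv s x p1 fr fi).
Qed.

Lemma measurable_block s (g : Rd R d -> R) :
  measurable_fun setT g -> measurable_fun setT (block s g).
Proof.
by move=> mg; case: s => [|s]; [|apply: measurable_funB]; exact: measurable_conv.
Qed.

Lemma VP_block_ReIm_Lp_le p (A B : R) s f : 1 <= p -> 0 <= B ->
  Lp_le p A (reC f) -> Lp_le p A (imC f) ->
  (CLnorm lam p%:E (VP_block s f) <= B%:E)%E ->
  Lp_le p B (block s (reC f)) /\ Lp_le p B (block s (imC f)).
Proof.
move=> p1 B0 fr fi.
have -> : VP_block s f = fun x => Complex (block s (reC f) x) (block s (imC f) x).
  by apply/funext => x; exact: VP_block_block p1 fr fi.
move: (block s (reC f)) (block s (imC f))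
  (measurable_block s fr.1) (measurable_block s fi.1) => u v mu mv uvB.
exact: (@Lp_le_ReIm _ _ p B (fun x => Complex (u x) (v x)) p1 B0).
Qed.

Lemma VP_partialS n f x : VP_partial n.+1 f x = VP_sum n f x.
Proof.
rewrite /VP_partial; elim: n => [|n IH]; first by rewrite big_nat1.
by rewrite big_nat_recr//= IH addrC subrK.
Qed.

Lemma CLnorm_ge0 q f : (0 <= CLnorm lam q f)%E.
Proof. exact: Lnorm_ge0. Qed.

Lemma CLnorm_le_Lp p (B : R) f g : 1 <= p -> 0 <= B ->
  (forall x, Normc.normc (f x) = `|g x|) -> Lp_le p B g ->
  (CLnorm lam p%:E f <= B%:E)%E.
Proof.
move=> p1 B0 fg [mg gB]; have p0 : 0 < p by exact: lt_le_trans p1.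
have E : (CLnorm lam p%:E f `^ p <= B%:E `^ p)%E.
  rewrite /CLnorm poweR_Lnorm; last by rewrite gt_eqF.
  rewrite poweR_EFin; apply: le_trans gB; rewrite le_eqVlt; apply/orP; left; apply/eqP.
  apply: eq_integral => x _; rewrite -poweR_EFin; congr (_ `^ _)%E.
  by rewrite -[LHS]/(`|Normc.normc (f x)|%:E) fg normr_id.
have rt (N : \bar R) : (0 <= N)%E -> N = ((N `^ p) `^ p^-1)%E.
  by move=> N0; rewrite -poweRrM mulfV ?gt_eqF// poweRe1.
rewrite (rt _ (CLnorm_ge0 _ _)) (rt B%:E)//.
apply: gt0_ler_poweR => //; first by rewrite invr_ge0 ltW.
- by apply: ge0_in_itv0y; exact: poweR_ge0.
- by apply: ge0_in_itv0y; exact: poweR_ge0.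
Qed.

Lemma CLnorm_infty_ae f (E : R) : (CLnorm lam +oo f <= E%:E)%E ->
  {ae lam, forall x, Normc.normc (f x) <= E}.
Proof.
rewrite /CLnorm unlock /=; case: ifPn => [_ /ess_supP|h0 _].
  apply: (@filterS _ (almost_everywhere lam) (ae_filter_ringOfSetsType lam)) => x.
  by rewrite /= lee_fin ger0_norm ?normc_ge0.
(* If the whole space had measure 0, it would itself be an exceptional null set. *)
exists setT; split => //; apply/eqP.
by rewrite eq_le measure_ge0 andbT leNgt.
Qed.

Lemma besov_block_le (Omega : R -> R) p theta f s : (1 <= theta)%E ->
  (forall t, 0 < t -> 0 < Omega t) ->
  (besov_norm Omega p%:E theta f <= 1)%E ->
  (CLnorm lam p%:E (VP_block s f) <= (Omega (2 ^- s))%:E)%E.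
Proof.
move=> th1 Om0; set N := CLnorm lam p%:E (VP_block s f).
have N0 : (0 <= N)%E by exact: CLnorm_ge0.
have O0 : 0 < Omega (2 ^- s) by apply: Om0; rewrite invr_gt0 exprn_gt0.
case: theta th1 => [t| |//] th1 /=; last first.
  move=> /ereal_supP/(_ _ (imageT _ s)) /=; rewrite -/N.
  move=> /(lee_wpmul2l (ltW (O0 : (0 < (Omega (2 ^- s))%:E)%E))).
  by rewrite muleA -EFinM mulfV ?gt_eqF// mul1e mule1.
move=> S1; have t1 : 1 <= t by rewrite -lee_fin.
have t0 : 0 < t by exact: lt_le_trans t1.
pose u k := ((Omega (2 ^- k) `^ (- t))%:E *
  CLnorm lam p%:E (VP_block k f) `^ t)%E.
have u0 k : (0 <= u k)%E by rewrite mule_ge0 ?poweR_ge0// lee_fin powR_ge0.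
have S1' : (\sum_(0 <= k <oo) u k <= 1)%E.
  have S0 : (0 <= \sum_(0 <= k <oo) u k)%E by exact: nneseries_ge0.
  have -> : (\sum_(0 <= k <oo) u k = ((\sum_(0 <= k <oo) u k) `^ t^-1) `^ t)%E.
    by rewrite -poweRrM mulVf ?lt0r_neq0// poweRe1.
  apply: (@le_trans _ _ (1 `^ t)%E); last by rewrite poweR1r.
  apply: gt0_ler_poweR => //; first exact: ltW.
  - by apply: ge0_in_itv0y; exact: poweR_ge0.
  - by apply: ge0_in_itv0y; exact: lee01.
have us : (u s <= 1)%E.
  apply: le_trans S1'; apply: le_trans (nneseries_lim_ge s.+1 _); last by [].
  by rewrite big_nat_recr//= leeDr// sume_ge0.
have Nt : (N `^ t <= (Omega (2 ^- s))%:E `^ t)%E.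
  rewrite poweR_EFin -[leRHS]mule1.
  have : ((Omega (2 ^- s) `^ t)%:E * u s <= (Omega (2 ^- s) `^ t)%:E * 1)%E.
    by rewrite lee_wpmul2l// lee_fin powR_ge0.
  by rewrite /u muleA -EFinM powRN mulfV ?gt_eqF ?powR_gt0// mul1e.
have rt (M : \bar R) : (0 <= M)%E -> M = ((M `^ t) `^ t^-1)%E.
  by move=> M0; rewrite -poweRrM mulfV ?gt_eqF// poweRe1.
rewrite (rt _ N0) (rt (Omega (2 ^- s))%:E) ?lee_fin ?(ltW O0)//.
apply: gt0_ler_poweR => //; first by rewrite invr_ge0 ltW.
- by apply: ge0_in_itv0y; exact: poweR_ge0.
- by apply: ge0_in_itv0y; exact: poweR_ge0.
Qed.

(** The factor 1/2 handles all [theta] at once: for finite t >= 1 each of the two terms is at most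
    (1/2)^t <= 1/2, and for the supremum it is more than enough. *)
Lemma besov_norm_le1 (Omega : R -> R) p theta f n : (1 <= theta)%E ->
  (forall t, 0 < t -> 0 < Omega t) ->
  (forall s, (s == n) || (s == n.+1) ->
    (CLnorm lam p%:E (VP_block s f) <= (2^-1 * Omega (2 ^- s))%:E)%E) ->
  (forall s, (s != n) && (s != n.+1) -> CLnorm lam p%:E (VP_block s f) = 0%E) ->
  (besov_norm Omega p%:E theta f <= 1)%E.
Proof.
move=> th1 Om0 fn f0.
have O0 s : 0 < Omega (2 ^- s) by apply: Om0; rewrite invr_gt0 exprn_gt0.
case: theta th1 => [t| |//] th1 /=; last first.
  apply/ereal_supP => _ [s _ <-].
  have [sn|] := boolP ((s == n) || (s == n.+1)); last first.
    by rewrite negb_or => /f0 ->; rewrite mule0.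
  apply: le_trans (_ : (((Omega (2 ^- s))^-1)%:E * (2^-1 * Omega (2 ^- s))%:E <= 1)%E).
    by rewrite lee_wpmul2l ?fn// lee_fin invr_ge0 ltW.
  by rewrite -EFinM mulrCA mulVf ?gt_eqF// mulr1 lee_fin invf_le1// ler1n.
have t1 : 1 <= t by rewrite -lee_fin.
have t0 : 0 < t by exact: lt_le_trans t1.
pose u k := ((Omega (2 ^- k) `^ (- t))%:E *
  CLnorm lam p%:E (VP_block k f) `^ t)%E.
have u0 k : (0 <= u k)%E by rewrite mule_ge0 ?poweR_ge0// lee_fin powR_ge0.
have uz k : (k != n) && (k != n.+1) -> u k = 0%E.
  by move=> /f0 h; rewrite /u h poweR0r ?mule0// gt_eqF.
have uh k : (k == n) || (k == n.+1) -> (u k <= 2^-1%:E)%E.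
  move=> /fn h; have h0 : 0 <= 2^-1 * Omega (2 ^- k) by rewrite mulr_ge0// ltW.
  have : (CLnorm lam p%:E (VP_block k f) `^ t <= (2^-1 * Omega (2 ^- k))%:E `^ t)%E.
    apply: gt0_ler_poweR => //; first exact: ltW.
    - by apply: ge0_in_itv0y; exact: CLnorm_ge0.
    - by apply: ge0_in_itv0y.
  rewrite poweR_EFin => h1.
  apply: (@le_trans _ _ ((Omega (2 ^- k) `^ (- t))%:E * ((2^-1 * Omega (2 ^- k)) `^ t)%:E)%E).
    by rewrite lee_wpmul2l// lee_fin powR_ge0.
  rewrite -EFinM lee_fin powRM ?(ltW (O0 k))// mulrCA powRN mulVf ?gt_eqF ?powR_gt0//.
  rewrite mulr1 -[leRHS]powRr1//; apply: ger_powR => //.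
  by rewrite invr_gt0 ltr0n/= invf_le1// ler1n.
have S1 : (\sum_(0 <= k <oo) u k <= 1)%E.
  rewrite (nneseries_split 0 n.+2)//= add0n.
  rewrite [X in (_ + X)%E]eseries0 ?adde0; last first.
    move=> k nk _; apply: uz; apply/andP; split; apply/eqP => kn.
      by move: nk; rewrite kn ltnNge leqnSn.
    by move: nk; rewrite kn ltnn.
  rewrite big_nat_recr//= big_nat_recr//=.
  rewrite big_nat_cond big1 ?add0e; last first.
    move=> k /andP[/andP[_ kn] _]; apply: uz.
    by rewrite (ltn_eqF kn) (ltn_eqF (ltnW _)).
  apply: (@le_trans _ _ (2^-1%:E + 2^-1%:E)%E).
    by rewrite leeD// uh// eqxx ?orbT.
  by rewrite -EFinD lee_fin; lra.
rewrite -(poweR1r t^-1); apply: gt0_ler_poweR => //; first by rewrite invr_ge0 ltW.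
- by apply: ge0_in_itv0y; apply: nneseries_ge0 => k _ _; exact: u0.
- by apply: ge0_in_itv0y; exact: lee01.
Qed.

End vp_operators.

(** * Upper and lower bounds for the Besov class *)

Section main_bounds.
Context {R : realType} {d : nat}.
Notation lam := (lebesgue_Rd R d).
Context (p alpha : R) (theta : \bar R) (l : nat) (Omega : R -> R).
Context (d0 : (0 < d)%N) (p1 : 1 <= p) (th1 : (1 <= theta)%E)
  (dpa : d%:R / p < alpha) (Phi_Omega : Phi alpha l Omega).

Let Om s : R := Omega (2 ^- s).

Let Om_gt0 s : 0 < Om s.
Proof. by apply: (Phi_gt0 Phi_Omega); rewrite invr_gt0 exprn_gt0. Qed.

Lemma vp_upper_bound : exists2 C : R, 0 < C &
  forall n, (0 < n)%N -> (VP_class_error +oo n (besov_ball (d := d) Omega p%:E theta)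
    <= (C * Omega (2 ^- n) * 2 `^ ((n * d)%:R / p))%:E)%E.
Proof.
have [C2 C20 HS] := Phi_S_alpha Phi_Omega.
set b := 2 `^ (d%:R / p); have b0 : 0 < b by rewrite powR_gt0.
have bg : b < 2 `^ alpha by rewrite /b /powR (gt_eqF (ltr0Sn R 1)) ltr_expR ltr_pM2r// ln_gt0// ltr1n.
have g0 : 0 < (2 : R) `^ alpha by rewrite powR_gt0.
have pk (k : nat) : (2 ^- k : R) `^ alpha = (2 `^ alpha) ^- k.
  have -> : (2 `^ alpha) ^+ k = (2 ^+ k) `^ alpha :> R.
    by rewrite -powR_mulrn// -powRrM mulrC powRrM powR_mulrn// powR_ge0.
  have nz : (2 ^+ k : R) `^ alpha != 0 by rewrite gt_eqF// powR_gt0// exprn_gt0.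
  apply: (mulIf nz); rewrite mulVf// -powRM ?invr_ge0 ?exprn_ge0//.
  by rewrite mulVf ?powR1// gt_eqF// exprn_gt0.
have OmS m s : (m <= s)%N -> Om s <= C2 * Om m * ((2 `^ alpha) ^+ m / (2 `^ alpha) ^+ s).
  move=> ms; have := HS (2 ^- s) (2 ^- m).
  rewrite invr_gt0 exprn_gt0// lef_pV2 ?posrE ?exprn_gt0// ler_weXn2l ?ler1n//.
  rewrite invf_le1 ?exprn_gt0// exprn_ege1 ?ler1n// => /(_ isT isT isT).
  rewrite !pk !invrK -ler_pdivlMr ?exprn_gt0// => /le_trans; apply.
  by rewrite !mulrA.
pose D := (3 ^+ d + 1) * b * C2 / (1 - b / 2 `^ alpha).
have D0 : 0 < D.
  have e1 : 0 < 3 ^+ d + 1 :> R by rewrite addr_gt0 ?exprn_gt0.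
  have g1 : 0 < 1 - b / 2 `^ alpha.
    by rewrite subr_gt0 ltr_pdivrMr ?mul1r// powR_gt0.
  by rewrite /D divr_gt0// !mulr_gt0// powR_gt0.
(* Real and imaginary parts contribute [D] each. *)
exists (2 * D); first by rewrite mulr_gt0.
case=> // n _; apply/ereal_supP => _ [f [[mr mi fp] fB] <-].
(* The 1 makes the bound positive even when [f] has norm 0. *)
pose A := fine (CLnorm lam p%:E f) + 1.
have Nfin : CLnorm lam p%:E f \is a fin_num by rewrite ge0_fin_numE ?CLnorm_ge0.
have A0 : 0 < A by rewrite ltr_wpDl// fine_ge0 ?CLnorm_ge0.
have fA : (CLnorm lam p%:E f <= A%:E)%E.
  by rewrite -(fineK Nfin) lee_fin lerDl.
have [fr fi] := Lp_le_ReIm p1 (ltW A0) mr mi fA.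
have blk s : Lp_le p (Om s) (block s (reC f)) /\ Lp_le p (Om s) (block s (imC f)).
  apply: (VP_block_ReIm_Lp_le p1 (ltW (Om_gt0 s)) fr fi).
  exact: (besov_block_le s th1 (Phi_gt0 Phi_Omega) fB).
have aer := vp_error_ae n p1 A0 fr Om_gt0 (fun s => (blk s).1) (ltW C20) bg OmS.
have aei := vp_error_ae n p1 A0 fi Om_gt0 (fun s => (blk s).2) (ltW C20) bg OmS.
have X0 : 0 <= D * (Om n.+1 * 2 `^ ((n.+1 * d)%:R / p)).
  exact: (mulr_ge0 (ltW D0) (mulr_ge0 (ltW (Om_gt0 _)) (powR_ge0 _ _))).
rewrite (_ : 2 * D * _ * _ = D * (Om n.+1 * 2 `^ ((n.+1 * d)%:R / p)) +
  D * (Om n.+1 * 2 `^ ((n.+1 * d)%:R / p))); last by rewrite /Om; ring.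
apply: CLnorm_infty_le; first by rewrite addr_ge0.
move: aer aei; apply: (@filterS2 _ (almost_everywhere lam) (ae_filter_ringOfSetsType lam)).
move=> x xr xi; rewrite VP_partialS (VP_sum_conv n x p1 fr fi).
apply: le_trans (normc_le _) _.
by move: xr xi; rewrite -/b -/D /reC /imC; case: (f x) => y z /= xr xi; rewrite lerD.
Qed.

Lemma vp_lower_bound : exists2 c : R, 0 < c &
  forall n, (0 < n)%N -> ((c * Omega (2 ^- n) * 2 `^ ((n * d)%:R / p))%:E
    <= VP_class_error +oo n (besov_ball (d := d) Omega p%:E theta))%E.
Proof.
have [C1 C10 Hdil] := Phi_dilation Phi_Omega.
have [c c0 hc] := @ext_sup_ge R d.
have K0 := @ext_cst_gt0 R d.
pose L : R := C1 * 2 ^+ l; have L0 : 0 < L by rewrite mulr_gt0// exprn_gt0.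
(* Blocks [n] and n + 1 must have norms at most half of [Om n] and [Om n.+1]. Dilation by 2 gives Om
   n <= L * Om n.+1, and L + 1 dominates both 1 and [L]. *)
pose k : R := (2 * @ext_cst R d * (L + 1))^-1.
have L1 : 0 < L + 1 by rewrite addr_gt0.
have k0 : 0 < k by rewrite invr_gt0 !mulr_gt0.
exists (k * c); first by rewrite mulr_gt0.
move=> n n0; pose kappa := k * Om n.
have ka0 : 0 <= kappa by rewrite mulr_ge0// ltW.
pose g : Rd R d -> R := ext (kappa * 2 `^ ((n * d)%:R / p)) n.
pose f : Rd R d -> R[i] := fun x => Complex (g x) 0.
have kapE : kappa * @ext_cst R d = (2 * (L + 1))^-1 * Om n.
  rewrite /kappa /k; move: (@ext_cst R d) K0 => e e0.
  by field; rewrite !gt_eqF.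
have ka1 s : (s == n) || (s == n.+1) -> kappa * @ext_cst R d <= 2^-1 * Om s.
  rewrite kapE invfM -mulrA ler_pM2l ?invr_gt0// ler_pdivrMl//.
  case/orP => /eqP ->.
    by rewrite ler_peMl ?(ltW (Om_gt0 n))// lerDr ltW.
  have := Hdil 2%N (2 ^- n.+1); rewrite invr_ge0 exprn_ge0// => /(_ isT).
  have -> : 2%:R * 2 ^- n.+1 = 2 ^- n :> R by rewrite exprS invfM mulVKf.
  rewrite -/(Om n) -/(Om n.+1) -/L => h.
  by rewrite mulrDl mul1r (le_trans h)// lerDl ltW.
have gLp := @ext_Lp_le R d p kappa n p1 ka0.
have Lp0 : Lp_le p (kappa * @ext_cst R d) (fun _ : Rd R d => 0).
  split => //; under eq_integral do rewrite normr0 powR0 ?gt_eqF ?(lt_le_trans ltr01 p1)//.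
  by rewrite integral0 lee_fin powR_ge0.
have KB0 : 0 <= kappa * @ext_cst R d by rewrite mulr_ge0// ltW.
have normcE (y : R) : Normc.normc (Complex y 0) = `|y|.
  by rewrite /= expr0n/= addr0 sqrtr_sqr.
have conv0 s x : conv s (fun _ : Rd R d => 0) x = 0 :> R.
  by rewrite /conv; under eq_Rintegral do rewrite mulr0; rewrite /Rintegral integral0.
have block0 s x : block s (fun _ : Rd R d => 0) x = 0 :> R.
  by case: s => [|s] /=; rewrite !conv0// subrr.
have blkE s x : VP_block s f x = Complex (block s g x) 0.
  by rewrite (VP_block_block s x p1 (f := f) gLp Lp0) block0.
have fball : besov_ball (d := d) Omega p%:E theta f.
  split.
    split; [exact: measurable_ext|exact: measurable_cst|].
    apply: le_lt_trans (ltry (kappa * @ext_cst R d)).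
    exact: (@CLnorm_le_Lp _ _ p _ f g p1 KB0 (fun x => normcE (g x)) gLp).
  apply: (@besov_norm_le1 _ _ _ _ _ _ n) => //; first exact: Phi_gt0 Phi_Omega.
    move=> s sn; apply: (@le_trans _ _ (kappa * @ext_cst R d)%:E).
      apply: (@CLnorm_le_Lp _ _ p _ (VP_block s f) (block s g) p1 KB0).
        by move=> x; rewrite blkE normcE.
      exact: (block_ext_Lp_le s d0 n0 p1 ka0).
    by rewrite lee_fin ka1.
  move=> s /andP[sn sn1]; apply/eqP; rewrite eq_le CLnorm_ge0 andbT.
  have p0 : 0 < p by exact: lt_le_trans p1.
  apply: (@CLnorm_le_Lp _ _ p 0 (VP_block s f) (fun=> 0) p1 (lexx 0)).
    move=> x; rewrite blkE normcE; congr (`| _ |).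
    have [sln|nls|/eqP] := ltngtP s n; [exact: block_ext_low| |by rewrite (negbTE sn)].
    by apply: block_ext_high; rewrite ltn_neqAle eq_sym sn1.
  split => //; under eq_integral do rewrite normr0 powR0 ?gt_eqF//.
  by rewrite integral0 lee_fin powR_ge0.
apply: le_trans (ereal_sup_ubound (imageP _ fball)).
(* The partial sum is sigma_(2^(n-1)) f, which is 0 because level n - 1 is below the spectrum; n >=
   1 is used to name this level. *)
have errE x : f x - VP_partial n f x = Complex (g x) 0.
  case: n n0 @kappa ka0 @g @f kapE ka1 gLp Lp0 KB0 blkE fball => // n _ kappa ka0 g f kapE ka1 gLp Lp0 KB0 blkE fball.
  rewrite VP_partialS (VP_sum_conv n x p1 (f := f) gLp Lp0) conv0.
  have -> : conv n (reC f) x = 0 by exact: conv_ext_low.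
  by apply/eqP; rewrite eq_complex /= !subr0 !eqxx.
have err0 : (0 <= VP_error +oo n f)%E by exact: CLnorm_ge0.
(* An infinite error satisfies the bound trivially; otherwise it bounds [f] almost everywhere. *)
case E : (VP_error +oo n f) err0 => [r| |//] r0; last exact: leey.
rewrite lee_fin.
have r0' : 0 <= kappa * 2 `^ ((n * d)%:R / p) by rewrite mulr_ge0 ?powR_ge0.
have -> : k * c * Omega (2 ^- n) * 2 `^ ((n * d)%:R / p) =
    kappa * 2 `^ ((n * d)%:R / p) * c by rewrite /kappa /Om; ring.
apply: (hc _ n) => //.
have h : (VP_error +oo n f <= r%:E)%E by rewrite E.
have := CLnorm_infty_ae h.
apply: (@filterS _ (almost_everywhere lam) (ae_filter_ringOfSetsType lam)) => x.
by rewrite errE normcE.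
Qed.

End main_bounds.

Theorem mainTheorem1 (R : realType) (d : nat) (p : R) (theta : \bar R)
    (l : nat) (alpha : R) (Omega : R -> R) :
  (0 < d)%N -> 1 <= p -> (1 <= theta)%E -> (0 < l)%N ->
  d%:R / p < alpha -> Phi alpha l Omega ->
  exists c C : R, [/\ 0 < c, 0 < C &
    forall n : nat, (0 < n)%N ->
      ((c * Omega (2 ^- n) * 2 `^ ((n * d)%:R / p))%:E
        <= VP_class_error +oo n
             (besov_ball (d := d) Omega p%:E theta))%E /\
      (VP_class_error +oo n (besov_ball (d := d) Omega p%:E theta)
        <= (C * Omega (2 ^- n) * 2 `^ ((n * d)%:R / p))%:E)%E].
Proof.
move=> d0 p1 th1 l0 dpa PhiO.
have [c c0 hc] := vp_lower_bound d0 p1 th1 PhiO.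
have [C C0 hC] := vp_upper_bound p1 th1 dpa PhiO.
by exists c, C; split=> // n n0; split; [exact: hc|exact: hC].
Qed.
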